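(* Let $B=(B_1,B_2,B_3)$ be a magnetic field on $\mathbb{R}^3$. Suppose that $\operatorname{div}B(x)=0$ and that $$|B(x)|\le C(1+|x|)^{-r},\qquad r>2 .$$ For $x\ne0$, $\hat x=x/|x|$, let $$A^{(\infty)}(x)=|x|^{-2}\int_0^\infty \bigl(B(s\hat x)\times x\bigr)\,s\,ds,\qquad A^{(reg)}(x)=-|x|^{-2}\int_{|x|}^\infty \bigl(B(s\hat x)\times x\bigr)\,s\,ds,$$ and let $$U(x)=\int_{\Gamma_{x_0,x}}\langle A^{(\infty)}(y),dy\rangle ,\qquad x\neq 0,$$ be the curvilinear integral taken between some fixed point $x_0\ne0$ and the variable point $x$ along a contour $\Gamma_{x_0,x}$ with $0\notin\Gamma_{x_0,x}$. Let $R_2>R_1>0$ and let $\eta\in C^\infty(\mathbb{R}^3)$ be such that $\eta(x)=1$ for $|x|\ge R_2$ and $\eta(x)=0$ for $|x|\le R_1$. Let the magnetic potential $A(x)$ be defined by $$A(x)=A^{(tr)}(x)-\operatorname{grad}(\eta(x)U(x))=A^{(reg)}(x)+(1-\eta(x))A^{(\infty)}(x)-U(x)\operatorname{grad}\eta(x).$$ Then $A(x)$ satisfies the equation $\operatorname{curl}A(x)=B(x)$ and the estimate $$|A(x)|\le C(1+|x|)^{-\rho},\qquad \rho>1 .$$ Moreover, $A(x)$ has compact support if $B(x)$ has compact support.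
   Context: $A^{(tr)}$ is the magnetic potential in the transversal gauge ($\operatorname{curl}A^{(tr)}=B$, $\langle A^{(tr)}(x),x\rangle=0$), $$A^{(tr)}(x)=\int_0^1\bigl(B(sx)\times x\bigr)\,s\,ds,$$ i.e. $A^{(tr)}_1(x)=\int_0^1(B_2(sx)x_3-B_3(sx)x_2)\,s\,ds$ and the other components are obtained by cyclic permutations of indices; one has $A^{(tr)}=A^{(\infty)}+A^{(reg)}$ for $x\ne0$. The field $A^{(\infty)}$ is homogeneous of degree $-1$ and satisfies $\langle A^{(\infty)}(x),x\rangle=0$ and $\operatorname{curl}A^{(\infty)}(x)=0$ for $x\ne0$; since $\mathbb{R}^3\setminus\{0\}$ is simply connected, $U(x)$ does not depend on the choice of the contour. One has $A=A^{(tr)}$ for $|x|\le R_1$ and $A=A^{(reg)}$ for $|x|\ge R_2$. In general, the equation $\operatorname{curl}A=B$ is understood in the sense of distributions. $C$ denotes different positive constants. *)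

(* Defs.v *)
From HB Require Import structures.
From mathcomp Require Import all_boot all_order all_algebra.
From mathcomp Require Import all_classical all_reals all_analysis.

Set Implicit Arguments.
Unset Strict Implicit.
Unset Printing Implicit Defensive.

Import Order.TTheory GRing.Theory Num.Theory.
Import numFieldNormedType.Exports.

Local Open Scope classical_set_scope.
Local Open Scope ring_scope.

(* Points and vectors of R^3 are row vectors 'rV[R]_3. The library norm `|x|
   on 'rV[R]_3 is the sup norm; it is used only through its (standard) topology,
   and |x| in the mathematics is always the Euclidean norm enorm.  Coordinates
   are numbered 0, 1, 2, and the indices i + 1, i + 2 below are computed in the
   cyclic group 'I_3 = Z/3Z (cyclic permutation of the coordinates). *)

Definition dot (R : realType) (u v : 'rV[R]_3) : R :=
  \sum_(i < 3) u 0 i * v 0 i.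

Definition enorm (R : realType) (x : 'rV[R]_3) : R := Num.sqrt (dot x x).

Definition cross (R : realType) (u v : 'rV[R]_3) : 'rV[R]_3 :=
  \row_(i < 3) (u 0 (i + 1) * v 0 (i + 2%:R) - u 0 (i + 2%:R) * v 0 (i + 1)).

Definition basis_vec (R : realType) (i : 'I_3) : 'rV[R]_3 := delta_mx 0 i.

Definition partial (R : realType) (i : 'I_3) (f : 'rV[R]_3 -> R) :
  'rV[R]_3 -> R := fun x => 'D_(basis_vec R i) f x.

Definition grad (R : realType) (f : 'rV[R]_3 -> R) (x : 'rV[R]_3) : 'rV[R]_3 :=
  \row_(i < 3) partial i f x.

Fixpoint class_C (R : realType) (k : nat) (f : 'rV[R]_3 -> R) : Prop :=
  match k with
  | 0%N => continuous f
  | k'.+1 => continuous f /\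
      forall i : 'I_3,
        (forall x, derivable f x (basis_vec R i)) /\ class_C k' (partial i f)
  end.

Definition smooth (R : realType) (f : 'rV[R]_3 -> R) : Prop :=
  forall k : nat, class_C k f.

Definition compact_support (R : realType) (V : nmodType) (f : 'rV[R]_3 -> V) :
  Prop := compact (closure [set x | f x != 0]).

Definition test_function (R : realType) (phi : 'rV[R]_3 -> R) : Prop :=
  smooth phi /\ compact_support phi.

(* Lebesgue measure on R^3 is the product measure on R * R * R, and functions
   on 'rV[R]_3 are integrated through the coordinate map vec3. *)
Definition vec3 (R : realType) (p : R * R * R) : 'rV[R]_3 :=
  \row_(i < 3) [:: p.1.1; p.1.2; p.2]`_i.

Definition lebesgue3 (R : realType) :=
  ((@lebesgue_measure R \x @lebesgue_measure R) \x @lebesgue_measure R)%E.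

Definition integral3 (R : realType) (f : 'rV[R]_3 -> R) : R :=
  \int[@lebesgue3 R]_p f (vec3 p).

Definition loc_integrable (R : realType) (f : 'rV[R]_3 -> R) : Prop :=
  forall K : set 'rV[R]_3, compact K ->
    (@lebesgue3 R).-integrable (@vec3 R @^-1` K) (fun p => (f (vec3 p))%:E).

(* the value at the test function phi of the distribution d f / d x_i *)
Definition distr_partial (R : realType) (i : 'I_3) (f phi : 'rV[R]_3 -> R) : R :=
  - integral3 (fun x => f x * partial i phi x).

Definition component (R : realType) (F : 'rV[R]_3 -> 'rV[R]_3) (i : 'I_3) :
  'rV[R]_3 -> R := fun x => F x 0 i.

Definition distr_div_free (R : realType) (B : 'rV[R]_3 -> 'rV[R]_3) : Prop :=
  (forall i, loc_integrable (component B i)) /\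
  forall phi, test_function phi ->
    \sum_(i < 3) distr_partial i (component B i) phi = 0.

Definition distr_curl_eq (R : realType) (A B : 'rV[R]_3 -> 'rV[R]_3) : Prop :=
  (forall i, loc_integrable (component A i)) /\
  (forall i, loc_integrable (component B i)) /\
  forall phi, test_function phi -> forall i : 'I_3,
    distr_partial (i + 1) (component A (i + 2%:R)) phi
      - distr_partial (i + 2%:R) (component A (i + 1)) phi
    = integral3 (fun x => component B i x * phi x).

Definition vec_integral (R : realType) (D : set R) (f : R -> 'rV[R]_3) :
  'rV[R]_3 := \row_(i < 3) \int[@lebesgue_measure R]_(s in D) f s 0 i.

(* A contour is a piecewise C^1 path parametrized by [0, 1]; C^1 on the closed
   interval [a, b] means being the restriction of a C^1 path. *)
Definition C1_path_on (R : realType) (a b : R) (g : R -> 'rV[R]_3) : Prop :=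
  exists h : R -> 'rV[R]_3,
    [/\ forall t, derivable h t 1, continuous (fun t => 'D_1 h t) &
        forall t, a <= t <= b -> g t = h t].

Definition contour (R : realType) (p q : 'rV[R]_3) (g : R -> 'rV[R]_3) : Prop :=
  [/\ g 0 = p, g 1 = q,
      forall t, 0 <= t <= 1 -> g t != 0 &
      exists2 s : seq R, itv_partition 0 1 s &
        forall i, (i < size s)%N -> C1_path_on (0 :: s)`_i s`_i g].

(* The derivative is meaningless at the finitely many break points of g, which
   do not contribute to the integral. *)
Definition line_integral (R : realType) (F : 'rV[R]_3 -> 'rV[R]_3)
    (g : R -> 'rV[R]_3) : R :=
  \int[@lebesgue_measure R]_(t in `[0, 1]) dot (F (g t)) ('D_1 g t).

Definition Atr (R : realType) (B : 'rV[R]_3 -> 'rV[R]_3) (x : 'rV[R]_3) :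
  'rV[R]_3 := vec_integral `[0, 1] (fun s => s *: cross (B (s *: x)) x).

Definition unit_dir (R : realType) (x : 'rV[R]_3) : 'rV[R]_3 :=
  (enorm x)^-1 *: x.

Definition Ainf (R : realType) (B : 'rV[R]_3 -> 'rV[R]_3) (x : 'rV[R]_3) :
  'rV[R]_3 :=
  (enorm x) ^- 2 *:
    vec_integral `[0, +oo[ (fun s => s *: cross (B (s *: unit_dir x)) x).

Definition Areg (R : realType) (B : 'rV[R]_3 -> 'rV[R]_3) (x : 'rV[R]_3) :
  'rV[R]_3 :=
  - ((enorm x) ^- 2 *:
    vec_integral `[enorm x, +oo[ (fun s => s *: cross (B (s *: unit_dir x)) x)).

Definition decays (R : realType) (F : 'rV[R]_3 -> 'rV[R]_3) (r : R) : Prop :=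
  exists2 C : R, 0 < C & forall x, enorm (F x) <= C * (1 + enorm x) `^ (- r).

(* Gamma x is the contour chosen from x0 to x.  The value of U at 0 is
   irrelevant: it is always multiplied by a function vanishing near 0. *)
Definition Upot (R : realType) (B : 'rV[R]_3 -> 'rV[R]_3)
    (Gamma : 'rV[R]_3 -> R -> 'rV[R]_3) (x : 'rV[R]_3) : R :=
  line_integral (Ainf B) (Gamma x).

Definition magnetic_potential (R : realType) (B : 'rV[R]_3 -> 'rV[R]_3)
    (Gamma : 'rV[R]_3 -> R -> 'rV[R]_3) (eta : 'rV[R]_3 -> R) (x : 'rV[R]_3) :
  'rV[R]_3 := Atr B x - grad (fun y => eta y * Upot B Gamma y) x.

(* Main.v *)
Require Import Defs.
From HB Require Import structures.
From mathcomp Require Import all_boot all_order all_algebra.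
From mathcomp Require Import all_classical all_reals all_analysis.
From mathcomp Require Import measurable_realfun ring lra.
Import Order.TTheory GRing.Theory Num.Theory.
Import numFieldNormedType.Exports.
Local Open Scope classical_set_scope.
Local Open Scope ring_scope.

(** The field B is only continuous and its divergence vanishes only weakly, so
    everything rests on one identity that makes sense for such fields. For a centre
    e, let rpot e B be the potential of B in the transversal gauge centred at e; in
    particular Atr B = rpot 0 B. Poincare's homotopy formula (is_derive_lint) says
    that the primitive of a smooth field F along the rays from e has gradient
    F - rpot e (curl F). With F = rpot 0 B, whose curl is B when B is smooth and
    divergence free (curl_rpot), and after integration along a segment, this becomes
    an identity between circulations, without derivatives of B (transgression).
    Mollification by a smooth bump function extends it to B itself: the mollified
    field is smooth and divergence free in the classical sense (moll_div), and it
    converges to B with the mollification parameter. The same passage to the limit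
    gives curl Atr = B in the sense of distributions (distr_curl_rpot).

    The field Ainf is homogeneous of degree -1, and Ainf + Areg = Atr with
    Areg of order |x|^-1 (1 + |x|)^(2 - r). Hence N Atr (N x) tends to Ainf x as N
    tends to infinity, uniformly away from 0 (Ascaled_dist), and Ainf is continuous
    outside 0. It may fail to be differentiable there, so that its vanishing curl has
    to be stated through circulations: the transgression identity for a triangle
    dilated by N relates the circulation of Ascaled N around the triangle to the flux
    of B through the dilated triangle, which is of order N^2 N^-r. Since r > 2 the
    flux tends to 0, and Ainf has no circulation around a triangle that lies in a
    half-space away from 0 (Ainf_triangle).

    From this one builds a primitive Vpot of Ainf outside 0, integrating along
    segments from a base point b0 and, on the half-line opposite to b0, from - b0.
    The fundamental theorem of calculus along the pieces of a contour then gives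
    U x = Vpot x - Vpot x0, whatever the contours are (line_integral_contour), hence
    grad U = Ainf outside 0.

    The rest is the usual gauge argument. The function eta U is C^1 on the whole
    space because eta vanishes near 0, so subtracting its gradient does not change the
    weak curl (distr_curl_grad). Outside the ball of radius R2 one has eta = 1 and
    A = Atr - Ainf = Areg, which decays like |x|^(1 - r) and vanishes where B vanishes
    further out on the ray; inside the ball A is continuous, hence bounded. So the
    exponent rho = r - 1 > 1 is suitable. *)

Set Implicit Arguments.
Unset Strict Implicit.
Unset Printing Implicit Defensive.

(** * Continuity *)

Section ContinuityRules.
Context {R : realType} {X : topologicalType}.

Lemma contD (f g : X -> R) : continuous f -> continuous g ->
  continuous (fun x => f x + g x).
Proof. by move=> cf cg x; apply: cvgD; [exact: cf|exact: cg]. Qed.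

Lemma contB (f g : X -> R) : continuous f -> continuous g ->
  continuous (fun x => f x - g x).
Proof. by move=> cf cg x; apply: cvgB; [exact: cf|exact: cg]. Qed.

Lemma contN (f : X -> R) : continuous f -> continuous (fun x => - f x).
Proof. by move=> cf x; apply: cvgN; exact: cf. Qed.

Lemma contM (f g : X -> R) : continuous f -> continuous g ->
  continuous (fun x => f x * g x).
Proof. by move=> cf cg x; apply: cvgM; [exact: cf|exact: cg]. Qed.

Lemma contX (f : X -> R) n : continuous f -> continuous (fun x => f x ^+ n).
Proof.
move=> cf; elim: n => [|n IH]; first by move=> x; exact: cvg_cst.
rewrite (_ : (fun x => _) = (fun x => f x * f x ^+ n)); first exact: contM.
by apply/funext => x; rewrite exprS.
Qed.

Lemma contvD (V : normedModType R) (f g : X -> V) : continuous f -> continuous g ->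
  continuous (fun x => f x + g x).
Proof. by move=> cf cg x; apply: cvgD; [exact: cf|exact: cg]. Qed.

Lemma contvB (V : normedModType R) (f g : X -> V) : continuous f -> continuous g ->
  continuous (fun x => f x - g x).
Proof. by move=> cf cg x; apply: cvgB; [exact: cf|exact: cg]. Qed.

Lemma contvZ (V : normedModType R) (k : X -> R) (f : X -> V) :
  continuous k -> continuous f -> continuous (fun x => k x *: f x).
Proof. by move=> cf cg x; apply: cvgZ; [exact: cf|exact: cg]. Qed.

Lemma cont_pair (Y Z : topologicalType) (f : X -> Y) (g : X -> Z) :
  continuous f -> continuous g -> continuous (fun x => (f x, g x)).
Proof. by move=> cf cg x; apply: cvg_pair => /=; [exact: cf|exact: cg]. Qed.

Lemma cont_comp (Y Z : topologicalType) (f : X -> Y) (g : Y -> Z) :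
  continuous g -> continuous f -> continuous (fun x => g (f x)).
Proof. by move=> cg cf x; apply: (@continuous_comp _ _ _ f g); [exact: cf|exact: cg]. Qed.

Lemma cont_comp2 (Y Z T : topologicalType) (f : X -> Y) (h : X -> Z) (g : Y -> Z -> T) :
  continuous (fun p : Y * Z => g p.1 p.2) -> continuous f -> continuous h ->
  continuous (fun x => g (f x) (h x)).
Proof.
move=> cg cf ch.
exact: (@cont_comp _ _ (fun x => (f x, h x)) (fun p : Y * Z => g p.1 p.2) cg (cont_pair cf ch)).
Qed.

Lemma cont_fst (Y Z : topologicalType) (f : X -> Y * Z) : continuous f ->
  continuous (fun x => (f x).1).
Proof. by move=> cf; apply: (@cont_comp _ _ f fst) => //; move=> p; exact: cvg_fst. Qed.

Lemma cont_snd (Y Z : topologicalType) (f : X -> Y * Z) : continuous f ->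
  continuous (fun x => (f x).2).
Proof. by move=> cf; apply: (@cont_comp _ _ f snd) => //; move=> p; exact: cvg_snd. Qed.

Lemma cont_id : continuous (fun x : X => x).
Proof. by move=> x; exact: cvg_id. Qed.

Lemma cont_cst (Y : topologicalType) (y : Y) : continuous (fun _ : X => y).
Proof. by move=> x; exact: cvg_cst. Qed.

Lemma cont_coord n (f : X -> 'rV[R]_n) i : continuous f ->
  continuous (fun x => f x 0 i).
Proof.
move=> cf; apply: (@cont_comp _ _ f (fun v : 'rV[R]_n => v 0 i)) => //.
exact: coord_continuous.
Qed.

Lemma cont_row n (f : X -> 'I_n -> R) : (forall i, continuous (f ^~ i)) ->
  continuous (fun x => \row_i f x i).
Proof.
move=> cf x; apply/cvgrPdist_lt => e e0.
have : \forall y \near x, forall i, `|f x i - f y i| < e.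
  apply: filter_forall => i.
  by have /cvgrPdist_lt /(_ _ e0) := cf i x.
apply: filterS => y H.
rewrite /Num.norm /= mx_normrE; apply/bigmax_ltP; split=> // -[i j] _ /=.
by rewrite !mxE; exact: H.
Qed.

Lemma ord3_ind (P : 'I_3 -> Prop) : P 0 -> P 1 -> P 2%:R -> forall i, P i.
Proof.
move=> P0 P1 P2 [[|[|[|i]]] Hi] //.
- by rewrite (_ : Ordinal Hi = 0)//; exact: val_inj.
- by rewrite (_ : Ordinal Hi = 1)//; exact: val_inj.
- by rewrite (_ : Ordinal Hi = 2%:R)//; exact: val_inj.
Qed.

Lemma cont_vec3 (x y z : X -> R) :
  continuous x -> continuous y -> continuous z ->
  continuous (fun t => vec3 (x t, y t, z t)).
Proof.
by move=> cx cy cz; apply: cont_row; apply: ord3_ind => /=.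
Qed.

Lemma cont_sum n (f : X -> 'I_n -> R) : (forall i, continuous (f ^~ i)) ->
  continuous (fun x => \sum_i f x i).
Proof.
move=> cf; elim: n f cf => [|n IH] f cf.
  rewrite (_ : (fun x => _) = fun=> 0); first exact: cont_cst.
  by apply/funext => x; rewrite big_ord0.
rewrite (_ : (fun x => _) = (fun x => f x ord0 + \sum_(i < n) f x (lift ord0 i))).
  by apply: contD => //; apply: (IH (fun x i => f x (lift ord0 i))) => i.
by apply/funext => x; rewrite big_ord_recl.
Qed.

Lemma cont_norm (V : normedModType R) (f : X -> V) : continuous f ->
  continuous (fun x => `|f x|).
Proof. by move=> cf; apply: (@cont_comp _ _ f Num.norm) => //; exact: norm_continuous. Qed.

(** How an identity passes from the mollified fields to the field itself. *)
Lemma cont_lim_eq0 (h : R -> R) : continuous h -> (forall e, 0 < e -> h e = 0) ->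
  h 0 = 0.
Proof.
move=> ch h0; apply/eqP; rewrite -normr_le0; apply/ler_addgt0Pr => e e0.
have /cvgrPdist_le /(_ _ e0) [d /= d0 H] := ch 0.
have := H (d / 2%:R); rewrite /= sub0r normrN ger0_norm; last by apply: divr_ge0 => //; exact: ltW.
rewrite (h0 (d / 2%:R)); last by rewrite divr_gt0.
rewrite subr0 add0r; apply.
by rewrite ltr_pdivrMr// ltr_pMr// ltr1n.
Qed.

End ContinuityRules.

(** Continuity by recursion on the expression, down to functions known to be
    continuous; joint continuity of a function of two variables is expected in
    uncurried form. *)
Ltac cont_step :=
  match goal with
  | |- forall _, continuous _ => intro
  | |- continuous (fun x => x) => exact: cont_id
  | |- continuous (fun _ => ?c) => exact: cont_cst
  | |- continuous (fun x => vec3 (@?f x, @?g x, @?h x)) => refine (@cont_vec3 _ _ f g h _ _ _)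
  | |- continuous fst => move=> ?; exact: cvg_fst
  | |- continuous snd => move=> ?; exact: cvg_snd
  | |- continuous (fun x => (@?f x, @?g x)) => refine (@cont_pair _ _ _ f g _ _)
  | |- continuous (fun x => @?f x + - (@?g x)) =>
      first [refine (@contB _ _ f g _ _)|refine (@contvB _ _ _ f g _ _)]
  | |- continuous (fun x => @?f x + @?g x) =>
      first [refine (@contD _ _ f g _ _)|refine (@contvD _ _ _ f g _ _)]
  | |- continuous (fun x => - @?f x) => refine (@contN _ _ f _)
  | |- continuous (fun x => @?f x * @?g x) => refine (@contM _ _ f g _ _)
  | |- continuous (fun x => @?f x *: @?g x) => refine (@contvZ _ _ _ f g _ _)
  | |- continuous (fun x => @?f x ^+ _) => refine (@contX _ _ f _ _)
  | |- continuous (fun x => `| @?f x |) => refine (@cont_norm _ _ _ f _)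
  | |- continuous (fun x => \row_i @?f x i) => refine (@cont_row _ _ _ f _)
  | |- continuous (fun x => \sum_i @?f x i) => refine (@cont_sum _ _ _ f _)
  | |- continuous (fun x => (@?f x).1) => refine (@cont_fst _ _ _ f _)
  | |- continuous (fun x => (@?f x).2) => refine (@cont_snd _ _ _ f _)
  | |- continuous (fun x => fun_of_matrix (@?f x) _ _) => refine (@cont_coord _ _ _ f _ _)
  | H : continuous ?g |- continuous ?h => constr_eq g h; exact: H
  | H : continuous (fun p => ?h p.1 p.2) |- continuous (fun x => ?g (@?a x) (@?b x)) =>
      constr_eq g h; refine (@cont_comp2 _ _ _ _ a b g H _ _)
  | H : continuous ?h |- continuous (fun x => ?g (@?a x)) =>
      constr_eq g h; refine (@cont_comp _ _ _ a g H _)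
  | H : forall i, continuous (?h i) |- continuous (fun x => ?g ?i (@?a x)) =>
      constr_eq g h; refine (@cont_comp _ _ _ a (g i) (H i) _)
  end.
Ltac cont := repeat cont_step.

(** * Integrals over segments *)

(** Sealed: unification must compare two such integrals by their arguments,
    never by unfolding the Lebesgue integral. *)
HB.lock Definition segint (R : realType) (a b : R) (f : R -> R) : R :=
  \int[@lebesgue_measure R]_(t in `[a, b]) f t.

Lemma segintE (R : realType) (a b : R) (f : R -> R) :
  segint a b f = \int[@lebesgue_measure R]_(t in `[a, b]) f t.
Proof. by rewrite segint.unlock. Qed.

Section SegmentIntegral.
Context {R : realType}.
Implicit Types (a b c : R) (f g : R -> R).
Notation mu := (@lebesgue_measure R).

Lemma continuous_segment_integrable a b f : continuous f ->
  mu.-integrable `[a, b] (EFin \o f).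
Proof.
move=> cf; apply: continuous_compact_integrable; first exact: segment_compact.
exact: continuous_subspaceT.
Qed.

Lemma eq_segint a b f g : (forall t, a <= t <= b -> f t = g t) ->
  segint a b f = segint a b g.
Proof.
move=> fg; rewrite !segintE; apply: eq_Rintegral => t; rewrite inE /= in_itv /= => tab.
exact: fg.
Qed.

Lemma segintD a b f g : continuous f -> continuous g ->
  segint a b (fun t => f t + g t) = segint a b f + segint a b g.
Proof. by move=> *; rewrite !segintE RintegralD//; exact: continuous_segment_integrable. Qed.

Lemma segintB a b f g : continuous f -> continuous g ->
  segint a b (fun t => f t - g t) = segint a b f - segint a b g.
Proof. by move=> *; rewrite !segintE RintegralB//; exact: continuous_segment_integrable. Qed.

Lemma segintZ a b k f : continuous f ->
  segint a b (fun t => k * f t) = k * segint a b f.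
Proof. by move=> *; rewrite !segintE RintegralZl//; exact: continuous_segment_integrable. Qed.

Lemma segint_lin3 a b (k0 k1 k2 : R) (f0 f1 f2 : R -> R) :
  continuous f0 -> continuous f1 -> continuous f2 ->
  segint a b (fun t => k0 * f0 t + k1 * f1 t + k2 * f2 t) =
  k0 * segint a b f0 + k1 * segint a b f1 + k2 * segint a b f2.
Proof.
move=> c0 c1 c2; rewrite segintD; [|by cont|by cont].
rewrite segintD; [|by cont|by cont].
by rewrite !segintZ.
Qed.

Lemma segint_cst a b k : a <= b -> segint a b (fun=> k) = k * (b - a).
Proof.
move=> ab; rewrite !segintE Rintegral_cst//; congr (_ * _).
have := lebesgue_measure_itv `[a, b]; rewrite /= lte_fin => ->.
by case: ltgtP ab => //= ->; rewrite subrr.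
Qed.

Lemma le_segint a b f g : continuous f -> continuous g ->
  (forall t, a <= t <= b -> f t <= g t) -> segint a b f <= segint a b g.
Proof.
by move=> cf cg fg; rewrite !segintE; apply: le_Rintegral => //;
  exact: continuous_segment_integrable.
Qed.

Lemma ler_norm_segint a b k f : a <= b -> continuous f ->
  (forall t, a <= t <= b -> `|f t| <= k) -> `|segint a b f| <= k * (b - a).
Proof.
move=> ab cf fk; rewrite -segint_cst// segintE.
apply: le_trans (le_normr_Rintegral _ _) _ => //.
  exact: continuous_segment_integrable.
rewrite -segintE.
apply: le_segint => //; last by move=> t; exact: cst_continuous.
by move=> t; apply: (@continuous_comp _ _ _ f Num.norm); [exact: cf|exact: norm_continuous].
Qed.

Lemma segint_FTC2 a b (F f : R -> R) : a <= b -> continuous f ->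
  (forall t : R, a <= t <= b -> is_derive t 1 F (f t)) -> segint a b f = F b - F a.
Proof.
rewrite le_eqVlt => /predU1P[<-|ab] cf dF.
  by rewrite segintE set_itv1 Rintegral_set1 subrr.
have cF t : a <= t <= b -> {for t, continuous F}.
  move=> tab; apply: differentiable_continuous; apply/derivable1_diffP.
  by have ? := dF t tab; exact: ex_derive.
rewrite segintE /Rintegral (@continuous_FTC2 _ f F)//.
- exact: continuous_subspaceT.
- split.
  + move=> t /[!in_itv]/= /andP[at_ tb].
    by have ? := dF t (introT andP (conj (ltW at_) (ltW tb))); exact: ex_derive.
  + by apply: cvg_at_right_filter; apply: cF; rewrite lexx ltW.
  + by apply: cvg_at_left_filter; apply: cF; rewrite lexx ltW.
- move=> t /[!in_itv]/= /andP[at_ tb].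
  by have ? := dF t (introT andP (conj (ltW at_) (ltW tb))); rewrite derive1E derive_val.
Qed.

Lemma segint_cat a b c f : a <= b -> b <= c -> continuous f ->
  segint a c f = segint a b f + segint b c f.
Proof.
move=> ab bc cf.
have := @Rintegral_itvB R f (BLeft a) (BRight c) b
  (continuous_segment_integrable a c cf) _ _.
rewrite !bnd_simp => /(_ ab bc) E.
rewrite !segintE -(@Rintegral_itv_obnd_cbnd _ b) -?E ?subrKC//.
apply: (@integrableS _ _ _ mu `[b, c]%classic) => //.
  by apply: subset_itvr; rewrite bnd_simp.
exact: continuous_segment_integrable.
Qed.

Lemma segint_FTC1 a x f : a < x -> continuous f ->
  is_derive x 1 (segint a ^~ f) (f x).
Proof.
move=> ax cf.
have [] := @continuous_FTC1_closed R f a x (x + 1) _ _ ax (cf x).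
- by rewrite ltrDl.
- exact: continuous_segment_integrable.
move=> d1 d2; rewrite (_ : segint a ^~ f = fun x => \int[mu]_(t in `[a, x]) f t); last first.
  by apply/funext => y; rewrite segintE.
by apply: DeriveDef; [exact: d1|rewrite -derive1E; exact: d2].
Qed.

End SegmentIntegral.

(** * Integrals depending on a parameter *)

Section ParameterIntegral.
Context {R : realType}.
Implicit Types (a b : R).

Lemma continuous_slice (X Y Z : topologicalType) (f : X -> Y -> Z) x :
  continuous (fun p : X * Y => f p.1 p.2) -> continuous (f x).
Proof.
move=> cf y; apply: (@continuous_comp _ _ _ (fun y => (x, y)) (fun p : X * Y => f p.1 p.2)).
  by apply: cvg_pair => //; exact: cvg_cst.
exact: cf.
Qed.

(** Compactness of [a, b] makes the convergence uniform in t. *)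
Lemma continuous_segint_at (X : topologicalType) (x : X) a b (f : X -> R -> R) :
  a <= b -> (\forall y \near x, continuous (f y)) ->
  (forall t, a <= t <= b -> {for (x, t), continuous (fun p : X * R => f p.1 p.2)}) ->
  {for x, continuous (fun x => segint a b (f x))}.
Proof.
move=> ab nf cf; apply/cvgrPdist_le => e e0.
pose d := e / (b - a + 1).
have ba0 : 0 < b - a + 1 by lra.
have d0 : 0 < d by rewrite divr_gt0.
have K : near_covering (`[a, b]%classic : set R).
  exact/compact_near_coveringP/segment_compact.
have UP : \forall y \near x, `[a, b]%classic `<=` (fun t => `|f x t - f y t| <= d).
  apply: (K X (nbhs x) (fun y t => `|f x t - f y t| <= d) _) => t.
  rewrite set_itvE /= => tab.
  have c1 := cf _ tab.
  have := (cvgrPdist_le _ _).1 c1 (d / 2%:R) ltac:(by rewrite divr_gt0).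
  move=> [[U V] /= [Ux Vt] UV].
  exists (V, U) => //= -[s y] /= [Vs Uy].
  have h1 := UV (y, s) (conj Uy Vs).
  have h2 := UV (x, s) (conj (nbhs_singleton Ux) Vs).
  rewrite /= in h1 h2.
  rewrite (_ : f x s - f y s = (f x t - f y s) - (f x t - f x s)); last by ring.
  by rewrite (le_trans (ler_normB _ _))// (splitr d) lerD.
near=> y.
have Uy : `[a, b]%classic `<=` (fun t => `|f x t - f y t| <= d).
  by near: y.
have cy : continuous (f y) by near: y.
have cx : continuous (f x) by exact: nbhs_singleton nf.
rewrite -segintB//; apply: le_trans (ler_norm_segint ab (k := d) _ _) _.
- by move=> t; apply: cvgB; [exact: cx|exact: cy].
- by move=> t tab; apply: Uy; rewrite /= in_itv.
- rewrite /d -mulrA ler_piMr//; first exact: ltW.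
  by rewrite mulrC ler_pdivrMr// mul1r; lra.
Unshelve. all: by end_near. Qed.

Lemma continuous_segint (X : topologicalType) a b (f : X -> R -> R) : a <= b ->
  continuous (fun p : X * R => f p.1 p.2) ->
  continuous (fun x => segint a b (f x)).
Proof.
move=> ab cf x; apply: continuous_segint_at => // [|t _].
  by near=> y; exact: continuous_slice.
exact: cf.
Unshelve. all: by end_near. Qed.

(** Reduces directional derivatives to derivatives in one variable. *)
Lemma is_derive_line (W V : normedModType R) (f : W -> V) x v df :
  is_derive x v f df <-> is_derive (0:R) 1 (fun h : R => f (x + h *: v)) df.
Proof.
have E : (fun h : R => h^-1 *: ((f \o shift x) (h *: v) - f x)) =
     (fun h : R => h^-1 *: (((fun h : R => f (x + h *: v)) \o shift 0) (h *: 1) - f (x + 0 *: v))).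
  by apply/funext => h; rewrite /= scale0r addr0 addr0 /GRing.scale /= mulr1 [_ + x]addrC.
by split => -[d1 d2]; apply: DeriveDef; move: d1 d2; rewrite /derivable /derive E.
Qed.

Lemma is_derive_segint_near (W : normedModType R) a b (f g : W -> R -> R) (w v : W) (e : R) :
  a <= b -> 0 < e ->
  (forall h, -e < h < e -> continuous (f (w + h *: v))) ->
  continuous (fun p : W * R => g p.1 p.2) ->
  (forall h t, -e < h < e -> is_derive (w + h *: v) v (f ^~ t) (g (w + h *: v) t)) ->
  is_derive w v (fun w => segint a b (f w)) (segint a b (g w)).
Proof.
move=> ab e0 cf cg df; apply/is_derive_line.
pose F (h t : R) := f (w + h *: v) t.
have dF (h t : R) : -e < h < e -> is_derive h 1 (F ^~ t) (g (w + h *: v) t).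
  move=> he; apply/is_derive_line.
  have /is_derive_line := df h t he.
  suff -> : (fun h0 : R => f (w + h *: v + h0 *: v) t) =
    (fun h0 : R => F (h + h0 *: 1) t) by [].
  by apply/funext => k; rewrite /F -addrA -scalerDl /GRing.scale/= mulr1.
have cG : continuous (fun p : R * R => g (w + p.1 *: v) p.2) by cont.
have [M M0 HM] : exists2 M : R, 0 <= M & forall h t : R, -e <= h <= e -> a <= t <= b ->
    `|g (w + h *: v) t| <= M.
  have K : compact (`[-e, e]%classic `*` `[a, b]%classic : set (R * R)).
    by apply: compact_setX; exact: segment_compact.
  have := @continuous_compact (R * R)%type R^o _ _ (continuous_subspaceT cG) K.
  move=> /compact_bounded [M [Mr HM]].
  exists (`|M| + 1); first by rewrite addr_ge0.
  move=> h t h1 t1; apply: (HM (`|M| + 1)).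
    by rewrite (le_lt_trans (ler_norm _))// ltrDl.
  by exists (h, t) => //=; rewrite !in_itv/=.
have Ia : `]-e, e[%classic (0 : R) by rewrite /= in_itv/= oppr_lt0 e0.
have E1 h t : -e < h < e -> partial1of2 F h t = g (w + h *: v) t.
  by move=> he; rewrite /partial1of2 derive1E; have := dF h t he => ?; exact: derive_val.
have intF h : `]-e, e[%classic h -> (@lebesgue_measure R).-integrable `[a, b] (EFin \o F h).
  by rewrite set_itvE => he; apply: continuous_segment_integrable; exact: cf.
have derF h t : `]-e, e[%classic h -> `[a, b]%classic t -> derivable (F ^~ t) h 1.
  by rewrite set_itvE => he _; have ? := dF h t he; exact: ex_derive.
have intM : (@lebesgue_measure R).-integrable `[a, b] (EFin \o (fun=> M)).
  by apply: continuous_segment_integrable => t; exact: cst_continuous.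
have bndF h t : `]-e, e[%classic h -> `[a, b]%classic t -> `|partial1of2 F h t| <= M.
  rewrite !set_itvE /= => he tab; rewrite E1//; apply: HM => //.
  by case/andP: he => ? ?; rewrite !ltW.
have mab : measurable (`[a, b]%classic : set (measurableTypeR R)) by exact: measurable_itv.
rewrite (_ : (fun h => _) = fun h => \int[@lebesgue_measure R]_(t in `[a, b]) F h t); last first.
  by apply/funext => h; rewrite segintE.
rewrite segintE; apply: DeriveDef.
- have D := @derivable_under_integral R _ (measurableTypeR R) (@lebesgue_measure R) F `[a, b]%classic mab 0 (-e) e Ia intF derF (fun=> M) (fun=> M0) intM bndF.
  exact: D.
- rewrite -derive1E; have D := @differentiation_under_integral R _ (measurableTypeR R) (@lebesgue_measure R) F `[a, b]%classic mab 0 (-e) e Ia intF derF (fun=> M) (fun=> M0) intM bndF.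
  rewrite [LHS]D.
  by apply: eq_Rintegral => t _; rewrite E1 ?scale0r ?addr0// oppr_lt0 e0.
Qed.

Lemma is_derive_segint (W : normedModType R) a b (f g : W -> R -> R) (w v : W) :
  a <= b ->
  continuous (fun p : W * R => f p.1 p.2) ->
  continuous (fun p : W * R => g p.1 p.2) ->
  (forall w t, is_derive w v (f ^~ t) (g w t)) ->
  is_derive w v (fun w => segint a b (f w)) (segint a b (g w)).
Proof.
move=> ab cf cg df; apply: (is_derive_segint_near (e := 1)) => //.
by move=> h _; exact: continuous_slice.
Qed.

Lemma derive0_eq (h : R -> R) a b : a <= b -> (forall t : R, a < t < b -> is_derive t 1 h 0) ->
  {within `[a, b], continuous h} -> h b = h a.
Proof.
move=> ab dh ch.
have [c _ H] : exists2 c, c \in `[a, b] & h b - h a = 0 * (b - a).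
  apply: (@MVT_segment R h (fun=> 0)) => // t; rewrite in_itv/=; exact: dh.
by apply/eqP; rewrite -subr_eq0 H mul0r.
Qed.

(** Fubini's theorem for continuous functions: both sides have the same derivative
    with respect to b. *)
Lemma segint_swap a b c d (f : R -> R -> R) : a <= b -> c <= d ->
  continuous (fun p : R * R => f p.1 p.2) ->
  segint a b (fun x => segint c d (f x)) = segint c d (fun y => segint a b (f ^~ y)).
Proof.
move=> ab cd cf.
pose g x := segint c d (f x).
have cg : continuous g by exact: continuous_segint.
have cfs y : continuous (f ^~ y) by cont.
(* the base point a - 1 keeps [a, b] inside the open half-line on which the
   fundamental theorem differentiates the primitives *)
pose o := a - 1.
have oa : o < a by rewrite /o; lra.
have cI u : o <= u -> continuous (fun y => segint o u (f ^~ y)).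
  move=> ou; apply: (continuous_segint (f := fun y x => f x y)) => //.
  by cont.
pose P (u : R) := segint o u g - segint c d (fun y => segint o u (f ^~ y)).
have dP (u : R) : o < u -> is_derive u 1 P 0.
  move=> au.
  have d1 := segint_FTC1 au cg.
  have d2 : is_derive u 1 (fun u => segint c d (fun y => segint o u (f ^~ y))) (segint c d (f u)).
    pose e := u - o; have e0 : 0 < e by rewrite subr_gt0.
    apply: (is_derive_segint_near (f := fun u y => segint o u (f ^~ y)) (e := e)) => //.
    + move=> h /andP[h1 h2]; apply: cI.
      by rewrite /GRing.scale/= mulr1 /e in h1 *; lra.
    + move=> h t /andP[h1 h2]; apply: (@segint_FTC1 R o _ (f ^~ t)) => //.
      by rewrite /GRing.scale/= mulr1 /e in h1 *; lra.
  by apply: is_derive_eq; rewrite /g subrr.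
have Pb : P b = P a.
  apply: derive0_eq => //.
    by move=> t /andP[at_ _]; apply: dP; exact: lt_trans at_.
  apply: continuous_in_subspaceT => t; rewrite inE /= in_itv/= => /andP[at_ _].
  apply: differentiable_continuous; apply/derivable1_diffP.
  by have ? := dP t (lt_le_trans oa at_); exact: ex_derive.
have ca u : a <= u -> segint a u g = segint o u g - segint o a g.
  move=> au; have E := segint_cat (ltW oa) au cg.
  by rewrite E addrC addKr.
apply: (eq_trans (ca b ab)).
have -> : segint c d (fun y => segint a b (f ^~ y)) =
    segint c d (fun y => segint o b (f ^~ y) - segint o a (f ^~ y)).
  apply: eq_segint => y _.
  by rewrite (segint_cat (ltW oa) ab (cfs y)) addrC addKr.
rewrite segintB; last 2 first.
- by apply: cI; exact: le_trans (ltW oa) ab.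
- by apply: cI; exact: ltW.
have sub_swap (x y z w : R) : x - y = z - w -> x - z = y - w by lra.
exact: sub_swap Pb.
Qed.

End ParameterIntegral.

(** * Measurability and Fubini's theorem in space *)

Section BorelSpace.
Context {R : realType}.

(** Cells of the grid of mesh (n+1)^-1, half-open so that they partition. *)
Let cell (n : nat) (k : int) : set R :=
  [set x | k%:~R / n.+1%:R <= x < (k + 1)%:~R / n.+1%:R].

Let measurable_cell n k : measurable (cell n k).
Proof.
rewrite (_ : cell n k = `[k%:~R / n.+1%:R, (k + 1)%:~R / n.+1%:R[%classic).
  exact: measurable_itv.
by rewrite set_itvE.
Qed.

Let cell_floor n (x : R) : cell n (Num.floor (x * n.+1%:R)) x.
Proof.
have n0 : 0 < n.+1%:R :> R by rewrite ltr0n.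
by rewrite /cell /= ler_pdivrMr// ltr_pdivlMr// floor_itv.
Qed.

Let cell_small n k (x y : R) : cell n k x -> cell n k y -> `|x - y| <= n.+1%:R^-1.
Proof.
rewrite /cell /= intrD mulrDl mul1r.
have H (a d : R) : a <= x < a + d -> a <= y < a + d -> `|x - y| <= d.
  move=> /andP[ax xb] /andP[ay yb].
  by rewrite ler_norml; apply/andP; split; lra.
exact: H.
Qed.

(** An open set is the union of the grid boxes that it contains, and there are
    only countably many grid boxes. *)
Lemma open_measurable3 (U : set (R * R * R)) : open U ->
  measurable (U : set (measurableTypeR R * measurableTypeR R * measurableTypeR R)).
Proof.
move=> oU.
pose C (a : nat * (int * int * int)) : set (R * R * R) :=
  (cell a.1 a.2.1.1 `*` cell a.1 a.2.1.2) `*` cell a.1 a.2.2.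
have -> : U = \bigcup_a (if `[< C a `<=` U >] then C a else set0).
  apply/seteqP; split => [[[x y] z] Up|p [a _]]; last first.
    by case: ifPn => // /asboolP; apply.
  have /nbhs_ballP[e /= e0 eU] : nbhs (x, y, z) U by apply: open_nbhs_nbhs.
  pose n := Num.truncn e^-1.
  have ne : n.+1%:R^-1 < e.
    by rewrite invf_plt ?posrE ?ltr0n// truncnS_gt.
  pose k (t : R) := Num.floor (t * n.+1%:R).
  exists (n, (k x, k y, k z)) => //.
  rewrite ifT.
    by split; [split|]; exact: cell_floor.
  apply/asboolP => -[[x' y'] z'] [[/= cx cy] cz]; apply: eU.
  by split; [split|]; rewrite /ball/=; apply: le_lt_trans ne; apply: cell_small;
    try eassumption; exact: cell_floor.
apply: countable_bigcupT_measurable; first exact: countableP.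
move=> a; case: ifPn => // _; rewrite /C.
apply: measurableX; last exact: measurable_cell.
by apply: measurableX; exact: measurable_cell.
Qed.

Lemma continuous_measurable3 (f : R * R * R -> R) : continuous f ->
  measurable_fun setT (f : measurableTypeR R * measurableTypeR R * measurableTypeR R -> R).
Proof.
move=> /continuousP cf; apply: (measurability _ (@measurable_realfun.RGenOpens.measurableE R)).
move=> _ [_ [a [b ->] <-]]; rewrite setTI; apply: open_measurable3.
exact/cf/interval_open.
Qed.

End BorelSpace.

Lemma product_sigma_finite d1 d2 (T1 : measurableType d1) (T2 : measurableType d2)
    (R : realType)
    (m1 : {sigma_finite_measure set T1 -> \bar R})
    (m2 : {sigma_finite_measure set T2 -> \bar R}) :
  sigma_finite setT (m1 \x m2)%E.
Proof.
have /sigma_finiteP[F [TF ndF Foo]] := sigma_finiteT m1.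
have /sigma_finiteP[G [TG ndG Goo]] := sigma_finiteT m2.
exists (fun n => F n `*` G n).
  apply/seteqP; split=> [[x y] _|//].
  have [n _ Fnx] : (\bigcup_i F i) x by rewrite -TF.
  have [k _ Gky] : (\bigcup_i G i) y by rewrite -TG.
  exists (maxn n k) => //; split.
  - by move: x Fnx; exact/subsetPset/ndF/leq_maxl.
  - by move: y Gky; exact/subsetPset/ndG/leq_maxr.
move=> k; have [mF ?] := Foo k; have [mG ?] := Goo k.
split; first exact: measurableX.
by rewrite product_measure1E// lte_mul_pinfty// ge0_fin_numE.
Qed.

Lemma Fubini_triple d1 d2 d3 (T1 : measurableType d1) (T2 : measurableType d2)
    (T3 : measurableType d3) (R : realType)
    (m1 : {sigma_finite_measure set T1 -> \bar R})
    (m2 : {sigma_finite_measure set T2 -> \bar R})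
    (m3 : {sigma_finite_measure set T3 -> \bar R}) (f : T1 * T2 * T3 -> \bar R) :
  (((m1 \x m2) \x m3)%E).-integrable setT f ->
  (\int[((m1 \x m2) \x m3)%E]_p f p =
   \int[m1]_x \int[m2]_y \int[m3]_z f (x, y, z))%E.
Proof.
move=> fi.
pose H := Measure_isSigmaFinite.Build _ _ _ (m1 \x m2)%E (product_sigma_finite m1 m2).
pose m12 : {sigma_finite_measure set (T1 * T2)%type -> \bar R} := HB.pack (m1 \x m2)%E H.
rewrite -(@integral12_prod_meas1 _ _ _ _ R m12 m3 f fi).
have Fi := @integrable_fubini_F _ _ _ _ R m12 m3 f fi.
exact: esym (@integral12_prod_meas1 _ _ _ _ R m1 m2 _ Fi).
Qed.

(** * Integrals over boxes and compact supports *)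

Section Space.
Context {R : realType}.
Implicit Types (f g : 'rV[R]_3 -> R) (M : R).
Notation mu := (@lebesgue_measure R).

Lemma sum3E (F : 'I_3 -> R) : \sum_i F i = F 0 + F 1 + F 2%:R.
Proof.
rewrite !big_ord_recr big_ord0 /= add0r.
by congr (F _ + F _ + F _); exact: val_inj.
Qed.

Lemma vec3E (x y z : R) :
  (vec3 (x, y, z) 0 0 = x) * (vec3 (x, y, z) 0 1 = y) * (vec3 (x, y, z) 0 2%:R = z).
Proof. by rewrite !mxE. Qed.

Definition supported_in (V : nmodType) M (f : 'rV[R]_3 -> V) := forall (x : 'rV[R]_3) (i : 'I_3), M <= `|x 0 i| -> f x = 0.

Lemma supported_in_le (V : nmodType) M N (f : 'rV[R]_3 -> V) : M <= N -> supported_in M f -> supported_in N f.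
Proof. by move=> MN sf x i Nx; apply: (sf x i); exact: le_trans Nx. Qed.

Lemma supported_inMr M f g : supported_in M f -> supported_in M (fun x => g x * f x).
Proof. by move=> sf x i Mx; rewrite (sf x i)// mulr0. Qed.

Definition box_int M f := segint (- M) M (fun x => segint (- M) M (fun y =>
  segint (- M) M (fun z => f (vec3 (x, y, z))))).

Lemma integral_line M (h : R -> R) : continuous h -> (forall t, M <= `|t| -> h t = 0) ->
  (\int[mu]_t (h t)%:E = (segint (- M) M h)%:E)%E.
Proof.
move=> ch h0.
have -> : (\int[mu]_t (h t)%:E = \int[mu]_(t in `[(- M)%R, M]) (h t)%:E)%E.
  rewrite [RHS]integral_mkcond; apply: eq_integral => t _.
  rewrite patchE; case: ifPn => // /negP tM; rewrite h0//.
  apply: contra_notT tM; rewrite -ltNge ltr_norml => /andP[a b].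
  by rewrite inE/= in_itv/= !ltW.
rewrite segintE /Rintegral fineK//.
apply: integrable_fin_num => //.
exact: continuous_segment_integrable.
Qed.

Lemma continuous_bounded_on (T : topologicalType) (f : T -> R) (A : set T) :
  compact A -> continuous f -> exists2 C, 0 <= C & forall x, A x -> `|f x| <= C.
Proof.
move=> cA cf.
have := @continuous_compact T R^o f A (continuous_subspaceT cf) cA.
move=> /compact_bounded [M [Mr HM]].
exists (`|M| + 1); first by rewrite addr_ge0.
move=> x Ax; apply: (HM (`|M| + 1)); last by exists x.
by rewrite (le_lt_trans (ler_norm _))// ltrDl.
Qed.

Definition cube3 M : set (R * R * R) := (`[- M, M] `*` `[- M, M]) `*` `[- M, M].

Let mbox M : measurable (cube3 M :
  set (measurableTypeR R * measurableTypeR R * measurableTypeR R)).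
Proof. by apply: measurableX => //; apply: measurableX. Qed.

Let cbox M : compact (cube3 M).
Proof. by apply: compact_setX; [apply: compact_setX|]; exact: segment_compact. Qed.

Let finbox M : (@lebesgue3 R (cube3 M) < +oo)%E.
Proof.
rewrite /lebesgue3 product_measure1E//; last by apply: measurableX.
rewrite [X in (X * _)%E]product_measure1E//.
have E : (mu `[(- M)%R, M]%classic < +oo)%E.
  have := lebesgue_measure_itv `[(- M)%R, M]; rewrite /= => ->.
  by case: ifPn => // _; rewrite -EFinB ltry.
have F : mu `[(- M)%R, M]%classic \is a fin_num by rewrite ge0_fin_numE.
by apply: lte_mul_pinfty; [exact: mule_ge0|exact: fin_numM|].
Qed.

Lemma continuous_integrable3 M (h : R * R * R -> R) (A : set (R * R * R)) :
  measurable (A : set (measurableTypeR R * measurableTypeR R * measurableTypeR R)) ->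
  A `<=` cube3 M ->
  continuous h -> (@lebesgue3 R).-integrable A (EFin \o h).
Proof.
move=> mA AM ch.
rewrite /lebesgue3; apply: (integrableS (mbox M) mA AM).
apply: measurable_bounded_integrable => //.
- exact: finbox.
- by apply: measurable_funS (continuous_measurable3 ch).
have [C C0 HC] := continuous_bounded_on (@cbox M) ch.
exists C; split; first exact: num_real.
by move=> y Cy x Ax; apply: le_trans (HC _ Ax) (ltW Cy).
Qed.

Lemma continuous_vec3 : continuous (@vec3 R).
Proof.
rewrite (_ : @vec3 R = fun p => vec3 (p.1.1, p.1.2, p.2)).
  by cont.
by apply/funext => -[[x y] z].
Qed.

(** The support allows one to replace each of Fubini's integrals over the line by
    an integral over a segment, where the calculus of continuous functions
    applies. *)
Lemma integral3_box M f : 0 <= M -> continuous f -> supported_in M f ->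
  integral3 f = box_int M f.
Proof.
move=> M0 cf sf.
have MM : - M <= M by lra.
have cfv : continuous (fun p : R * R * R => f (vec3 (p.1.1, p.1.2, p.2))).
  by cont.
have cfv' : continuous (fun p : R * R * R => f (vec3 p)).
  exact: (cont_comp cf continuous_vec3).
pose g (p : R * R) := segint (- M) M (fun z => f (vec3 (p, z))).
have cg : continuous g.
  by apply: (continuous_segint (f := fun p z => f (vec3 (p, z)))).
have g0 (p : R * R) : M <= `|p.1| \/ M <= `|p.2| -> g p = 0.
  move=> Mp; rewrite /g (eq_segint (g := fun=> 0)); first by rewrite segint_cst// mul0r.
  move=> t _; case: p Mp => x y [] /= Mp.
  + by apply: (sf _ 0); rewrite vec3E.
  + by apply: (sf _ 1); rewrite vec3E.
have int3 : (((mu \x mu) \x mu)%E).-integrable setT (EFin \o (f \o @vec3 R)).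
  have -> : EFin \o (f \o @vec3 R) = (EFin \o (f \o @vec3 R)) \_ (cube3 M).
    apply/funext => -[[x y] z]; rewrite patchE; case: ifPn => // /negP nM /=.
    congr (_%:E); apply/eqP; apply: contra_notT nM => fn0; rewrite inE.
    have H i : `|vec3 (x, y, z) 0 i| <= M.
      by rewrite leNgt; apply: contra_neqN fn0 => Mi; apply: (sf _ i); exact: ltW.
    by move: (H 0) (H 1) (H 2%:R); rewrite !vec3E /cube3 !ler_norml /=
      => a b c; split; [split|] => /=; rewrite in_itv.
  apply/(integrable_mkcond _ (@mbox M)).
  exact: (@continuous_integrable3 M).
rewrite /integral3 /Rintegral /lebesgue3.
have -> := Fubini_triple int3.
have -> : (\int[mu]_x \int[mu]_y \int[mu]_z (EFin \o (f \o @vec3 R)) (x, y, z) =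
    \int[mu]_x (segint (- M) M (fun y => g (x, y)))%:E)%E.
  apply: eq_integral => x _.
  rewrite -(@integral_line M (fun y => g (x, y))); last 2 first.
  - by cont.
  - by move=> t Mt; apply: g0; right.
  apply: eq_integral => y _.
  rewrite -(@integral_line M (fun z => f (vec3 (x, y, z))))//; first by cont.
  by move=> t Mt; apply: (sf _ 2%:R); rewrite vec3E.
rewrite (@integral_line M (fun x => segint (- M) M (fun y => g (x, y))))//.
- by apply: (continuous_segint (f := fun x y => g (x, y))) => //; cont.
move=> x Mx; rewrite (eq_segint (g := fun=> 0)); first by rewrite segint_cst// mul0r.
by move=> y _; apply: g0; left.
Qed.

Lemma cont_box_int (X : topologicalType) M (F : X -> 'rV[R]_3 -> R) : 0 <= M ->
  continuous (fun p : X * 'rV[R]_3 => F p.1 p.2) ->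
  continuous (fun x => box_int M (F x)).
Proof.
move=> M0 cF; have MM : - M <= M by lra.
apply: (continuous_segint (f := fun x a => segint (- M) M (fun b =>
  segint (- M) M (fun c => F x (vec3 (a, b, c)))))) => //.
apply: (continuous_segint (f := fun (p : X * R) b =>
  segint (- M) M (fun c => F p.1 (vec3 (p.2, b, c))))) => //.
apply: (continuous_segint (f := fun (p : X * R * R) c => F p.1.1 (vec3 (p.1.2, p.2, c)))) => //.
by cont.
Qed.

Let cont1 M f : 0 <= M -> continuous f ->
  continuous (fun p : R * R => segint (- M) M (fun z => f (vec3 (p.1, p.2, z)))).
Proof.
move=> M0 cf; apply: (continuous_segint (f := fun (p : R * R) z => f (vec3 (p.1, p.2, z)))); last by cont.
by lra.
Qed.

Let cont1s M f x : 0 <= M -> continuous f ->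
  continuous (fun y => segint (- M) M (fun z => f (vec3 (x, y, z)))).
Proof.
move=> M0 cf; apply: (continuous_segint (f := fun y z => f (vec3 (x, y, z)))); last by cont.
by lra.
Qed.

Let cont2 M f : 0 <= M -> continuous f ->
  continuous (fun x => segint (- M) M (fun y => segint (- M) M (fun z => f (vec3 (x, y, z))))).
Proof.
move=> M0 cf.
apply: (continuous_segint (f := fun x y => segint (- M) M (fun z => f (vec3 (x, y, z))))).
  by lra.
exact: cont1.
Qed.

Lemma box_intD M f g : 0 <= M -> continuous f -> continuous g ->
  box_int M (fun x => f x + g x) = box_int M f + box_int M g.
Proof.
move=> M0 cf cg; have MM : - M <= M by lra.
rewrite /box_int -segintD; last 2 first.
- exact: cont2.
- exact: cont2.
apply: eq_segint => x _; rewrite -segintD; last 2 first.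
- exact: cont1s.
- exact: cont1s.
by apply: eq_segint => y _; rewrite -segintD//; cont.
Qed.

Lemma box_intZ M k f : 0 <= M -> continuous f ->
  box_int M (fun x => k * f x) = k * box_int M f.
Proof.
move=> M0 cf; have MM : - M <= M by lra.
rewrite /box_int -segintZ; last exact: cont2.
apply: eq_segint => x _; rewrite -segintZ; last exact: cont1s.
by apply: eq_segint => y _; rewrite -segintZ//; cont.
Qed.

Lemma box_int_swap12 M f : 0 <= M -> continuous f ->
  box_int M f = segint (- M) M (fun x => segint (- M) M (fun z =>
    segint (- M) M (fun y => f (vec3 (x, y, z))))).
Proof.
move=> M0 cf; have MM : - M <= M by lra.
apply: eq_segint => x _.
by rewrite (segint_swap (f := fun y z => f (vec3 (x, y, z))))//; cont.
Qed.

Lemma box_int_swap012 M f : 0 <= M -> continuous f ->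
  box_int M f = segint (- M) M (fun y => segint (- M) M (fun z =>
    segint (- M) M (fun x => f (vec3 (x, y, z))))).
Proof.
move=> M0 cf; have MM : - M <= M by lra.
rewrite /box_int (segint_swap (f := fun x y => segint (- M) M (fun z => f (vec3 (x, y, z)))))//; last exact: cont1.
apply: eq_segint => y _.
by rewrite (segint_swap (f := fun x z => f (vec3 (x, y, z))))//; cont.
Qed.

Lemma vec3D (x y z h : R) :
  (vec3 (x, y, z) + h *: basis_vec R 0 = vec3 (x + h, y, z)) *
  (vec3 (x, y, z) + h *: basis_vec R 1 = vec3 (x, y + h, z)) *
  (vec3 (x, y, z) + h *: basis_vec R 2%:R = vec3 (x, y, z + h)).
Proof.
by split; [split|]; apply/rowP; apply: ord3_ind;
  rewrite !mxE/= ?mulr1 ?mulr0 ?addr0.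
Qed.

(** For a curve c that is affine near t. *)
Lemma is_derive_shift_line (V W : normedModType R) (g : V -> W) (c : R -> V) (v : V) (t : R) dg :
  (forall h, c (t + h) = c t + h *: v) -> is_derive (c t) v g dg ->
  is_derive t 1 (fun t => g (c t)) dg.
Proof.
move=> cE /is_derive_line dl; apply/is_derive_line.
rewrite (_ : (fun h => _) = fun h => g (c t + h *: v))//.
by apply/funext => h; rewrite -cE /GRing.scale/= mulr1.
Qed.

Lemma supported_in_partial M N i g : M < N -> supported_in M g ->
  supported_in N (partial i g).
Proof.
move=> MN sg x j Nx; rewrite /partial.
have ng : \near x, 0 = g x.
  near=> y; rewrite (sg y j)//; apply: ltW.
  near: y; apply: (cvgr_gt (`|x 0 j|)); last exact: lt_le_trans Nx.
  by apply: (cont_norm (f := fun x : 'rV[R]_3 => x 0 j)); cont.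
by have ? := near_eq_is_derive ng (is_derive_cst 0 x (basis_vec R i)); exact: derive_val.
Unshelve. all: by end_near. Qed.

(** The integral of a partial derivative of a compactly supported function
    vanishes: integrate first along the line of differentiation. *)
Lemma integral3_partial M i g : 0 <= M -> supported_in M g ->
  (forall x, derivable g x (basis_vec R i)) -> continuous (partial i g) ->
  integral3 (partial i g) = 0.
Proof.
move=> M0 sg dg cp; have MN : M < M + 1 by rewrite ltrDl.
have N0 : 0 <= M + 1 by rewrite addr_ge0.
have NN : - (M + 1) <= M + 1 by lra.
rewrite (integral3_box N0 cp (supported_in_partial i MN sg)).
have Mend (t : R) : `|t| = M + 1 -> M <= `|t| by move=> ->; exact: ltW.
have z1 : `|M + 1| = M + 1 by rewrite ger0_norm.
have z2 : `|- (M + 1)| = M + 1 by rewrite normrN.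
have zero a b (F : R -> R) : a <= b -> (forall x, F x = 0) -> segint a b F = 0.
  by move=> ab F0; rewrite (eq_segint (g := fun=> 0)) ?segint_cst ?mul0r.
move: i dg cp; apply: ord3_ind => dg cp.
- rewrite (box_int_swap012 N0 cp); apply: (zero) => //= y; apply: (zero) => //= z.
  have cF : continuous (fun t => partial 0 g (vec3 (t, y, z))) by cont.
  have dF (t : R) : is_derive t 1 (fun t => g (vec3 (t, y, z))) (partial 0 g (vec3 (t, y, z))).
    apply: (is_derive_shift_line (c := fun t => vec3 (t, y, z)) (v := basis_vec R 0)).
      by move=> h; rewrite vec3D.
    exact: derivableP.
  rewrite (segint_FTC2 NN cF (fun t _ => dF t)).
  by rewrite !(sg _ 0) ?subrr// vec3E; exact: Mend.
- rewrite (box_int_swap12 N0 cp); apply: (zero) => //= x; apply: (zero) => //= z.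
  have cF : continuous (fun t => partial 1 g (vec3 (x, t, z))) by cont.
  have dF (t : R) : is_derive t 1 (fun t => g (vec3 (x, t, z))) (partial 1 g (vec3 (x, t, z))).
    apply: (is_derive_shift_line (c := fun t => vec3 (x, t, z)) (v := basis_vec R 1)).
      by move=> h; rewrite vec3D.
    exact: derivableP.
  rewrite (segint_FTC2 NN cF (fun t _ => dF t)).
  by rewrite !(sg _ 1) ?subrr// vec3E; exact: Mend.
- rewrite /box_int; apply: (zero) => //= x; apply: (zero) => //= y.
  have cF : continuous (fun t => partial 2%:R g (vec3 (x, y, t))) by cont.
  have dF (t : R) : is_derive t 1 (fun t => g (vec3 (x, y, t))) (partial 2%:R g (vec3 (x, y, t))).
    apply: (is_derive_shift_line (c := fun t => vec3 (x, y, t)) (v := basis_vec R 2%:R)).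
      by move=> h; rewrite vec3D.
    exact: derivableP.
  rewrite (segint_FTC2 NN cF (fun t _ => dF t)).
  by rewrite !(sg _ 2%:R) ?subrr// vec3E; exact: Mend.
Qed.

Lemma compact_bounded_rV (K : set 'rV[R]_3) : compact K ->
  exists2 M, 0 <= M & forall x i, K x -> `|x 0 i| <= M.
Proof.
move=> cK.
have H i : exists2 C, 0 <= C & forall x, K x -> `|x 0 i| <= C.
  by apply: (@continuous_bounded_on _ (fun x : 'rV[R]_3 => x 0 i) _ cK); cont.
have [C0 C00 H0] := H 0; have [C1 C10 H1] := H 1; have [C2 C20 H2] := H 2%:R.
exists (C0 + C1 + C2); first by rewrite !addr_ge0.
move=> x i Kx; move: i; apply: ord3_ind.
- by apply: le_trans (H0 x Kx) _; lra.
- by apply: le_trans (H1 x Kx) _; lra.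
- by apply: le_trans (H2 x Kx) _; lra.
Qed.

Lemma compact_support_supported (V : nmodType) (f : 'rV[R]_3 -> V) : compact_support f ->
  exists2 M, 0 <= M & supported_in M f.
Proof.
move=> /compact_bounded_rV[M M0 HM]; exists (M + 1); first by rewrite addr_ge0.
move=> x i Mx; apply/eqP; apply: contraTT Mx => fx0; rewrite -ltNge.
apply: le_lt_trans (HM x i _) _; last by rewrite ltrDl.
exact: subset_closure.
Qed.

Lemma continuous_loc_integrable f : continuous f -> loc_integrable f.
Proof.
move=> cf K cK.
have [M M0 HM] := compact_bounded_rV cK.
apply: (@continuous_integrable3 M (fun p => f (vec3 p))).
- rewrite -[X in measurable X]setCK; apply: measurableC; apply: open_measurable3.
  have /closed_openC oK := compact_closed (@norm_hausdorff _ 'rV[R]_3) cK.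
  by move/continuousP : continuous_vec3 => /(_ _ oK).
- move=> [[x y] z] /= Kv; rewrite /cube3 /=.
  have H i := HM _ i Kv.
  by move: (H 0) (H 1) (H 2%:R); rewrite !vec3E !ler_norml
    => a b c; split; [split|] => /=; rewrite in_itv.
exact: (cont_comp cf continuous_vec3).
Qed.

End Space.

(** * Directional derivatives and Schwarz's theorem *)

Section DerivativeRules.
Context {R : realType} {W : normedModType R}.
Implicit Types (x v : W) (f g : W -> R).

Lemma derM x v f g df dg : is_derive x v f df -> is_derive x v g dg ->
  is_derive x v (fun y => f y * g y) (df * g x + f x * dg).
Proof.
move=> hf hg; apply: is_derive_eq (is_deriveM hf hg) _.
by rewrite /GRing.scale/= addrC mulrC.
Qed.

Lemma derD x v f g df dg : is_derive x v f df -> is_derive x v g dg ->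
  is_derive x v (fun y => f y + g y) (df + dg).
Proof. by move=> hf hg; exact: is_deriveD. Qed.

Lemma derB x v f g df dg : is_derive x v f df -> is_derive x v g dg ->
  is_derive x v (fun y => f y - g y) (df - dg).
Proof. by move=> hf hg; exact: is_deriveB. Qed.

Lemma derZ x v (k : R) f df : is_derive x v f df ->
  is_derive x v (fun y => k * f y) (k * df).
Proof. by move=> hf; exact: is_deriveZ. Qed.

Lemma der_cst x v (k : R) : is_derive x v (fun=> k) 0.
Proof. exact: is_derive_cst. Qed.

Lemma der_comp (f : R -> R) g x v a b :
  is_derive (g x) 1 f a -> is_derive x v g b ->
  is_derive x v (fun y => f (g y)) (a * b).
Proof.
move=> df /is_derive_line dg; apply/is_derive_line.
have h0 : g (x + 0 *: v) = g x by rewrite scale0r addr0.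
apply: (@is_derive1_comp R f (fun h => g (x + h *: v)) 0 a b) => //.
by rewrite h0.
Qed.

Lemma der_eq x v f df df' : is_derive x v f df -> df = df' -> is_derive x v f df'.
Proof. by move=> h <-. Qed.

Lemma der_unique x v f df df' : is_derive x v f df -> is_derive x v f df' -> df = df'.
Proof. by move=> h1 h2; rewrite -(@derive_val _ _ _ _ _ _ _ h1) (@derive_val _ _ _ _ _ _ _ h2). Qed.

Lemma der_ext x v f g df : (forall y, f y = g y) -> is_derive x v f df -> is_derive x v g df.
Proof. by move=> /funext ->. Qed.

End DerivativeRules.

Section CoordinateDerivatives.
Context {R : realType}.
Implicit Types (x v : 'rV[R]_3).

Lemma der_coord x v (i : 'I_3) : is_derive x v (fun y : 'rV[R]_3 => y 0 i) (v 0 i).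
Proof.
apply/is_derive_line.
rewrite (_ : (fun h : R => _) = fun h : R => x 0 i + v 0 i * h); last first.
  by apply/funext => h; rewrite !mxE mulrC.
apply: der_eq (derD (der_cst _ _ _) (derZ _ (is_derive_id _ _))) _.
by rewrite add0r mulr1.
Qed.

Lemma basis_vecE (i j : 'I_3) : basis_vec R i 0 j = (i == j)%:R.
Proof. by rewrite /basis_vec mxE eqxx eq_sym. Qed.

(** Schwarz's theorem, by differentiating under the integral sign in
    f (y + b e_j) - f (y - e_j) = int_(-1)^b (d_j f) (y + t e_j) dt. *)
Lemma partialC (i j : 'I_3) (f : 'rV[R]_3 -> R) : class_C 2 f ->
  partial i (partial j f) = partial j (partial i f).
Proof.
move=> [cf Cf]; apply/funext => x.
have [dfi [cfi Cfi]] := Cf i; have [dfj [cfj Cfj]] := Cf j.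
have [dfji cfji] := Cfj i; have [dfij cfij] := Cfi j.
rewrite /= in cfji cfij.
pose ej := basis_vec R j; pose ei := basis_vec R i.
have E (b : R) (y : 'rV[R]_3) : -1 <= b -> f (y + b *: ej) - f (y - ej) =
    segint (-1) b (fun t => partial j f (y + t *: ej)).
  move=> b1; have cg : continuous (fun t : R => partial j f (y + t *: ej)) by cont.
  have dF (t : R) : is_derive t 1 (fun t => f (y + t *: ej)) (partial j f (y + t *: ej)).
    apply: (is_derive_shift_line (c := fun t => y + t *: ej) (v := ej)).
      by move=> h; rewrite scalerDl addrA.
    exact: derivableP.
  by rewrite (segint_FTC2 b1 cg (fun t _ => dF t)) scaleN1r.
have D (b : R) : -1 <= b -> partial i f (x + b *: ej) - partial i f (x - ej) =
    segint (-1) b (fun t => partial i (partial j f) (x + t *: ej)).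
  move=> b1.
  have sh (w : 'rV[R]_3) : is_derive x ei (fun y => f (y + w)) (partial i f (x + w)).
    apply/is_derive_line; apply: (is_derive_shift_line (c := fun t => x + t *: ei + w) (v := ei)).
      by move=> h; rewrite scalerDl addrA [LHS]addrAC.
    by rewrite scale0r addr0; exact: derivableP.
  have d1 := derB (sh (b *: ej)) (sh (- ej)).
  apply: (der_unique d1).
  apply: (der_ext (f := fun y => segint (-1) b (fun t => partial j f (y + t *: ej)))).
    by move=> y; rewrite -E.
  pose F (y : 'rV[R]_3) (t : R) := partial j f (y + t *: ej).
  pose G (y : 'rV[R]_3) (t : R) := partial i (partial j f) (y + t *: ej).
  have cF : continuous (fun p : 'rV[R]_3 * R => F p.1 p.2) by rewrite /F; cont.
  have cG : continuous (fun p : 'rV[R]_3 * R => G p.1 p.2) by rewrite /G; cont.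
  have dF (w : 'rV[R]_3) (t : R) : is_derive w ei (F ^~ t) (G w t).
    apply/is_derive_line.
    apply: (is_derive_shift_line (c := fun s => w + s *: ei + t *: ej) (v := ei)).
      by move=> h; rewrite scalerDl addrA [LHS]addrAC.
    by rewrite scale0r addr0; exact: derivableP.
  exact: (is_derive_segint x b1 cF cG dF).
have c2 : continuous (fun t : R => partial i (partial j f) (x + t *: ej)) by cont.
have h1 := @segint_FTC1 R (-1) 0 _ (ltrN10 R) c2.
have h2 : is_derive (0 : R) 1 (fun b => partial i f (x + b *: ej)) (partial j (partial i f) x).
  apply: (is_derive_shift_line (c := fun b => x + b *: ej) (v := ej)).
    by move=> h; rewrite scalerDl addrA.
  by rewrite scale0r addr0; exact: derivableP.
have h3 := derB h2 (der_cst _ _ (partial i f (x - ej))).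
have ne : \forall b \near (0 : R), segint (-1) b (fun t : R => partial i (partial j f) (x + t *: ej)) =
    partial i f (x + b *: ej) - partial i f (x - ej).
  near=> b; rewrite D//; apply: ltW; near: b.
  by apply: lt_nbhsr; rewrite ltrN10.
have := der_unique (near_eq_is_derive ne h1) h3.
by rewrite scale0r addr0 subr0.
Unshelve. all: by end_near. Qed.

End CoordinateDerivatives.

(** * Flat functions *)

Section FlatFunctions.
Context {R : realType}.
Implicit Types (P : {poly R}) (t : R).

(** t |-> P(1/t) exp(-1/t), extended by 0: a family closed under
    differentiation, hence made of smooth functions, all flat at 0. *)
Definition expinv P t : R := if 0 < t then P.[t^-1] * expR (- t^-1) else 0.

Lemma expinv0 P t : t <= 0 -> expinv P t = 0.
Proof. by rewrite /expinv ltNge => ->. Qed.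

(** exp (- u) beats every power of u = 1/t. *)
Lemma expinv_bound P : exists2 C, 0 <= C & forall t, 0 < t -> `|expinv P t| <= C * t.
Proof.
pose C := \sum_(i < size P) `|P`_i| * i.+1%:R ^+ i.+1.
exists C; first by apply: sumr_ge0 => i _; rewrite mulr_ge0// exprn_ge0.
move=> t t0; rewrite /expinv t0; set u := t^-1.
have u0 : 0 < u by rewrite invr_gt0.
rewrite normrM (ger0_norm (expR_ge0 _)) horner_coef.
apply: (@le_trans _ _ ((\sum_(i < size P) `|P`_i| * u ^+ i) * expR (- u))).
  rewrite ler_wpM2r ?expR_ge0//; apply: le_trans (ler_norm_sum _ _ _) _.
  by apply: ler_sum => i _; rewrite normrM (ger0_norm (exprn_ge0 _ (ltW u0))).
rewrite mulr_suml /C mulr_suml; apply: ler_sum => i _.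
rewrite -!mulrA ler_wpM2l//.
rewrite -[t]invrK -/u ler_pdivlMr//.
(* exp u = (exp (u / n))^n >= (u / n)^n with n = i + 1 *)
have E : (u / i.+1%:R) ^+ i.+1 <= expR u.
  have -> : expR u = expR (u / i.+1%:R) ^+ i.+1.
    by rewrite -expRM_natl mulrC divfK// pnatr_eq0.
  rewrite lerXn2r ?nnegrE ?expR_ge0//; first by rewrite divr_ge0// ltW.
  by apply: le_trans (expR_ge1Dx _); rewrite lerDr.
rewrite mulrAC -exprSr expRN ler_pdivrMr ?expR_gt0//.
by move: E; rewrite expr_div_n ler_pdivrMr ?exprn_gt0 ?ltr0n// mulrC.
Qed.

Lemma is_derive_expinv P t :
  is_derive t 1 (expinv P) (expinv ('X^2 * (P - P^`())) t).
Proof.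
have [t0|t0|->] := ltgtP t 0.
- have ne : \near t, 0 = expinv P t.
    near=> s; rewrite expinv0//; apply: ltW; near: s; exact: lt_nbhsl.
  have h := near_eq_is_derive ne (is_derive_cst 0 t 1).
  by apply: der_eq h _; rewrite expinv0// ltW.
- have ne : \forall s \near t, P.[s^-1] * expR (- s^-1) = expinv P s.
    by near=> s; rewrite /expinv ifT//; near: s; exact: lt_nbhsr.
  apply: near_eq_is_derive ne _.
  have hV : is_derive t 1 (fun s : R => s^-1) (- t ^- 2).
    by apply: is_derive_eq (is_deriveV _ _) _; [rewrite gt_eqF|
       rewrite /GRing.scale/= mulr1].
  have hp := der_comp (is_derive_poly P t^-1) hV.
  have hN := derZ (-1) hV.
  have he := der_comp (is_derive_expR _) hN.
  have h : is_derive t 1 (fun s : R => P.[s^-1] * expR (- s^-1))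
      (P^`().[t^-1] * - t ^- 2 * expR (-1 * t^-1) +
       P.[t^-1] * (expR (-1 * t^-1) * (-1 * - t ^- 2))).
    rewrite (_ : (fun s : R => _) = fun s : R => P.[s^-1] * expR (-1 * s^-1)); last first.
      by apply/funext => s; rewrite mulN1r.
    exact: derM.
  apply: der_eq h _; rewrite /expinv t0 -exprVn mulN1r.
  set u := t^-1; rewrite hornerM hornerXn hornerD hornerN.
  by move: P.[u] P^`().[u] (expR _) => p p' E; ring.
- rewrite (@expinv0 _ 0)//.
  have [C C0 HC] := expinv_bound ('X * P).
  have lim0 : h^-1 *: ((expinv P \o shift 0) (h *: 1) - expinv P 0) @[h --> 0^'] --> (0 : R).
    apply/cvgrPdist_le => e e0; near=> h.
    have h0 : h != 0 by near: h; exact: nbhs_dnbhs_neq.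
    rewrite sub0r normrN /= addr0 (expinv0 P (lexx 0)) subr0 /GRing.scale/= mulr1.
    have [hle|hgt] := leP h 0; first by rewrite expinv0// mulr0 normr0 ltW.
    rewrite (_ : h^-1 * expinv P h = expinv ('X * P) h); last first.
      by rewrite /expinv hgt hornerM hornerX; ring.
    apply: le_trans (HC _ hgt) _.
    have hd : `|h| <= e / (C + 1).
      near: h; apply: dnbhs0_le; rewrite divr_gt0//.
      by rewrite ltr_pwDr.
    apply: le_trans (_ : (C + 1) * (e / (C + 1)) <= e); last first.
      by rewrite mulrC divfK// gt_eqF// ltr_pwDr.
    apply: ler_pM => //; first exact: ltW.
      by rewrite lerDl.
    by rewrite -(gtr0_norm hgt).
  apply: DeriveDef; first by apply/cvg_ex; exists 0.
  exact: cvg_lim lim0.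
Unshelve. all: by end_near. Qed.

Lemma continuous_expinv P : continuous (expinv P).
Proof.
move=> t; apply: differentiable_continuous; apply/derivable1_diffP.
by have ? := is_derive_expinv P t; exact: ex_derive.
Qed.

Lemma expinv1_gt0 t : 0 < t -> 0 < expinv 1 t.
Proof. by move=> t0; rewrite /expinv t0 hornerE mul1r expR_gt0. Qed.

Lemma expinv1_ge0 t : 0 <= expinv 1 t.
Proof. by have [/expinv0->//|/expinv1_gt0/ltW] := leP t 0. Qed.

(** Products and sums of the flat functions of the coordinates: an algebra
    stable under partial derivatives, so its members are smooth. *)
Inductive flat_algebra : ('rV[R]_3 -> R) -> Prop :=
| flat_cst k : flat_algebra (fun=> k)
| flat_expinv P (a b : R) i : flat_algebra (fun x => expinv P (a * x 0 i + b))
| flat_add f g : flat_algebra f -> flat_algebra g -> flat_algebra (fun x => f x + g x)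
| flat_mul f g : flat_algebra f -> flat_algebra g -> flat_algebra (fun x => f x * g x).

Lemma flat_continuous f : flat_algebra f -> continuous f.
Proof.
elim=> [k|P a b i|{}f g _ cf _ cg|{}f g _ cf _ cg]; [|have ce := @continuous_expinv P| |]; cont.
Qed.

Lemma flat_partial f i : flat_algebra f -> exists2 g, flat_algebra g &
  forall x, is_derive x (basis_vec R i) f (g x).
Proof.
elim=> [k|P a b j|{}f g Ff [df Fdf Df] Fg [dg Fdg Dg]|{}f g Ff [df Fdf Df] Fg [dg Fdg Dg]].
- by exists (fun=> 0); [exact: flat_cst|move=> x; exact: der_cst].
- exists (fun x => expinv ('X^2 * (P - P^`())) (a * x 0 j + b) * (a * basis_vec R i 0 j + 0)).
    by apply: flat_mul; [exact: flat_expinv|exact: flat_cst].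
  move=> x; apply: (der_comp (f := expinv P) (g := fun x : 'rV[R]_3 => a * x 0 j + b)).
    exact: is_derive_expinv.
  exact: (derD (derZ a (der_coord x _ j)) (der_cst x _ b)).
- by exists (fun x => df x + dg x); [exact: flat_add|move=> x; exact: derD].
- exists (fun x => df x * g x + f x * dg x); last by move=> x; exact: derM.
  by apply: flat_add; exact: flat_mul.
Qed.

Lemma flat_smooth f : flat_algebra f -> smooth f.
Proof.
move=> Ff k; elim: k f Ff => [|k IH] f Ff /=; first exact: flat_continuous.
split=> [|i]; first exact: flat_continuous.
have [g Fg dg] := flat_partial i Ff.
split=> [x|]; first by have ? := dg x; exact: ex_derive.
rewrite (_ : partial i f = g); first exact: IH.
by apply/funext => x; rewrite /partial; have ? := dg x; exact: derive_val.
Qed.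

End FlatFunctions.

(** * Changes of variables *)

Section Rescaling.
Context {R : realType}.
Implicit Types (f : 'rV[R]_3 -> R) (x : 'rV[R]_3).

Lemma segint_affine (a b k c : R) (g : R -> R) : 0 < k -> a <= b -> continuous g ->
  k * segint a b (fun t => g (k * t + c)) = segint (k * a + c) (k * b + c) g.
Proof.
move=> k0 ab cg; pose o := k * a + c - 1.
have cgk : continuous (fun t => g (k * t + c)) by cont.
have oa : o <= k * a + c by rewrite /o; lra.
have kab : k * a + c <= k * b + c by rewrite lerD2r ler_wpM2l// ltW.
have dF (t : R) : a <= t <= b ->
    is_derive t 1 (fun t => segint o (k * t + c) g) (k * g (k * t + c)).
  move=> /andP[at_ _].
  have ot : o < k * t + c.
    by have := ler_wpM2l (ltW k0) at_; rewrite /o; lra.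
  have d1 := segint_FTC1 ot cg.
  have d2 : is_derive t 1 (fun t => k * t + c) (k * 1 + 0).
    exact: (derD (derZ k (is_derive_id t 1)) (der_cst t 1 c)).
  have d3 := der_comp (g := fun t => k * t + c) (x := t) d1 d2; rewrite mulr1 addr0 mulrC in d3; exact: d3.
rewrite -segintZ// (segint_FTC2 ab _ dF); last by cont.
by rewrite (segint_cat oa kab)// addrC addKr.
Qed.

Lemma segint_supp (a b c d : R) (g : R -> R) : c <= a -> a <= b -> b <= d ->
  continuous g -> (forall t, t <= a -> g t = 0) -> (forall t, b <= t -> g t = 0) ->
  segint c d g = segint a b g.
Proof.
move=> ca ab bd cg g1 g2.
have z u v : u <= v -> (forall t, u <= t <= v -> g t = 0) -> segint u v g = 0.
  by move=> uv H; rewrite (eq_segint (g := fun=> 0))// segint_cst// mul0r.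
rewrite (segint_cat ca (le_trans ab bd))// (segint_cat ab bd)//.
rewrite [segint c a g]z ?[segint b d g]z ?add0r ?addr0// => t /andP[t1 t2].
  exact: g2.
exact: g1.
Qed.

Lemma segint_rescale (h : R -> R) (e x L : R) : continuous h ->
  (forall y, 1 <= `|y| -> h y = 0) -> 0 < e -> `|x| + e <= L ->
  segint (-1) 1 h = e^-1 * segint (- L) L (fun z => h (e^-1 * (z - x))).
Proof.
move=> ch h0 e0 xL.
have ei0 : 0 < e^-1 by rewrite invr_gt0.
have [xL1 xL2] : - L <= x - e /\ x + e <= L.
  by split; move: xL; have := ler_norm x; have := ler_norm (- x); rewrite normrN; lra.
have E : (fun z => h (e^-1 * (z - x))) = fun z => h (e^-1 * z + - (e^-1 * x)).
  by apply/funext => z; rewrite mulrBr.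
rewrite (@segint_supp (x - e) (x + e) (- L) L)//.
- rewrite E segint_affine//; last by lra.
  by congr segint; field; rewrite gt_eqF.
- by lra.
- by rewrite E; cont.
- move=> t tx; apply: h0; rewrite ler0_norm.
    by rewrite -mulrN ler_pdivlMl// mulr1; lra.
  by rewrite mulr_ge0_le0 ?ltW//; lra.
- move=> t tx; apply: h0; rewrite ger0_norm; first by rewrite ler_pdivlMl// mulr1; lra.
  by rewrite mulr_ge0 ?ltW//; lra.
Qed.

(** The affine substitution is made one coordinate at a time; the support
    condition makes the enlarged box irrelevant. *)
Lemma box_int_rescale f (e L : R) x : continuous f -> supported_in 1 f -> 0 < e ->
  (forall i, `|x 0 i| + e <= L) ->
  box_int 1 f = e^-1 ^+ 3 * box_int L (fun z => f (e^-1 *: (z - x))).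
Proof.
move=> cf sf e0 xL.
have L0 : - L <= L.
  by have := xL 0; have := normr_ge0 (x 0 0); lra.
pose s i (t : R) := e^-1 * (t - x 0 i).
have cs i : continuous (s i) by rewrite /s; cont.
have sE (a b c : R) : e^-1 *: (vec3 (a, b, c) - x) = vec3 (s 0 a, s 1 b, s 2%:R c).
  by apply/rowP; apply: ord3_ind; rewrite !mxE /=.
have z (a b : R) (F : R -> R) : a <= b -> (forall t, F t = 0) -> segint a b F = 0.
  by move=> ab F0; rewrite (eq_segint (g := fun=> 0)) ?segint_cst ?mul0r.
have N1 : -1 <= (1 : R) by lra.
rewrite /box_int.
have -> : segint (- L) L (fun a => segint (- L) L (fun b => segint (- L) L (fun c =>
    f (e^-1 *: (vec3 (a, b, c) - x))))) =
  segint (- L) L (fun a => segint (- L) L (fun b => segint (- L) L (fun c =>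
    f (vec3 (s 0 a, s 1 b, s 2%:R c))))).
  by apply: eq_segint => a _; apply: eq_segint => b _; apply: eq_segint => c _; rewrite sE.
pose F1 a b := segint (- L) L (fun c => f (vec3 (a, b, s 2%:R c))).
have cF1 : continuous (fun p : R * R => F1 p.1 p.2).
  apply: (continuous_segint (f := fun (p : R * R) c => f (vec3 (p.1, p.2, s 2%:R c)))) => //.
  by cont.
have cF1s a : continuous (F1 a) by apply: (continuous_slice (f := F1)).
have F10 a b : 1 <= `|a| \/ 1 <= `|b| -> F1 a b = 0.
  move=> ab; apply: (z) => // c; case: ab => ab.
    by apply: (sf _ 0); rewrite vec3E.
  by apply: (sf _ 1); rewrite vec3E.
pose F2 a := segint (- L) L (fun b => F1 a (s 1 b)).
have cF2 : continuous F2.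
  by apply: (continuous_segint (f := fun a b => F1 a (s 1 b))) => //; cont.
have F20 a : 1 <= `|a| -> F2 a = 0.
  by move=> a1; apply: (z) => // b; apply: F10; left.
have E1 a b : segint (-1) 1 (fun c => f (vec3 (a, b, c))) = e^-1 * F1 a b.
  rewrite (@segint_rescale _ e (x 0 2%:R) L)//; first by cont.
  by move=> y y1; apply: (sf _ 2%:R); rewrite vec3E.
have E2 a : segint (-1) 1 (fun b => e^-1 * F1 a b) = e^-1 * (e^-1 * F2 a).
  rewrite segintZ//.
  rewrite (@segint_rescale _ e (x 0 1) L)//.
  by move=> y y1; apply: F10; right.
have E3 : segint (-1) 1 F2 = e^-1 * segint (- L) L (fun a => F2 (s 0 a)).
  by rewrite (@segint_rescale _ e (x 0 0) L).
transitivity (segint (-1) 1 (fun a => e^-1 * (e^-1 * F2 a))).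
  apply: eq_segint => a _; rewrite -E2.
  by apply: eq_segint => b _; rewrite -E1.
rewrite segintZ; last by cont.
by rewrite segintZ// E3 !exprS expr0 mulr1 !mulrA.
Qed.

Lemma is_derive_box_int (W : normedModType R) (M : R) (F G : W -> 'rV[R]_3 -> R) (w v : W) : 0 <= M ->
  continuous (fun p : W * 'rV[R]_3 => F p.1 p.2) ->
  continuous (fun p : W * 'rV[R]_3 => G p.1 p.2) ->
  (forall y z, is_derive y v (F ^~ z) (G y z)) ->
  is_derive w v (fun y => box_int M (F y)) (box_int M (G w)).
Proof.
move=> M0 cF cG dF; have MM : - M <= M by lra.
pose I1 (H : W -> 'rV[R]_3 -> R) (w : W) (a b : R) := segint (- M) M (fun c => H w (vec3 (a, b, c))).
pose I2 (H : W -> 'rV[R]_3 -> R) (w : W) (a : R) := segint (- M) M (I1 H w a).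
have cI1 H : continuous (fun p : W * 'rV[R]_3 => H p.1 p.2) ->
    continuous (fun p : W * R * R => I1 H p.1.1 p.1.2 p.2).
  move=> cH; apply: (continuous_segint (f := fun (p : W * R * R) c => H p.1.1 (vec3 (p.1.2, p.2, c)))) => //.
  by cont.
have cI2 H : continuous (fun p : W * 'rV[R]_3 => H p.1 p.2) ->
    continuous (fun p : W * R => I2 H p.1 p.2).
  move=> cH; apply: (continuous_segint (f := fun (p : W * R) b => I1 H p.1 p.2 b)) => //.
  exact: cI1.
have cI1s H a : continuous (fun p : W * 'rV[R]_3 => H p.1 p.2) ->
    continuous (fun p : W * R => I1 H p.1 a p.2).
  move=> cH; apply: (continuous_segint (f := fun (p : W * R) c => H p.1 (vec3 (a, p.2, c)))) => //.
  by cont.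
have d1 (y : W) a b : is_derive y v (fun y => I1 F y a b) (I1 G y a b).
  apply: (is_derive_segint (f := fun y c => F y (vec3 (a, b, c))) (g := fun y c => G y (vec3 (a, b, c)))) => //.
    by cont.
  by cont.
have d2 (y : W) a : is_derive y v (fun y => I2 F y a) (I2 G y a).
  apply: (is_derive_segint (f := fun y b => I1 F y a b) (g := fun y b => I1 G y a b)) => //.
    exact: cI1s.
  exact: cI1s.
apply: (is_derive_segint (f := fun y a => I2 F y a) (g := fun y a => I2 G y a)) => //.
  exact: cI2.
exact: cI2.
Qed.

Lemma compact_box M : compact [set v : 'rV[R]_3 | forall i, `|v 0 i| <= M].
Proof.
rewrite (_ : mkset _ = [set v : 'rV[R]_3 | forall i, `[- M, M]%classic (v ord0 i)]).
  by apply: (@rV_compact R 3 (fun=> `[- M, M]%classic)) => i; exact: segment_compact.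
by apply/seteqP; split => v H i; have := H i; rewrite /= in_itv/= -ler_norml.
Qed.

Lemma supported_compact_support (V : nmodType) M (f : 'rV[R]_3 -> V) :
  supported_in M f -> compact_support f.
Proof.
move=> sf; have cK := @compact_box M.
apply: (subclosed_compact _ cK); first exact: closed_closure.
have cK' := compact_closed (@norm_hausdorff _ 'rV[R]_3) cK.
rewrite [X in _ `<=` X](closure_id _).1//; apply: closure_subset => x /= fx0 i.
rewrite leNgt; apply/negP => /ltW Mx.
by rewrite (sf x i Mx) eqxx in fx0.
Qed.

End Rescaling.

(** * Mollification of a divergence free field *)

Section Mollifier.
Context {R : realType}.
Implicit Types (x v : 'rV[R]_3) (t : R).

Lemma ord3D : (((0 + 1)%R = 1%R :> 'I_3) * ((0 + 2%:R)%R = 2%:R%R :> 'I_3) *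
  ((1 + 1)%R = 2%:R%R :> 'I_3) * ((1 + 2%:R)%R = 0%R :> 'I_3) *
  ((2%:R + 1)%R = 0%R :> 'I_3) * ((2%:R + 2%:R)%R = 1%R :> 'I_3))%type.
Proof. by repeat split; exact: val_inj. Qed.

Let bell0 t := expinv 1 (t + 1) * expinv 1 (1 - t).

Let cont_bell0 : continuous bell0.
Proof. by have ce := @continuous_expinv R 1; rewrite /bell0; cont. Qed.

Let mass := segint (-1) 1 bell0.

Let bell0_ge0 t : 0 <= bell0 t.
Proof. by rewrite mulr_ge0 ?expinv1_ge0. Qed.

Let mass_gt0 : 0 < mass.
Proof.
have h0 : 0 < (2%:R : R) by [].
have [c cI Hc] : exists2 c, c \in `[-(2%:R^-1), 2%:R^-1 : R] &
    forall t, t \in `[-(2%:R^-1), 2%:R^-1 : R] -> bell0 c <= bell0 t.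
  by apply: EVT_min; [lra|exact: continuous_subspaceT].
have c0 : 0 < bell0 c.
  by move: cI; rewrite in_itv/= => /andP[a b]; rewrite mulr_gt0 ?expinv1_gt0//; lra.
have s0 (a b : R) : a <= b -> 0 <= segint a b bell0.
  move=> ab; rewrite -[leLHS](mul0r (b - a)) -segint_cst//.
  by apply: le_segint => //; cont.
have l1 : (-1 : R) <= - 2%:R^-1 by lra.
have l2 : - 2%:R^-1 <= (2%:R^-1 : R) by lra.
have l3 : (2%:R^-1 : R) <= 1 by lra.
rewrite /mass (segint_cat l1 (le_trans l2 l3) cont_bell0).
rewrite (segint_cat l2 l3 cont_bell0).
rewrite ltr_wpDl ?s0// ltr_pwDl ?s0//.
apply: (@lt_le_trans _ _ (bell0 c * (2%:R^-1 - - 2%:R^-1))).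
  by rewrite mulr_gt0//; lra.
rewrite -segint_cst; last by lra.
by apply: le_segint => //; cont.
Qed.

Definition bell t := mass^-1 * bell0 t.

Let flat1 : {poly R} := 'X^2 * (1 - 1^`()).

(** The derivative of bell: flat1 is the polynomial given by the derivation rule of
    the functions expinv P for P = 1. *)
Definition dbell t := mass^-1 *
  (expinv flat1 (t + 1) * expinv 1 (1 - t) - expinv 1 (t + 1) * expinv flat1 (1 - t)).

Lemma continuous_bell : continuous bell.
Proof. by rewrite /bell; cont. Qed.

Lemma continuous_dbell : continuous dbell.
Proof.
have ce := @continuous_expinv R 1; have cf := @continuous_expinv R flat1.
by rewrite /dbell; cont.
Qed.

Lemma is_derive_bell t : is_derive t 1 bell (dbell t).
Proof.
apply: derZ; rewrite /bell0.
have h1 : is_derive t 1 (fun t : R => t + 1) (1 + 0).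
  exact: (derD (is_derive_id t 1) (der_cst t 1 1)).
have h2 : is_derive t 1 (fun t : R => 1 - t) (0 - 1).
  exact: (derB (der_cst t 1 1) (is_derive_id t 1)).
have d1 := der_comp (g := fun t : R => t + 1) (x := t) (is_derive_expinv 1 (t + 1)) h1.
have d2 := der_comp (g := fun t : R => 1 - t) (x := t) (is_derive_expinv 1 (1 - t)) h2.
apply: der_eq (derM d1 d2) _.
by rewrite addr0 mulr1 sub0r mulrN1 mulrN.
Qed.

Lemma bell_supp t : 1 <= `|t| -> bell t = 0.
Proof.
move=> t1; rewrite /bell /bell0; have [t0|t0] := leP 0 t.
  by rewrite [expinv 1 (1 - t)]expinv0 ?mulr0//; move: t1; rewrite ger0_norm//; lra.
by rewrite [expinv 1 (t + 1)]expinv0 ?mul0r ?mulr0//; move: t1; rewrite ltr0_norm//; lra.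
Qed.

Lemma dbell_supp t : 1 <= `|t| -> dbell t = 0.
Proof.
move=> t1; rewrite /dbell; have [t0|t0] := leP 0 t.
  rewrite [expinv 1 (1 - t)]expinv0; last by move: t1; rewrite ger0_norm//; lra.
  rewrite [expinv _ (1 - t)]expinv0; last by move: t1; rewrite ger0_norm//; lra.
  by rewrite !mulr0 subr0 mulr0.
rewrite [expinv 1 (t + 1)]expinv0; last by move: t1; rewrite ltr0_norm//; lra.
rewrite [expinv _ (t + 1)]expinv0; last by move: t1; rewrite ltr0_norm//; lra.
by rewrite !mul0r subr0 mulr0.
Qed.

Lemma segint_bell : segint (-1) 1 bell = 1.
Proof. by rewrite /bell segintZ// mulVf// gt_eqF. Qed.

Lemma flat_bell (a b : R) i : flat_algebra (fun x => bell (a * x 0 i + b)).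
Proof.
rewrite (_ : (fun x => _) = fun x => mass^-1 * (expinv 1 (a * x 0 i + (b + 1)) *
    expinv 1 ((- a) * x 0 i + (1 - b)))).
  by apply: flat_mul; [exact: flat_cst|apply: flat_mul; exact: flat_expinv].
apply/funext => x; rewrite /bell /bell0; congr (_ * (expinv _ _ * expinv _ _)); ring.
Qed.

Definition kernel3 x := bell (x 0 0) * bell (x 0 1) * bell (x 0 2%:R).

Definition dkernel3 (j : 'I_3) x :=
  dbell (x 0 j) * (bell (x 0 (j + 1)) * bell (x 0 (j + 2%:R))).

Lemma continuous_kernel3 : continuous kernel3.
Proof. by have cb := continuous_bell; rewrite /kernel3; cont. Qed.

Lemma continuous_dkernel3 j : continuous (dkernel3 j).
Proof.
by have cb := continuous_bell; have cd := continuous_dbell; rewrite /dkernel3; cont.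
Qed.

Lemma kernel3_supp : supported_in 1 kernel3.
Proof.
move=> x i xi; rewrite /kernel3; move: i xi; apply: ord3_ind => /bell_supp ->.
- by rewrite !mul0r.
- by rewrite mulr0 mul0r.
- by rewrite mulr0.
Qed.

Lemma dkernel3_supp j : supported_in 1 (dkernel3 j).
Proof.
move=> x i xi; rewrite /dkernel3.
have [k|[k|k]] : i = j \/ i = j + 1 \/ i = j + 2%:R.
- move: j i {xi}; apply: ord3_ind; apply: ord3_ind; rewrite !ord3D; by [left|right;left|right;right].
- by rewrite -k dbell_supp// mul0r.
- by rewrite -k (bell_supp xi) mul0r mulr0.
- by rewrite -k (bell_supp xi) !mulr0.
Qed.

Lemma is_derive_kernel3 x v :
  is_derive x v kernel3 (\sum_j dkernel3 j x * v 0 j).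
Proof.
have db i := der_comp (is_derive_bell (x 0 i)) (der_coord x v i).
apply: der_eq (derM (derM (db 0) (db 1)) (db 2%:R)) _.
by rewrite sum3E /dkernel3 !ord3D; ring.
Qed.

Lemma box_int_kernel3 : box_int 1 kernel3 = 1.
Proof.
have cb := continuous_bell.
rewrite /box_int -[RHS]segint_bell; apply: eq_segint => a _.
rewrite -[RHS]mulr1 -[X in _ * X]segint_bell -segintZ//; apply: eq_segint => b _.
rewrite -[RHS]mulr1 -[X in _ * X]segint_bell -segintZ//; apply: eq_segint => c _.
by rewrite /kernel3 !vec3E.
Qed.

Variable B : 'rV[R]_3 -> 'rV[R]_3.
Hypothesis B_cont : continuous B.

(** The convolution of B with kernel3 at scale e. Integrating over the unit cube,
    instead of integrating B against the scaled kernel, makes it jointly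
    continuous in (e, x) down to e = 0, where it is B. *)
Definition moll (e : R) x : 'rV[R]_3 :=
  \row_i box_int 1 (fun y => B (x + e *: y) 0 i * kernel3 y).

Definition dmoll (e : R) (i : 'I_3) x : 'rV[R]_3 :=
  \row_j (- e^-1 * box_int 1 (fun y => B (x + e *: y) 0 i * dkernel3 j y)).

Lemma continuous_moll : continuous (fun p : R * 'rV[R]_3 => moll p.1 p.2).
Proof.
have ck := continuous_kernel3.
apply: cont_row => i.
apply: (cont_box_int (F := fun (p : R * 'rV[R]_3) y => B (p.2 + p.1 *: y) 0 i * kernel3 y)) => //.
by cont.
Qed.

Lemma continuous_dmoll e i : continuous (dmoll e i).
Proof.
apply: cont_row => j; have ck := @continuous_dkernel3 j.
apply: contM; first exact: cont_cst.
apply: (cont_box_int (F := fun x y => B (x + e *: y) 0 i * dkernel3 j y)) => //.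
by cont.
Qed.

Lemma moll0 x : moll 0 x = B x.
Proof.
apply/rowP => i; rewrite mxE.
have -> : (fun y => B (x + 0 *: y) 0 i * kernel3 y) = fun y => B x 0 i * kernel3 y.
  by apply/funext => y; rewrite scale0r addr0.
by rewrite box_intZ// ?box_int_kernel3 ?mulr1//; exact: continuous_kernel3.
Qed.

(** Substituting z = x + e y moves the dependence on x from B to the kernel. *)
Let moll_subst (e L : R) (k : 'rV[R]_3 -> R) i x : continuous k -> supported_in 1 k ->
  0 < e -> (forall i, `|x 0 i| + e <= L) ->
  box_int 1 (fun y => B (x + e *: y) 0 i * k y) =
  e^-1 ^+ 3 * box_int L (fun z => B z 0 i * k (e^-1 *: (z - x))).
Proof.
move=> ck sk e0 xL; rewrite (@box_int_rescale _ _ e L x)//.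
- congr (_ * box_int L _); apply/funext => z; congr (B _ 0 i * _).
  by rewrite scalerA mulfV ?gt_eqF// scale1r addrC subrK.
- by cont.
- by move=> y j yj; rewrite (sk y j)// mulr0.
Qed.

Let bound_near (e : R) x : exists2 L, 0 <= L &
  \forall y \near x, forall i : 'I_3, `|(y : 'rV[R]_3) 0 i| + e <= L.
Proof.
pose L := `|x 0 0| + `|x 0 1| + `|x 0 2%:R| + 1 + `|e|.
exists L; first by rewrite !addr_ge0.
apply: (@filter_forall _ 'I_3 (fun i (y : 'rV[R]_3) => `|y 0 i| + e <= L) (nbhs x) _) => i; near=> y.
have yi : `|(y : 'rV[R]_3) 0 i| < `|x 0 i| + 1.
  near: y; apply: (cvgr_lt (`|x 0 i|)); last by rewrite ltrDl.
  by apply: (cont_norm (f := fun x : 'rV[R]_3 => x 0 i)); cont.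
have xi : `|x 0 i| <= `|x 0 0| + `|x 0 1| + `|x 0 2%:R|.
  have := normr_ge0 (x 0 0); have := normr_ge0 (x 0 1); have := normr_ge0 (x 0 2%:R).
  by move: (i); apply: ord3_ind; lra.
by have := ler_norm e; rewrite /L; lra.
Unshelve. all: by end_near. Qed.

(** B is only continuous: the derivative must fall on the kernel, after the
    substitution z = x + e y. *)
Lemma is_derive_moll (e : R) i x v : 0 < e ->
  is_derive x v (fun y => moll e y 0 i) (dot (dmoll e i x) v).
Proof.
move=> e0; have ck := continuous_kernel3.
have cdk j := @continuous_dkernel3 j.
have [L L0 HL] := bound_near e x.
have ne : \forall y \near x,
    e^-1 ^+ 3 * box_int L (fun z => B z 0 i * kernel3 (e^-1 *: (z - y))) = moll e y 0 i.
  near=> y; rewrite mxE (@moll_subst e L)//; first exact: kernel3_supp.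
  by near: y.
apply: near_eq_is_derive ne _.
pose F (y z : 'rV[R]_3) := B z 0 i * kernel3 (e^-1 *: (z - y)).
pose G (y z : 'rV[R]_3) := \sum_j (- e^-1 * v 0 j) * (B z 0 i * dkernel3 j (e^-1 *: (z - y))).
have cF : continuous (fun p : 'rV[R]_3 * 'rV[R]_3 => F p.1 p.2) by rewrite /F; cont.
have cG : continuous (fun p : 'rV[R]_3 * 'rV[R]_3 => G p.1 p.2).
  by apply: cont_sum => j; have cj := @cdk j; cont.
have dF y z : is_derive y v (F ^~ z) (G y z).
  have h : is_derive y v (fun y => kernel3 (e^-1 *: (z - y)))
      (\sum_j dkernel3 j (e^-1 *: (z - y)) * (- e^-1 *: v) 0 j).
    apply/is_derive_line.
    apply: (is_derive_shift_line (c := fun h => e^-1 *: (z - (y + h *: v))) (v := - e^-1 *: v)).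
      move=> h; rewrite add0r scale0r addr0 !scalerBr scalerDr opprD addrA.
      by congr (_ + _); rewrite scaleNr scalerN !scalerA mulrC.
    by rewrite scale0r addr0; exact: is_derive_kernel3.
  apply: der_eq (derZ (B z 0 i) h) _.
  rewrite /G mulr_sumr; apply: eq_bigr => j _; rewrite mxE; ring.
have h := derZ (e^-1 ^+ 3) (@is_derive_box_int R _ L F G x v L0 cF cG dF).
apply: der_eq h _.
have cg j : continuous (fun z => B z 0 i * dkernel3 j (e^-1 *: (z - x))).
  by have cj := @cdk j; cont.
have cgk j k : continuous (fun z => k * (B z 0 i * dkernel3 j (e^-1 *: (z - x)))).
  by have cj := @cg j; cont.
have -> : box_int L (G x) = \sum_j (- e^-1 * v 0 j) *
    box_int L (fun z => B z 0 i * dkernel3 j (e^-1 *: (z - x))).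
  rewrite sum3E -!box_intZ// -!box_intD//; last first.
    by apply: contD.
  by congr box_int; apply/funext => z; rewrite /G sum3E.
rewrite /dot mulr_sumr; apply: eq_bigr => j _.
rewrite mxE (@moll_subst e L)//; [ring|exact: dkernel3_supp|exact: nbhs_singleton HL].
Unshelve. all: by end_near. Qed.

(** The kernel recentred at x is a test function, so the weak divergence of B
    controls the pointwise divergence of the mollified field. *)
Lemma moll_div (e : R) x : distr_div_free B -> 0 < e ->
  \sum_i dmoll e i x 0 i = 0.
Proof.
move=> [_ divB] e0; have ck := continuous_kernel3.
have cdk j := @continuous_dkernel3 j.
have [L L0 /nbhs_singleton HL] := bound_near e x.
pose phi (z : 'rV[R]_3) := kernel3 (e^-1 *: (z - x)).
have sphi (f : 'rV[R]_3 -> R) : supported_in 1 f -> supported_in L (fun z => f (e^-1 *: (z - x))).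
  move=> sf z i Lz; apply: (sf _ i); rewrite !mxE normrM gtr0_norm ?invr_gt0//.
  rewrite ler_pdivlMl// mulr1.
  have := ler_normB (z 0 i - x 0 i) (- x 0 i); rewrite opprK subrK normrN.
  by have := HL i; lra.
have flat_phi : flat_algebra phi.
  rewrite (_ : phi = fun z => bell (e^-1 * z 0 0 + - (e^-1 * x 0 0)) *
      bell (e^-1 * z 0 1 + - (e^-1 * x 0 1)) * bell (e^-1 * z 0 2%:R + - (e^-1 * x 0 2%:R))).
    by apply: flat_mul; [apply: flat_mul|]; exact: flat_bell.
  by apply/funext => z; rewrite /phi /kernel3 !mxE !mulrBr.
have tphi : test_function phi.
  split; first exact: flat_smooth.
  by apply: (@supported_compact_support R R L); apply: sphi; exact: kernel3_supp.
have pphi j : partial j phi = fun z => e^-1 * dkernel3 j (e^-1 *: (z - x)).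
  apply/funext => z.
  suff h : is_derive z (basis_vec R j) phi (e^-1 * dkernel3 j (e^-1 *: (z - x))).
    by rewrite /partial; exact: derive_val.
  apply/is_derive_line.
  apply: (is_derive_shift_line (c := fun h => e^-1 *: (z + h *: basis_vec R j - x)) (v := e^-1 *: basis_vec R j)).
    by move=> h; rewrite add0r scale0r addr0 addrAC scalerDr !scalerA mulrC.
  rewrite scale0r addr0; apply: der_eq (is_derive_kernel3 _ _) _.
  rewrite (bigD1 j)//= big1 ?addr0; first by rewrite mxE basis_vecE eqxx mulr1 mulrC.
  by move=> k kj; rewrite mxE basis_vecE eq_sym (negbTE kj) !mulr0.
have := divB _ tphi.
have E i : distr_partial i (component B i) phi = e ^+ 3 * dmoll e i x 0 i.
  rewrite /distr_partial /component pphi.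
  rewrite mxE (@moll_subst e L)//; last exact: dkernel3_supp.
  rewrite (@integral3_box _ L)//; last 2 first.
  - by have ci := @cdk i; cont.
  - apply: supported_inMr => z j Lz.
    by rewrite (sphi _ (@dkernel3_supp i) z j Lz) mulr0.
  rewrite [X in box_int L X](_ : _ = fun z => e^-1 * (B z 0 i * dkernel3 i (e^-1 *: (z - x)))); last first.
    by apply/funext => z; ring.
  rewrite box_intZ//; last by have ci := @cdk i; cont.
  by field; rewrite gt_eqF.
rewrite (eq_bigr _ (fun i _ => E i)) -mulr_sumr => /eqP.
by rewrite mulf_eq0 expf_eq0 gt_eqF//= => /eqP.
Qed.

End Mollifier.

(** * Radial potentials and their circulations *)

Section RadialPotential.
Context {R : realType}.
Implicit Types (x y v e p q : 'rV[R]_3) (B F A : 'rV[R]_3 -> 'rV[R]_3).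

Lemma dotE x y : dot x y = x 0 0 * y 0 0 + x 0 1 * y 0 1 + x 0 2%:R * y 0 2%:R.
Proof. by rewrite /dot sum3E. Qed.

Lemma crossE x y i :
  cross x y 0 i = x 0 (i + 1) * y 0 (i + 2%:R) - x 0 (i + 2%:R) * y 0 (i + 1).
Proof. by rewrite mxE. Qed.

Lemma cont_dot (X : topologicalType) (f g : X -> 'rV[R]_3) :
  continuous f -> continuous g -> continuous (fun t => dot (f t) (g t)).
Proof. by move=> cf cg; rewrite /dot; cont. Qed.

Lemma cont_cross (X : topologicalType) (f g : X -> 'rV[R]_3) :
  continuous f -> continuous g -> continuous (fun t => cross (f t) (g t)).
Proof. by move=> cf cg; rewrite /cross; cont. Qed.

(** Potential of B in the transversal gauge centred at e. *)
Definition rpot e B y : 'rV[R]_3 :=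
  \row_i segint 0 1 (fun t => t * cross (B (e + t *: (y - e))) (y - e) 0 i).

(** Circulation of F along the segment from p to q. *)
Definition lint F p q : R := segint 0 1 (fun t => dot (F (p + t *: (q - p))) (q - p)).

Lemma cont_rpot (X : topologicalType) (B : X -> 'rV[R]_3 -> 'rV[R]_3) (e y : X -> 'rV[R]_3) :
  continuous (fun p : X * 'rV[R]_3 => B p.1 p.2) -> continuous e -> continuous y ->
  continuous (fun t => rpot (e t) (B t) (y t)).
Proof.
move=> cB ce cy; apply: cont_row => i.
apply: (continuous_segint (f := fun (s : X) t => t * cross (B s (e s + t *: (y s - e s))) (y s - e s) 0 i)) => //.
apply: contM; first by cont.
by apply: cont_coord; apply: cont_cross; cont.
Qed.

Lemma cont_rpot_family (X : topologicalType) (B : X -> 'rV[R]_3 -> 'rV[R]_3) e :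
  continuous (fun w : X * 'rV[R]_3 => B w.1 w.2) ->
  continuous (fun w : X * 'rV[R]_3 => rpot e (B w.1) w.2).
Proof.
move=> cB; apply: (@cont_rpot _ (fun w : X * 'rV[R]_3 => B w.1) (fun=> e) (fun w => w.2)); cont.
Qed.

Lemma cont_lint (X : topologicalType) (F : X -> 'rV[R]_3 -> 'rV[R]_3) (a b : X -> 'rV[R]_3) :
  continuous (fun p : X * 'rV[R]_3 => F p.1 p.2) -> continuous a -> continuous b ->
  continuous (fun t => lint (F t) (a t) (b t)).
Proof.
move=> cF ca cb.
apply: (continuous_segint (f := fun (s : X) t => dot (F s (a s + t *: (b s - a s))) (b s - a s))) => //.
by apply: cont_dot; cont.
Qed.

Lemma continuous_rpot e B : continuous B -> continuous (rpot e B).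
Proof.
move=> cB; apply: (@cont_rpot 'rV[R]_3 (fun=> B) (fun=> e) (fun y => y)); cont.
Qed.

Section ClassicalField.
Variables (B : 'rV[R]_3 -> 'rV[R]_3) (G : 'I_3 -> 'rV[R]_3 -> 'rV[R]_3).
Hypothesis B_cont : continuous B.
Hypothesis G_cont : forall i, continuous (G i).
Hypothesis B_deriv : forall i x v, is_derive x v (fun y => B y 0 i) (dot (G i x) v).
Hypothesis B_div : forall x, \sum_i G i x 0 i = 0.

Let der_line i a w (t : R) :
  is_derive t 1 (fun t => B (a + t *: w) 0 i) (dot (G i (a + t *: w)) w).
Proof.
apply: (is_derive_shift_line (c := fun t => a + t *: w) (g := fun y => B y 0 i) (v := w)) => //.
by move=> h; rewrite scalerDl addrA.
Qed.

Let der_scale i (s : R) x v :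
  is_derive x v (fun y => B (s *: y) 0 i) (s * dot (G i (s *: x)) v).
Proof.
apply/is_derive_line.
apply: (is_derive_shift_line (c := fun h => s *: (x + h *: v)) (g := fun y => B y 0 i) (v := s *: v)).
  by move=> h; rewrite add0r scale0r addr0 scalerDr !scalerA mulrC.
rewrite scale0r addr0; apply: der_eq (B_deriv _ _ _) _.
by rewrite !dotE !mxE; ring.
Qed.

(** The derivative, along the j-th coordinate, of the integrand of the i-th
    component of rpot 0 B at x. *)
Let drpot_int (i j : 'I_3) x (s : R) : R :=
  s * (s * G (i + 1) (s *: x) 0 j * x 0 (i + 2%:R) + B (s *: x) 0 (i + 1) * (i + 2%:R == j)%:R -
       (s * G (i + 2%:R) (s *: x) 0 j * x 0 (i + 1) + B (s *: x) 0 (i + 2%:R) * (i + 1 == j)%:R)).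

Definition drpot (i : 'I_3) x : 'rV[R]_3 := \row_j segint 0 1 (drpot_int i j x).

Let cont_drpot_int i j : continuous (fun p : 'rV[R]_3 * R => drpot_int i j p.1 p.2).
Proof.
have c1 := @G_cont (i + 1); have c2 := @G_cont (i + 2%:R).
by rewrite /drpot_int; cont.
Qed.

Lemma continuous_drpot i : continuous (drpot i).
Proof.
apply: cont_row => j.
by apply: (continuous_segint (f := drpot_int i j)) => //; exact: cont_drpot_int.
Qed.

Lemma is_derive_rpot i x v :
  is_derive x v (fun y => rpot 0 B y 0 i) (dot (drpot i x) v).
Proof.
pose f y (s : R) := s * (B (s *: y) 0 (i + 1) * y 0 (i + 2%:R) - B (s *: y) 0 (i + 2%:R) * y 0 (i + 1)).
pose g y (s : R) := \sum_j v 0 j * drpot_int i j y s.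
have cf : continuous (fun p : 'rV[R]_3 * R => f p.1 p.2) by rewrite /f; cont.
have cg : continuous (fun p : 'rV[R]_3 * R => g p.1 p.2).
  by apply: cont_sum => j; have := @cont_drpot_int i j => cj; cont.
have df y s : is_derive y v (f ^~ s) (g y s).
  have h1 := derM (der_scale (i + 1) s y v) (der_coord y v (i + 2%:R)).
  have h2 := derM (der_scale (i + 2%:R) s y v) (der_coord y v (i + 1)).
  apply: der_eq (derZ s (derB h1 h2)) _.
  rewrite /g /drpot_int sum3E !dotE.
  by move: (i); apply: ord3_ind; rewrite !ord3D /=; ring.
have h := is_derive_segint x ler01 cf cg df.
rewrite (_ : (fun y => _) = fun y => segint 0 1 (f y)); last first.
  apply/funext => y; rewrite mxE; apply: eq_segint => s _.
  by rewrite crossE subr0 add0r.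
apply: der_eq h _; rewrite /dot.
have cs j : continuous (drpot_int i j x) by exact: (continuous_slice (f := drpot_int i j)).
rewrite (_ : g x = fun s => v 0 0 * drpot_int i 0 x s + v 0 1 * drpot_int i 1 x s +
    v 0 2%:R * drpot_int i 2%:R x s); last by apply/funext => s; rewrite /g sum3E.
by rewrite segint_lin3// sum3E !mxE; ring.
Qed.

(** d/ds (s^2 B(s x)) = 2 s B(s x) + s^2 (x . grad) B(s x) is the integrand of
    the curl, up to a multiple of div B. *)
Lemma curl_rpot i x :
  drpot (i + 2%:R) x 0 (i + 1) - drpot (i + 1) x 0 (i + 2%:R) = B x 0 i.
Proof.
have c j k : continuous (drpot_int j k x) by exact: (continuous_slice (f := drpot_int j k)).
rewrite !mxE -segintB//.
pose F (s : R) := s ^+ 2 * B (0 + s *: x) 0 i.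
pose dF (s : R) := 2%:R * s * B (s *: x) 0 i + s ^+ 2 * dot (G i (s *: x)) x.
have cdF : continuous dF.
  have ci := @G_cont i; apply: contD; first by cont.
  by apply: contM; [cont|apply: cont_dot; cont].
have hF (s : R) : 0 <= s <= 1 -> is_derive s 1 F (dF s).
  move=> _; have hs : is_derive s 1 (fun s : R => s ^+ 2) (2%:R * s).
    by apply: is_derive_eq; rewrite /GRing.scale/=; ring.
  by apply: der_eq (derM hs (der_line i 0 x s)) _; rewrite add0r.
have := segint_FTC2 ler01 cdF hF.
rewrite {1}/F expr1n mul1r add0r scale1r {1}/F expr0n mul0r subr0 => <-.
apply: eq_segint => s _; rewrite /dF /drpot_int dotE.
have := B_div (s *: x); rewrite sum3E => /eqP; rewrite addr_eq0 => /eqP.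
move: (i); apply: ord3_ind; rewrite !ord3D /=.
- move=> E; have -> : G 2%:R (s *: x) 0 2%:R = - (G 0 (s *: x) 0 0 + G 1 (s *: x) 0 1).
    by rewrite E opprK.
  ring.
- move=> E; have -> : G 2%:R (s *: x) 0 2%:R = - (G 0 (s *: x) 0 0 + G 1 (s *: x) 0 1).
    by rewrite E opprK.
  ring.
- move=> E; have -> : G 2%:R (s *: x) 0 2%:R = - (G 0 (s *: x) 0 0 + G 1 (s *: x) 0 1).
    by rewrite E opprK.
  ring.
Qed.

End ClassicalField.

Section Transgression.
Variables (F B : 'rV[R]_3 -> 'rV[R]_3) (K : 'I_3 -> 'rV[R]_3 -> 'rV[R]_3).
Hypothesis F_cont : continuous F.
Hypothesis B_cont : continuous B.
Hypothesis K_cont : forall i, continuous (K i).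
Hypothesis F_deriv : forall i x v, is_derive x v (fun y => F y 0 i) (dot (K i x) v).
Hypothesis F_curl : forall i x,
  K (i + 2%:R) x 0 (i + 1) - K (i + 1) x 0 (i + 2%:R) = B x 0 i.

Lemma dot_rpot e x v : dot (rpot e B x) v =
  segint 0 1 (fun t => t * dot (cross (B (e + t *: (x - e))) (x - e)) v).
Proof.
have c (i : 'I_3) : continuous (fun t : R => t * cross (B (e + t *: (x - e))) (x - e) 0 i).
  by apply: contM; [cont|apply: cont_coord; apply: cont_cross; cont].
rewrite dotE !mxE [_ * v 0 0]mulrC [_ * v 0 1]mulrC [_ * v 0 2%:R]mulrC.
rewrite -segint_lin3//; try exact: c.
by apply: eq_segint => t _; rewrite dotE; ring.
Qed.

(** Poincare's homotopy formula: the primitive of F along the rays from e has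
    gradient F minus the radial potential, centred at e, of curl F. *)
Lemma is_derive_lint e x v :
  is_derive x v (lint F e) (dot (F x) v - dot (rpot e B x) v).
Proof.
pose z y (t : R) := e + t *: (y - e).
pose f y (t : R) := dot (F (z y t)) (y - e).
pose g y (t : R) := t * (dot (K 0 (z y t)) v * (y - e) 0 0 +
  dot (K 1 (z y t)) v * (y - e) 0 1 + dot (K 2%:R (z y t)) v * (y - e) 0 2%:R) + dot (F (z y t)) v.
have c0 := @K_cont 0; have c1 := @K_cont 1; have c2 := @K_cont 2%:R.
have cf : continuous (fun p : 'rV[R]_3 * R => f p.1 p.2).
  by rewrite /f /z; apply: cont_dot; cont.
have cg : continuous (fun p : 'rV[R]_3 * R => g p.1 p.2).
  rewrite /g /z; apply: contD; last by apply: cont_dot; cont.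
  apply: contM; first by cont.
  by repeat apply: contD; (apply: contM; [apply: cont_dot; cont|cont]).
have dFz i y (t : R) : is_derive y v (fun y => F (z y t) 0 i) (t * dot (K i (z y t)) v).
  apply/is_derive_line.
  apply: (is_derive_shift_line (c := fun h => z (y + h *: v) t) (g := fun y => F y 0 i) (v := t *: v)).
    move=> h; rewrite /z add0r scale0r addr0 -[RHS]addrA; congr (_ + _).
    by rewrite addrAC scalerDr !scalerA mulrC.
  rewrite scale0r addr0; apply: der_eq (F_deriv _ _ _) _.
  by rewrite !dotE !mxE; ring.
have de i y : is_derive y v (fun y => (y - e) 0 i) (v 0 i).
  rewrite (_ : (fun y => _) = fun y : 'rV[R]_3 => y 0 i - e 0 i); last first.
    by apply/funext => w; rewrite !mxE.
  by apply: der_eq (derB (der_coord y v i) (der_cst y v (e 0 i))) _; rewrite subr0.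
have df y (t : R) : is_derive y v (f ^~ t) (g y t).
  rewrite (_ : f ^~ t = fun y => F (z y t) 0 0 * (y - e) 0 0 + F (z y t) 0 1 * (y - e) 0 1 +
      F (z y t) 0 2%:R * (y - e) 0 2%:R); last by apply/funext => w; rewrite /f dotE.
  apply: der_eq (derD (derD (derM (dFz 0 y t) (de 0 y)) (derM (dFz 1 y t) (de 1 y)))
    (derM (dFz 2%:R y t) (de 2%:R y))) _.
  by rewrite /g [dot (F _) v]dotE; ring.
apply: der_eq (is_derive_segint x ler01 cf cg df) _.
pose h (t : R) := dot (F (z x t)) v + t * (dot (K 0 (z x t)) (x - e) * v 0 0 +
  dot (K 1 (z x t)) (x - e) * v 0 1 + dot (K 2%:R (z x t)) (x - e) * v 0 2%:R).
have ch : continuous h.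
  rewrite /h /z; apply: contD; first by apply: cont_dot; cont.
  apply: contM; first by cont.
  by repeat apply: contD; (apply: contM; [apply: cont_dot; cont|cont]).
have dz i (t : R) : is_derive t 1 (fun t => F (z x t) 0 i) (dot (K i (z x t)) (x - e)).
  apply: (is_derive_shift_line (c := fun t => z x t) (g := fun y => F y 0 i) (v := x - e)) => //.
  by move=> k; rewrite /z scalerDl addrA.
have dh (t : R) : 0 <= t <= 1 -> is_derive t 1 (fun t => t * dot (F (z x t)) v) (h t).
  move=> _.
  rewrite (_ : (fun t => _) = fun t => t * (v 0 0 * F (z x t) 0 0 + v 0 1 * F (z x t) 0 1 +
      v 0 2%:R * F (z x t) 0 2%:R)); last first.
    by apply/funext => k; rewrite dotE; ring.
  apply: der_eq (derM (is_derive_id t 1) (derD (derD (derZ (v 0 0) (dz 0 t))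
    (derZ (v 0 1) (dz 1 t))) (derZ (v 0 2%:R) (dz 2%:R t)))) _.
  by rewrite /h [dot (F _) v]dotE; ring.
have zx1 : z x 1 = x by rewrite /z scale1r addrC subrK.
have := segint_FTC2 ler01 ch dh; rewrite zx1 mul1r mul0r subr0 => <-.
rewrite dot_rpot -segintB//; last first.
  by apply: contM; [cont|apply: cont_dot; [apply: cont_cross; cont|cont]].
apply: eq_segint => t _; rewrite /g /h -/(z x t).
have E0 := F_curl 0 (z x t); have E1 := F_curl 1 (z x t); have E2 := F_curl 2%:R (z x t).
rewrite !ord3D in E0 E1 E2.
rewrite !dotE !crossE !ord3D -E0 -E1 -E2; ring.
Qed.

Lemma transgression_classical e p q :
  lint F e q - lint F e p = lint F p q - lint (rpot e B) p q.
Proof.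
pose f (t : R) := dot (F (p + t *: (q - p))) (q - p).
pose g (t : R) := dot (rpot e B (p + t *: (q - p))) (q - p).
have cr := @continuous_rpot e B B_cont.
have cf : continuous f by rewrite /f; apply: cont_dot; cont.
have cg : continuous g by rewrite /g; apply: cont_dot; cont.
have cfg : continuous (fun t => f t - g t) by cont.
have d (t : R) : 0 <= t <= 1 ->
    is_derive t 1 (fun t => lint F e (p + t *: (q - p))) (f t - g t).
  move=> _; apply: (is_derive_shift_line (c := fun t => p + t *: (q - p)) (g := lint F e) (v := q - p)).
    by move=> h; rewrite scalerDl addrA.
  exact: is_derive_lint.
have -> : lint F p q - lint (rpot e B) p q = segint 0 1 (fun t => f t - g t).
  by rewrite segintB.
by rewrite (segint_FTC2 ler01 cfg d) scale1r scale0r addr0 (addrC p) subrK.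
Qed.

End Transgression.

(** Poincare's formula for the potential rpot 0 B of the field B. It is proved
    first for the mollified fields, whose divergence vanishes pointwise; both
    sides are continuous in the mollification parameter down to 0. *)
Theorem transgression B e p q : continuous B -> distr_div_free B ->
  lint (rpot 0 B) e q - lint (rpot 0 B) e p =
  lint (rpot 0 B) p q - lint (rpot e B) p q.
Proof.
move=> cB divB.
pose A (u : R) := rpot 0 (moll B u).
have cM := continuous_moll cB.
have cA : continuous (fun p : R * 'rV[R]_3 => A p.1 p.2).
  exact: (@cont_rpot_family R (moll B) 0 cM).
have cE : continuous (fun p : R * 'rV[R]_3 => rpot e (moll B p.1) p.2).
  exact: (@cont_rpot_family R (moll B) e cM).
pose X (u : R) := lint (A u) e q - lint (A u) e p - (lint (A u) p q - lint (rpot e (moll B u)) p q).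
have cX : continuous X.
  have c1 := cont_lint cA (@cont_cst R _ e) (@cont_cst R _ q).
  have c2 := cont_lint cA (@cont_cst R _ e) (@cont_cst R _ p).
  have c3 := cont_lint cA (@cont_cst R _ p) (@cont_cst R _ q).
  have c4 := cont_lint (F := fun u => rpot e (moll B u)) cE (@cont_cst R _ p) (@cont_cst R _ q).
  by rewrite /X; apply: contB; apply: contB.
have X0 u : 0 < u -> X u = 0.
  move=> u0; apply/eqP; rewrite subr_eq0; apply/eqP.
  have cMu : continuous (moll B u) by exact: (@continuous_slice _ _ _ (moll B) u cM).
  have cd i := @continuous_dmoll _ _ cB u i.
  have dM i y w := @is_derive_moll _ _ cB u i y w u0.
  have div y := @moll_div _ _ cB u y divB u0.
  have h1 := continuous_rpot (e := 0) cMu.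
  have h2 := continuous_drpot cMu cd.
  have h3 := is_derive_rpot cMu cd dM.
  have h4 := curl_rpot cMu cd dM div.
  exact (transgression_classical h1 cMu h2 h3 h4 e p q).
have := cont_lim_eq0 cX X0.
have M0 : moll B 0 = B by apply/funext => y; rewrite moll0.
by rewrite /X /A M0 => /eqP; rewrite subr_eq0 => /eqP.
Qed.

(** The equation holds pointwise for the mollified fields, hence weakly after
    integration by parts, and the weak form is continuous in the mollification
    parameter down to 0. *)
Theorem distr_curl_rpot B : continuous B -> distr_div_free B ->
  distr_curl_eq (rpot 0 B) B.
Proof.
move=> cB divB; have cr := @continuous_rpot 0 B cB.
split; first by move=> i; apply: continuous_loc_integrable; rewrite /component; cont.
split; first by move=> i; apply: continuous_loc_integrable; rewrite /component; cont.
move=> phi [sphi /compact_support_supported[M M0 sM]] i.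
have [cphi dphi] := sphi 1%N.
have d1 j y : derivable phi y (basis_vec R j) by have [] := dphi j.
have cd j : continuous (partial j phi) by have [] := dphi j.
have MN : M < M + 1 by rewrite ltrDl.
have N0 : 0 <= M + 1 by rewrite addr_ge0.
have sN := supported_in_le (ltW MN) sM.
have sd j : supported_in (M + 1) (partial j phi) by exact: supported_in_partial sM.
pose A (u : R) := rpot 0 (moll B u).
have cM := continuous_moll cB.
have cA : continuous (fun p : R * 'rV[R]_3 => A p.1 p.2).
  exact: (@cont_rpot_family R (moll B) 0 cM).
have cd1 := @cd (i + 1); have cd2 := @cd (i + 2%:R).
pose X (u : R) := box_int (M + 1) (fun x => A u x 0 (i + 1) * partial (i + 2%:R) phi x) -
  box_int (M + 1) (fun x => A u x 0 (i + 2%:R) * partial (i + 1) phi x) -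
  box_int (M + 1) (fun x => moll B u x 0 i * phi x).
have cX : continuous X.
  have cA' j : continuous (fun p : R * 'rV[R]_3 => A p.1 p.2 0 j) by exact: cont_coord.
  have cM' j : continuous (fun p : R * 'rV[R]_3 => moll B p.1 p.2 0 j).
    exact: (@cont_coord _ _ 3 (fun w : R * 'rV[R]_3 => moll B w.1 w.2) j cM).
  rewrite /X; apply: contB; [apply: contB|].
  - apply: (cont_box_int (F := fun u x => A u x 0 (i + 1) * partial (i + 2%:R) phi x)) => //.
    by apply: contM => //; cont.
  - apply: (cont_box_int (F := fun u x => A u x 0 (i + 2%:R) * partial (i + 1) phi x)) => //.
    by apply: contM => //; cont.
  - apply: (cont_box_int (F := fun u x => moll B u x 0 i * phi x)) => //.
    by apply: contM => //; cont.
have X0 u : 0 < u -> X u = 0.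
  move=> u0.
  have cMu : continuous (moll B u) by exact: (@continuous_slice _ _ _ (moll B) u cM).
  have cG j := @continuous_dmoll _ _ cB u j.
  have dM j y w := @is_derive_moll _ _ cB u j y w u0.
  have div y := @moll_div _ _ cB u y divB u0.
  pose K := drpot (moll B u) (dmoll B u).
  have cK j : continuous (K j) by exact: continuous_drpot.
  have cAu : continuous (A u) by exact: continuous_rpot.
  have ibp j k : box_int (M + 1) (fun x => A u x 0 j * partial k phi x) =
      - box_int (M + 1) (fun x => K j x 0 k * phi x).
    have cjk : continuous (fun x => K j x 0 k * phi x) by have := @cK j => c; cont.
    have cjk' : continuous (fun x => A u x 0 j * partial k phi x) by have := @cd k => c; cont.
    have dprod x : is_derive x (basis_vec R k) (fun x => A u x 0 j * phi x)
        (K j x 0 k * phi x + A u x 0 j * partial k phi x).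
      have h : is_derive x (basis_vec R k) (fun x => A u x 0 j) (K j x 0 k).
        apply: der_eq (@is_derive_rpot _ _ cMu cG dM j x _) _.
        by rewrite /dot (bigD1 k)//= big1 ?addr0 ?basis_vecE ?eqxx ?mulr1// => l lk;
          rewrite basis_vecE eq_sym (negbTE lk) mulr0.
      exact: derM h (derivableP (d1 k x)).
    have E : partial k (fun x => A u x 0 j * phi x) =
        fun x => K j x 0 k * phi x + A u x 0 j * partial k phi x.
      by apply/funext => x; rewrite /partial; have ? := dprod x; exact: derive_val.
    have := @integral3_partial _ M k (fun x => A u x 0 j * phi x) M0.
    rewrite E (@integral3_box _ (M + 1))//; last 2 first.
    - exact: contD.
    - by move=> x l Ml; rewrite (sN x l)// (sd k x l)// !mulr0 addr0.
    rewrite box_intD// => H; apply/eqP; rewrite -addr_eq0 addrC; apply/eqP; apply: H.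
    - exact: supported_inMr.
    - by move=> x; have ? := dprod x; exact: ex_derive.
    - exact: contD.
  have ck1 : continuous (fun x => K (i + 1) x 0 (i + 2%:R) * phi x) by have := @cK (i + 1) => c; cont.
  have ck2 : continuous (fun x => K (i + 2%:R) x 0 (i + 1) * phi x) by have := @cK (i + 2%:R) => c; cont.
  rewrite /X !ibp opprK.
  have -> : (fun x => moll B u x 0 i * phi x) = fun x =>
      K (i + 2%:R) x 0 (i + 1) * phi x + (-1) * (K (i + 1) x 0 (i + 2%:R) * phi x).
    apply/funext => x.
    by rewrite -(@curl_rpot _ _ cMu cG dM div i x) -/K; ring.
  rewrite box_intD//; last by cont.
  by rewrite box_intZ//; ring.
have := cont_lim_eq0 cX X0.
have MB : moll B 0 = B by apply/funext => y; rewrite moll0.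
rewrite /X /A MB => /eqP; rewrite subr_eq0 => /eqP E.
rewrite /distr_partial /component !(@integral3_box _ (M + 1))//; last 6 first.
- by cont.
- exact: supported_inMr.
- by cont.
- exact: supported_inMr.
- by cont.
- exact: supported_inMr.
rewrite -E; move: (box_int _ _) => a; move: (box_int _ _) => b; ring.
Qed.

End RadialPotential.

(** * The Euclidean norm *)

Section EuclideanNorm.
Context {R : realType}.
Implicit Types (x y u v : 'rV[R]_3).

Lemma enorm_ge0 x : 0 <= enorm x.
Proof. exact: sqrtr_ge0. Qed.

Lemma enormZ (k : R) x : enorm (k *: x) = `|k| * enorm x.
Proof.
rewrite /enorm -sqrtr_sqr -sqrtrM ?sqr_ge0//; congr Num.sqrt.
by rewrite !dotE !mxE; ring.
Qed.

Lemma coord_le_enorm x i : `|x 0 i| <= enorm x.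
Proof.
rewrite -sqrtr_sqr /enorm ler_wsqrtr// dotE.
have := sqr_ge0 (x 0 0); have := sqr_ge0 (x 0 1); have := sqr_ge0 (x 0 2%:R).
by move: i; apply: ord3_ind; rewrite !expr2; lra.
Qed.

(** Equivalent to enorm, and additive over coordinatewise estimates. *)
Definition l1norm x : R := `|x 0 0| + `|x 0 1| + `|x 0 2%:R|.

Lemma l1norm_ge0 x : 0 <= l1norm x.
Proof. by rewrite !addr_ge0. Qed.

Lemma enorm_le_l1norm x : enorm x <= l1norm x.
Proof.
rewrite /enorm -[leRHS]ger0_norm ?l1norm_ge0// -sqrtr_sqr ler_wsqrtr// dotE /l1norm.
rewrite -!expr2 -[x 0 0 ^+ 2]real_normK ?num_real// -[x 0 1 ^+ 2]real_normK ?num_real//.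
rewrite -[x 0 2%:R ^+ 2]real_normK ?num_real//.
have := normr_ge0 (x 0 0); have := normr_ge0 (x 0 1); have := normr_ge0 (x 0 2%:R).
move: `|x 0 0| `|x 0 1| `|x 0 2%:R| => a b c c0 b0 a0.
have := mulr_ge0 a0 b0; have := mulr_ge0 a0 c0; have := mulr_ge0 b0 c0.
by rewrite !expr2; lra.
Qed.

Lemma l1norm_le_enorm x : l1norm x <= 3%:R * enorm x.
Proof.
have := coord_le_enorm x 0; have := coord_le_enorm x 1; have := coord_le_enorm x 2%:R.
by rewrite /l1norm; lra.
Qed.

Lemma enorm_eq0 x : enorm x = 0 -> x = 0.
Proof.
move=> x0; apply/rowP => i; rewrite mxE; apply/eqP; rewrite -normr_le0 -x0.
exact: coord_le_enorm.
Qed.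

Lemma enorm_gt0 x : x != 0 -> 0 < enorm x.
Proof.
by rewrite lt_def enorm_ge0 andbT; apply: contra_neq => /enorm_eq0.
Qed.

Lemma enorm0 : enorm (0 : 'rV[R]_3) = 0.
Proof. by rewrite /enorm dotE !mxE !mulr0 !addr0 sqrtr0. Qed.

Lemma enorm_unit_dir x : x != 0 -> enorm (unit_dir x) = 1.
Proof.
move=> /enorm_gt0 x0; rewrite /unit_dir enormZ gtr0_norm ?invr_gt0//.
by rewrite mulVf// gt_eqF.
Qed.

Lemma cont_enorm : continuous (@enorm R).
Proof.
apply: (@cont_comp _ _ _ (fun x => dot x x) Num.sqrt).
  exact: sqrt_continuous.
by apply: cont_dot; exact: cont_id.
Qed.

Lemma norm_dot_le (c : R) u v : (forall i, `|u 0 i| <= c) -> `|dot u v| <= c * l1norm v.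
Proof.
move=> uc; rewrite dotE /l1norm !mulrDr.
have H i : `|u 0 i * v 0 i| <= c * `|v 0 i| by rewrite normrM ler_wpM2r.
apply: le_trans (ler_normD _ _) _; apply: lerD => //.
by apply: le_trans (ler_normD _ _) _; apply: lerD.
Qed.

Lemma norm_cross_le (c : R) u v i : (forall i, `|u 0 i| <= c) -> `|cross u v 0 i| <= c * l1norm v.
Proof.
move=> uc; rewrite crossE; apply: le_trans (ler_normB _ _) _; rewrite !normrM.
have c0 : 0 <= c := le_trans (normr_ge0 _) (uc 0).
have H j k : `|u 0 j| * `|v 0 k| <= c * `|v 0 k| by rewrite ler_wpM2r.
have P k : 0 <= c * `|v 0 k| by rewrite mulr_ge0.
apply: le_trans (lerD (H _ _) (H _ _)) _.
have := P 0; have := P 1; have := P 2%:R.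
rewrite /l1norm !mulrDr.
by move: (i); apply: ord3_ind; rewrite !ord3D; lra.
Qed.

Lemma enorm_le_coord (c : R) x : (forall i, `|x 0 i| <= c) -> enorm x <= 3%:R * c.
Proof.
move=> H; apply: le_trans (enorm_le_l1norm x) _; rewrite /l1norm.
by have := H 0; have := H 1; have := H 2%:R; lra.
Qed.

End EuclideanNorm.

(** * Tails of convergent integrals *)

Section Tails.
Context {R : realType}.
Implicit Types (s t a : R) (g : R -> R).
Variable r : R.
Hypothesis r_gt2 : 2%:R < r.
Notation mu := (@lebesgue_measure R).

Lemma is_derive1_continuous g t d : is_derive t 1 g d -> {for t, continuous g}.
Proof.
move=> h; apply: differentiable_continuous; apply/derivable1_diffP.
exact: ex_derive.
Qed.

Lemma powR_small (p : R) (d : R) : 0 < p -> 0 < d ->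
  exists2 T, 0 < T & forall s, T <= s -> s `^ (- p) <= d.
Proof.
move=> p0 d0; exists (d `^ (- p^-1)); first exact: powR_gt0.
move=> s Ts; have T0 : 0 < d `^ (- p^-1) by exact: powR_gt0.
rewrite powRN -[leRHS]invrK lef_pV2 ?posrE ?invr_gt0 ?powR_gt0//; last exact: lt_le_trans Ts.
have -> : d^-1 = (d `^ (- p^-1)) `^ p.
  by rewrite -powRrM mulNr mulVf ?gt_eqF// powR_inv1// ltW.
by rewrite ge0_ler_powR ?nnegrE// ?ltW//; exact: lt_le_trans Ts.
Qed.

(** By the decay of B, the integrands of Ainf and Areg are bounded by multiples of
    this function. *)
Definition weight s := (1 + `|s|) `^ (1 - r).

Lemma continuous_weight : continuous weight.
Proof.
have w1 s : 0 < 1 + `|s| by rewrite ltr_pwDl.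
move=> s; apply: (@continuous_comp _ _ _ (fun s : R => 1 + `|s|) (fun y : R => y `^ (1 - r))).
  have c : continuous (fun s : R => 1 + `|s|).
    by apply: contD; [exact: cont_cst|exact: norm_continuous].
  exact: c.
have h := is_derive1_powR (1 - r) (w1 s).
exact: is_derive1_continuous h.
Qed.

Lemma weight_ge0 s : 0 <= weight s.
Proof. exact: powR_ge0. Qed.

(** The primitive of (1 + s) ^ (1 - r) that vanishes at infinity. *)
Let prim s := - (r - 2%:R)^-1 * (1 + s) `^ (2%:R - r).

Let dprim s : -1 < s -> is_derive s 1 prim ((1 + s) `^ (1 - r)).
Proof.
move=> s1; have s0 : 0 < 1 + s by lra.
have h1 : is_derive s 1 (fun s => 1 + s) (0 + 1).
  exact: (derD (der_cst s 1 1) (is_derive_id s 1)).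
have h2 := der_comp (f := fun y : R => y `^ (2%:R - r)) (g := fun s : R => 1 + s) (x := s) (is_derive1_powR (2%:R - r) s0) h1.
apply: der_eq (derZ (- (r - 2%:R)^-1) h2) _.
rewrite (_ : 2%:R - r - 1 = 1 - r); last by lra.
by field; rewrite subr_eq0 gt_eqF.
Qed.

Let prim_lim : prim s @[s --> +oo%R] --> (0 : R).
Proof.
apply/cvgrPdist_le => e e0.
have k0 : 0 < r - 2%:R by rewrite subr_gt0.
have [T T0 HT] := powR_small k0 (mulr_gt0 k0 e0).
near=> s.
have Ts : T <= s by near: s; apply: nbhs_pinfty_ge; exact: num_real.
rewrite sub0r normrN /prim normrM normrN (ger0_norm (powR_ge0 _ _)).
rewrite ger0_norm ?invr_ge0 ?(ltW k0)// (_ : 2%:R - r = - (r - 2%:R)); last by rewrite opprB.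
rewrite -(ler_pM2l k0) mulrA mulfV ?mul1r ?gt_eqF//; apply: HT.
by lra.
Unshelve. all: by end_near. Qed.

Lemma weight_tail a : 0 <= a ->
  mu.-integrable `[a, +oo[ (EFin \o weight) /\
  \int[mu]_(s in `[a, +oo[) weight s = (r - 2%:R)^-1 * (1 + a) `^ (2%:R - r).
Proof.
move=> a0.
have E : (\int[mu]_(s in `[a, +oo[) (weight s)%:E = (0 - prim a)%:E)%E.
  rewrite EFinB; apply: (@ge0_continuous_FTC2y R weight prim a 0).
  - by move=> s _; exact: weight_ge0.
  - apply: continuous_subspaceT; exact: continuous_weight.
  - exact: prim_lim.
  - by move=> s as_; have ? := @dprim s ltac:(lra); exact: ex_derive.
  - apply: cvg_at_right_filter.
    have h := @dprim a ltac:(lra).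
    exact: is_derive1_continuous h.
  - move=> s; rewrite in_itv/= andbT => as_.
    have ? := @dprim s ltac:(lra).
    rewrite derive1E derive_val /weight ger0_norm//; exact: ltW (le_lt_trans a0 as_).
split.
  apply/integrableP; split.
    apply/measurable_EFinP; apply: measurable_funS (continuous_measurable_fun continuous_weight) => //.
  rewrite [X in (X < _)%E](_ : _ = \int[mu]_(s in `[a, +oo[) (weight s)%:E)%E; last first.
    by apply: eq_integral => s _; rewrite gee0_abs// lee_fin weight_ge0.
  by rewrite E ltry.
by rewrite /Rintegral E /= /prim sub0r mulNr opprK.
Qed.

Lemma tail_integrable a c g : 0 <= a -> 0 <= c -> continuous g ->
  (forall s, a <= s -> `|g s| <= c * weight s) -> mu.-integrable `[a, +oo[ (EFin \o g).
Proof.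
move=> a0 c0 cg gw; have [wi _] := weight_tail a0.
apply: (@le_integrable _ _ _ mu _ _ _ (EFin \o (fun s => c * weight s))) => //.
- by apply/measurable_EFinP; apply: measurable_funS (continuous_measurable_fun cg).
- move=> s; rewrite /= in_itv/= andbT => as_; rewrite lee_fin.
  by apply: le_trans (gw _ as_) _; exact: ler_norm.
rewrite (_ : EFin \o _ = (fun s => c%:E * (EFin \o weight) s)%E); last by apply/funext.
exact: integrableZl.
Qed.

Lemma tail_bound a c g : 0 <= a -> 0 <= c -> continuous g ->
  (forall s, a <= s -> `|g s| <= c * weight s) ->
  `|\int[mu]_(s in `[a, +oo[) g s| <= c * ((r - 2%:R)^-1 * (1 + a) `^ (2%:R - r)).
Proof.
move=> a0 c0 cg gw; have [wi wE] := weight_tail a0.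
have gi := tail_integrable a0 c0 cg gw.
apply: le_trans (le_normr_Rintegral _ gi) _ => //.
rewrite -wE -RintegralZl//; apply: le_Rintegral => //.
- apply: (@tail_integrable a c) => //; first by cont.
  by move=> s; rewrite normr_id; exact: gw.
- rewrite (_ : EFin \o _ = (fun s => c%:E * (EFin \o weight) s)%E); last by apply/funext.
  exact: integrableZl.
- by move=> s; rewrite /= in_itv/= andbT; exact: gw.
Qed.

Lemma tail_split a c g : 0 <= a -> 0 <= c -> continuous g ->
  (forall s, 0 <= s -> `|g s| <= c * weight s) ->
  \int[mu]_(s in `[0, +oo[) g s = segint 0 a g + \int[mu]_(s in `[a, +oo[) g s.
Proof.
move=> a0 c0 cg gw; have gi := tail_integrable (lexx 0) c0 cg gw.
have := @Rintegral_itvB R g (BLeft 0) (BInfty _ false) a gi _ _.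
rewrite !bnd_simp => /(_ a0 isT) /eqP; rewrite subr_eq => /eqP ->.
rewrite segintE addrC; congr (_ + _); rewrite Rintegral_itv_obnd_cbnd//.
apply: integrableS gi => //; apply: subset_itvr; rewrite bnd_simp; exact: a0.
Qed.

End Tails.

(** * The field at infinity *)

Section FieldAtInfinity.
Context {R : realType}.
Implicit Types (x y u v e p q n : 'rV[R]_3) (s t a : R).
Notation mu := (@lebesgue_measure R).

Lemma continuous_unif_lim (X : topologicalType) (h : X -> R) :
  (forall d : R, 0 < d -> exists2 g : X -> R, continuous g & forall x : X, `|h x - g x| <= d) ->
  continuous h.
Proof.
move=> H x; apply/cvgrPdist_le => d d0.
have d3 : 0 < d / 3%:R by rewrite divr_gt0.
have [g cg hg] := H _ d3.
have := cg x => /cvgrPdist_le/(_ _ d3).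
apply: filterS => y gy.
rewrite (_ : h x - h y = (h x - g x) + (g x - g y) + - (h y - g y)); last by ring.
apply: le_trans (ler_normD _ _) _; rewrite normrN.
apply: le_trans (lerD (ler_normD _ _) (lexx _)) _.
have := hg x; have := hg y; move: gy.
move: `|_| `|_| `|_| => a b c; lra.
Qed.

Lemma continuous_locally (X : topologicalType) (h : X -> R) :
  (forall p : X, exists2 g : X -> R, continuous g & \forall y \near p, h y = g y) -> continuous h.
Proof.
move=> H p; have [g cg hg] := H p.
have hgp : h p = g p by exact: nbhs_singleton hg.
rewrite /continuous_at hgp; apply: cvg_trans (cg p).
by apply: near_eq_cvg; apply: filterS hg => y ->.
Qed.

Lemma lint_dist (F G : 'rV[R]_3 -> 'rV[R]_3) p q (k : R) : continuous F -> continuous G ->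
  (forall t, 0 <= t <= 1 -> forall i, `|F (p + t *: (q - p)) 0 i - G (p + t *: (q - p)) 0 i| <= k) ->
  `|lint F p q - lint G p q| <= k * l1norm (q - p).
Proof.
move=> cF cG H.
have c1 : continuous (fun t : R => dot (F (p + t *: (q - p))) (q - p)).
  by apply: cont_dot; cont.
have c2 : continuous (fun t : R => dot (G (p + t *: (q - p))) (q - p)).
  by apply: cont_dot; cont.
rewrite /lint -segintB// -[leRHS]mulr1 -[X in _ <= _ * X]subr0.
apply: ler_norm_segint => //; first by cont.
move=> t t01.
have -> : dot (F (p + t *: (q - p))) (q - p) - dot (G (p + t *: (q - p))) (q - p) =
    dot (F (p + t *: (q - p)) - G (p + t *: (q - p))) (q - p).
  by rewrite !dotE !mxE; ring.
by apply: norm_dot_le => i; have := H t t01 i; rewrite !mxE.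
Qed.

Variable B : 'rV[R]_3 -> 'rV[R]_3.
Hypothesis B_cont : continuous B.
Variable r : R.
Hypothesis r_gt2 : 2%:R < r.
Variable C : R.
Hypothesis C_gt0 : 0 < C.
Hypothesis B_le : forall x, enorm (B x) <= C * (1 + enorm x) `^ (- r).

Lemma Atr_rpot x : Atr B x = rpot 0 B x.
Proof.
apply/rowP => i; rewrite !mxE segintE; apply: eq_Rintegral => s _.
by rewrite mxE subr0 add0r.
Qed.

(** The integrand of Ainf and Areg. *)
Definition ray x i s := s * cross (B (s *: unit_dir x)) x 0 i.

Lemma AinfE x i : Ainf B x 0 i = (enorm x) ^- 2 * \int[mu]_(s in `[0, +oo[) ray x i s.
Proof.
rewrite /Ainf !mxE; congr (_ * _); apply: eq_Rintegral => s _.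
by rewrite mxE.
Qed.

Lemma AregE x i :
  Areg B x 0 i = - ((enorm x) ^- 2 * \int[mu]_(s in `[enorm x, +oo[) ray x i s).
Proof.
rewrite /Areg !mxE; congr (- (_ * _)); apply: eq_Rintegral => s _.
by rewrite mxE.
Qed.

Lemma continuous_ray x i : continuous (ray x i).
Proof.
apply: contM; first by cont.
by apply: cont_coord; apply: cont_cross; cont.
Qed.

Lemma field_coord_le x i : `|B x 0 i| <= C * (1 + enorm x) `^ (- r).
Proof. by apply: le_trans (coord_le_enorm _ _) _; exact: B_le. Qed.

Lemma ray_le x i s : x != 0 -> 0 <= s ->
  `|ray x i s| <= C * l1norm x * weight r s.
Proof.
move=> x0 s0; rewrite normrM.
have e1 : enorm (s *: unit_dir x) = s by rewrite enormZ enorm_unit_dir// mulr1 ger0_norm.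
have s1 : 0 < 1 + s by rewrite ltr_pwDl.
have H := norm_cross_le x i (fun j => field_coord_le (s *: unit_dir x) j).
rewrite e1 in H.
apply: le_trans (ler_wpM2l (normr_ge0 s) H) _.
rewrite [leLHS](_ : _ = C * l1norm x * (`|s| * (1 + s) `^ (- r))); last by ring.
apply: ler_wpM2l; first by rewrite mulr_ge0 ?l1norm_ge0// ltW.
rewrite /weight ger0_norm// powRD; last by apply/implyP => _; rewrite gt_eqF.
by rewrite powRr1 ?(ltW s1)// ler_wpM2r ?powR_ge0// lerDr.
Qed.

Let cst_ge0 x : 0 <= C * l1norm x.
Proof. by rewrite mulr_ge0 ?l1norm_ge0// ltW. Qed.

(** The integral over the ray is split at s = |x|; the inner part is Atr after the
    substitution s = |x| t. *)
Lemma Ainf_add_Areg x : x != 0 -> Ainf B x + Areg B x = Atr B x.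
Proof.
move=> x0; have e0 := enorm_gt0 x0; rewrite Atr_rpot; apply/rowP => i.
rewrite mxE AinfE AregE.
have cr := @continuous_ray x i.
have b := fun s => @ray_le x i s x0.
rewrite (tail_split r_gt2 (ltW e0) (cst_ge0 x) cr b) mulrDr addrK mxE.
have := segint_affine 0 e0 ler01 cr; rewrite mulr0 !addr0 mulr1 => <-.
have ct : continuous (fun t : R => t * cross (B (0 + t *: (x - 0))) (x - 0) 0 i).
  by apply: contM; [cont|apply: cont_coord; apply: cont_cross; cont].
have -> : segint 0 1 (fun t => ray x i (enorm x * t + 0)) =
    segint 0 1 (fun t => enorm x * (t * cross (B (0 + t *: (x - 0))) (x - 0) 0 i)).
  apply: eq_segint => t _; rewrite /ray addr0 subr0 add0r mulrA.
  congr (_ * cross (B _) _ _ _).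
  by rewrite /unit_dir scalerA mulrAC mulfV ?mul1r// gt_eqF.
rewrite segintZ// mulrA -expr2 mulrA mulVf ?mul1r//.
by rewrite expf_neq0// gt_eqF.
Qed.

Lemma unit_dirZ (k : R) x : 0 < k -> unit_dir (k *: x) = unit_dir x.
Proof.
move=> k0; rewrite /unit_dir enormZ gtr0_norm// invfM scalerA.
by rewrite mulrAC mulVf ?mul1r// gt_eqF.
Qed.

Lemma AinfZ (k : R) x : 0 < k -> x != 0 -> Ainf B (k *: x) = k^-1 *: Ainf B x.
Proof.
move=> k0 x0; apply/rowP => i; rewrite [RHS]mxE !AinfE enormZ (gtr0_norm k0).
have -> : ray (k *: x) i = fun s => k * ray x i s.
  by apply/funext => s; rewrite /ray unit_dirZ// !crossE !mxE; ring.
have gi := tail_integrable r_gt2 (lexx 0) (cst_ge0 x) (@continuous_ray x i) (fun s => @ray_le x i s x0).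
rewrite RintegralZl// mulrA mulrA; congr (_ * _).
have e0 := enorm_gt0 x0.
by field; rewrite !gt_eqF.
Qed.

Definition tail_cst : R := 3%:R * C * (r - 2%:R)^-1.

Lemma tail_cst_ge0 : 0 <= tail_cst.
Proof. by rewrite !mulr_ge0 ?invr_ge0 ?(ltW C_gt0)// subr_ge0 ltW. Qed.

Lemma Areg_le x i : x != 0 ->
  `|Areg B x 0 i| <= tail_cst * (enorm x)^-1 * (1 + enorm x) `^ (2%:R - r).
Proof.
move=> x0; have e0 := enorm_gt0 x0; rewrite AregE normrN normrM.
rewrite ger0_norm ?invr_ge0 ?exprn_ge0 ?(ltW e0)//.
have b s : enorm x <= s -> `|ray x i s| <= C * l1norm x * weight r s.
  by move=> es; apply: ray_le => //; exact: le_trans (ltW e0) es.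
have H := tail_bound r_gt2 (ltW e0) (cst_ge0 x) (@continuous_ray x i) b.
have k0 : 0 <= (enorm x) ^- 2 by rewrite invr_ge0 exprn_ge0// ltW.
apply: le_trans (ler_wpM2l k0 H) _.
rewrite /tail_cst; set w := _ `^ _.
rewrite [leLHS](_ : _ = C * (r - 2%:R)^-1 * w * (enorm x) ^- 2 * l1norm x); last by ring.
have k1 : 0 <= C * (r - 2%:R)^-1 * w * (enorm x) ^- 2.
  by rewrite !mulr_ge0 ?(ltW C_gt0)// ?invr_ge0 ?powR_ge0// ?subr_ge0 ?(ltW r_gt2)//.
apply: le_trans (ler_wpM2l k1 (l1norm_le_enorm x)) _.
rewrite le_eqVlt; apply/orP; left; apply/eqP.
by field; rewrite gt_eqF//= subr_eq0 gt_eqF.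
Qed.

(** As N grows this tends to Ainf: seen from far away, the transversal potential is
    its homogeneous part. *)
Definition Ascaled (N : R) x : 'rV[R]_3 := N *: rpot 0 B (N *: x).

Lemma continuous_Ascaled N : continuous (Ascaled N).
Proof. by have c := continuous_rpot (e := 0) B_cont; rewrite /Ascaled; cont. Qed.

(** Since Ainf is homogeneous of degree -1, the difference is N Areg (N x). *)
Lemma Ascaled_dist (m N : R) x i : 0 < N -> 0 < m -> m <= enorm x ->
  `|Ascaled N x 0 i - Ainf B x 0 i| <= tail_cst / m * (1 + N * m) `^ (2%:R - r).
Proof.
move=> N0 m0 mx.
have x0 : x != 0 by apply: contraTneq mx => ->; rewrite enorm0 -ltNge.
have Nx0 : N *: x != 0 by rewrite scaler_eq0 negb_or x0 gt_eqF.
have -> : Ascaled N x 0 i - Ainf B x 0 i = N * Areg B (N *: x) 0 i.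
  rewrite /Ascaled -Atr_rpot -Ainf_add_Areg// AinfZ// [X in X - _]mxE [X in N * X]mxE.
  rewrite [X in N * (X + _)]mxE mulrDr mulrA mulfV ?gt_eqF//.
  by rewrite mul1r [_ + N * _]addrC addrK.
rewrite normrM gtr0_norm//; apply: le_trans (ler_wpM2l (ltW N0) (Areg_le i Nx0)) _.
rewrite enormZ gtr0_norm//.
have e0 := enorm_gt0 x0.
rewrite [leLHS](_ : _ = tail_cst / enorm x * (1 + N * enorm x) `^ (2%:R - r)); last first.
  by field; rewrite !gt_eqF.
have Nm : 0 < 1 + N * m by rewrite ltr_pwDl// mulr_ge0 ?ltW.
have Ne : 0 < 1 + N * enorm x by rewrite ltr_pwDl// mulr_ge0 ?ltW.
apply: ler_pM; rewrite ?powR_ge0//.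
- by rewrite divr_ge0 ?tail_cst_ge0 ?ltW.
- by apply: ler_wpM2l; rewrite ?tail_cst_ge0// lef_pV2.
rewrite (_ : 2%:R - r = - (r - 2%:R)); last by rewrite opprB.
rewrite !powRN lef_pV2 ?posrE ?powR_gt0//.
rewrite ge0_ler_powR ?nnegrE ?(ltW Nm) ?(ltW Ne)//; first by rewrite subr_ge0 ltW.
by rewrite lerD2l ler_pM2l.
Qed.

(** The truncation of t to [0, 1], written with absolute values to make its
    continuity evident. *)
Definition clamp (t : R) : R := (`|t| - `|t - 1| + 1) / 2%:R.

Lemma clamp01 t : 0 <= clamp t <= 1.
Proof.
rewrite /clamp; case: (lerP 0 t) => h; first rewrite (ger0_norm h).
  case: (lerP 0 (t - 1)) => k; first by rewrite (ger0_norm k); apply/andP; split; lra.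
  by rewrite (ltr0_norm k); apply/andP; split; lra.
by rewrite (ltr0_norm h) ltr0_norm; [apply/andP; split; lra|lra].
Qed.

Lemma clamp_le0 t : t <= 0 -> clamp t = 0.
Proof. by move=> h; rewrite /clamp ler0_norm// ler0_norm; [field|lra]. Qed.

Lemma clamp_ge1 t : 1 <= t -> clamp t = 1.
Proof.
move=> h; rewrite /clamp ger0_norm; last by lra.
by rewrite ger0_norm; [field|lra].
Qed.

(** Equal to Ainf for 2 m <= |x| and to 0 for |x| <= m: a globally continuous
    substitute for Ainf away from its singularity. *)
Definition Acut (m : R) x : 'rV[R]_3 := clamp (enorm x / m - 1) *: Ainf B x.

Lemma AcutE m x : 0 < m -> 2%:R * m <= enorm x -> Acut m x = Ainf B x.
Proof.
move=> m0 mx; rewrite /Acut clamp_ge1 ?scale1r//.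
by rewrite lerBrDr ler_pdivlMr.
Qed.

(** The fields Ascaled N are continuous and converge to Ainf uniformly for
    m <= |x|. *)
Lemma continuous_Acut m : 0 < m -> continuous (Acut m).
Proof.
move=> m0; rewrite (_ : Acut m = fun x => \row_i (clamp (enorm x / m - 1) * Ainf B x 0 i)); last first.
  by apply/funext => x; apply/rowP => i; rewrite !mxE.
have cc : continuous (fun x => clamp (enorm x / m - 1)).
  by have ce := @cont_enorm R; rewrite /clamp; cont.
apply: cont_row => i; apply: continuous_unif_lim => d d0.
pose d' := d / (tail_cst / m + 1).
have k0 : 0 <= tail_cst / m by rewrite divr_ge0 ?tail_cst_ge0 ?ltW.
have d'0 : 0 < d' by rewrite divr_gt0// ltr_pwDr.
have rr : 0 < r - 2%:R by rewrite subr_gt0.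
have [T T0 HT] := powR_small rr d'0.
pose N := T / m.
have N0 : 0 < N by rewrite divr_gt0.
exists (fun x => clamp (enorm x / m - 1) * Ascaled N x 0 i).
  by have c := @continuous_Ascaled N; cont.
move=> x; rewrite -mulrBr normrM distrC.
have /andP[c0 c1] := clamp01 (enorm x / m - 1).
rewrite (ger0_norm c0).
have [mx|mx] := leP m (enorm x); last first.
  by rewrite clamp_le0 ?mul0r ?ltW// subr_lt0 ltr_pdivrMr// mul1r.
have H := Ascaled_dist i N0 m0 mx.
apply: le_trans (ler_pM c0 (normr_ge0 _) c1 H) _; rewrite mul1r.
have W : (1 + N * m) `^ (2%:R - r) <= d'.
  rewrite (_ : 2%:R - r = - (r - 2%:R)); last by rewrite opprB.
  apply: HT.
  by rewrite /N divfK ?gt_eqF// lerDr.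
apply: le_trans (ler_wpM2l k0 W) _.
move: k0; rewrite /d'; set k := tail_cst / m => k0.
rewrite mulrA ler_pdivrMr ?ltr_pwDr// mulrDr mulr1 (mulrC k).
by rewrite lerDl ltW.
Qed.

End FieldAtInfinity.

(** * Vanishing circulation of the field at infinity *)

Section PotentialAtInfinity.
Context {R : realType}.
Implicit Types (x y u v e p q n : 'rV[R]_3) (s t a : R).
Variable B : 'rV[R]_3 -> 'rV[R]_3.
Hypothesis B_cont : continuous B.
Hypothesis B_div : distr_div_free B.
Variable r : R.
Hypothesis r_gt2 : 2%:R < r.
Variable C : R.
Hypothesis C_gt0 : 0 < C.
Hypothesis B_le : forall x, enorm (B x) <= C * (1 + enorm x) `^ (- r).

Let cAs N : continuous (Ascaled B N) := @continuous_Ascaled R B B_cont N.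
Let cAc m (m0 : 0 < m) : continuous (Acut B m) := @continuous_Acut R B B_cont r r_gt2 C C_gt0 B_le m m0.

Lemma l1normD u v : l1norm (u + v) <= l1norm u + l1norm v.
Proof.
rewrite /l1norm !mxE.
have := ler_normD (u 0 0) (v 0 0); have := ler_normD (u 0 1) (v 0 1).
have := ler_normD (u 0 2%:R) (v 0 2%:R).
move: `|_ + _| `|_ + _| `|_ + _| => a b c; lra.
Qed.

Lemma l1normZ (k : R) u : l1norm (k *: u) = `|k| * l1norm u.
Proof. by rewrite /l1norm !mxE !normrM -!mulrDr. Qed.

Lemma dot_convex n p q t (d : R) : 0 <= t <= 1 -> d <= dot n p -> d <= dot n q ->
  d <= dot n (p + t *: (q - p)).
Proof.
move=> /andP[t0 t1] dp dq.
rewrite (_ : dot n _ = (1 - t) * dot n p + t * dot n q); last by rewrite !dotE !mxE; ring.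
have h1 : (1 - t) * d <= (1 - t) * dot n p by rewrite ler_wpM2l// subr_ge0.
have h2 : t * d <= t * dot n q by rewrite ler_wpM2l.
lra.
Qed.

Lemma halfspace_enorm n (d : R) x : d <= dot n x -> d / (l1norm n + 1) <= enorm x.
Proof.
move=> dx; have l0 := l1norm_ge0 n.
rewrite ler_pdivrMr ?ltr_pwDr//; apply: le_trans dx _.
have H := norm_dot_le n (coord_le_enorm x).
apply: le_trans (ler_norm _) _.
rewrite (_ : dot n x = dot x n); last by rewrite !dotE; ring.
apply: le_trans H _; rewrite [leRHS]mulrDr mulr1 lerDl; exact: enorm_ge0.
Qed.

Lemma lint_Acut (m : R) p q : 0 < m ->
  (forall t, 0 <= t <= 1 -> 2%:R * m <= enorm (p + t *: (q - p))) ->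
  lint (Ainf B) p q = lint (Acut B m) p q.
Proof. by move=> m0 H; apply: eq_segint => t t01; rewrite AcutE// H. Qed.

Lemma lint_scaled N p q : lint (rpot 0 B) (N *: p) (N *: q) = lint (Ascaled B N) p q.
Proof.
apply: eq_segint => t _; rewrite /Ascaled.
rewrite -scalerBr scalerA (mulrC t) -scalerA -scalerDr !dotE.
move: (rpot 0 B _) => w; rewrite !mxE; ring.
Qed.

Lemma Ainf_lint_dist (m N : R) p q : 0 < N -> 0 < m ->
  (forall t, 0 <= t <= 1 -> 2%:R * m <= enorm (p + t *: (q - p))) ->
  `|lint (Ascaled B N) p q - lint (Ainf B) p q| <=
  tail_cst r C / m * (1 + N * m) `^ (2%:R - r) * l1norm (q - p).
Proof.
move=> N0 m0 H; rewrite (lint_Acut m0 H).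
apply: lint_dist; [exact: cAs|exact: cAc|].
move=> t t01 i; have Ht := H t t01; rewrite AcutE//.
apply: (Ascaled_dist B_cont r_gt2 C_gt0 B_le) => //.
by apply: le_trans Ht; lra.
Qed.

(** The left-hand side is the absolute value of the flux of B through the dilated
    triangle (N e, N p, N q): the area is of order N^2 and B of order (1 + N m)^-r there. *)
Lemma lint_rpot_far (m N : R) e p q : 0 < N -> 0 < m ->
  (forall s t, 0 <= s <= 1 -> 0 <= t <= 1 -> m <= enorm (e + s *: (p + t *: (q - p) - e))) ->
  `|lint (rpot (N *: e) B) (N *: p) (N *: q)| <=
  C / m ^+ 2 * (1 + N * m) `^ (2%:R - r) * (l1norm (p - e) + l1norm (q - e)) * l1norm (q - p).
Proof.
move=> N0 m0 H.
have Nm : 0 < 1 + N * m by rewrite ltr_pwDl// mulr_ge0 ?ltW.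
set L := l1norm (p - e) + l1norm (q - e).
have L0 : 0 <= L by rewrite addr_ge0 ?l1norm_ge0.
have cr := @continuous_rpot R (N *: e) B B_cont.
set k := C * (1 + N * m) `^ (- r) * (N * L).
have k0 : 0 <= k by rewrite !mulr_ge0 ?powR_ge0 ?(ltW C_gt0) ?(ltW N0).
have cz : continuous (fun _ : 'rV[R]_3 => 0 : 'rV[R]_3) by exact: cont_cst.
have Z : lint (fun _ => 0) (N *: p) (N *: q) = 0 :> R.
  rewrite /lint (_ : (fun t => _) = fun _ => 0) ?segint_cst ?mul0r//.
  by apply/funext => t; rewrite dotE !mxE; ring.
rewrite -[X in `|X|]subr0 -Z.
have E : forall t, 0 <= t <= 1 -> forall i,
    `|rpot (N *: e) B (N *: p + t *: (N *: q - N *: p)) 0 i - (0 : 'rV[R]_3) 0 i| <= k.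
  move=> t t01 i.
  have -> : N *: p + t *: (N *: q - N *: p) = N *: (p + t *: (q - p)).
    by rewrite -scalerBr scalerA (mulrC t) -scalerA -scalerDr.
  set y := p + _; rewrite [X in _ - X]mxE subr0 mxE.
  rewrite -[leRHS]mulr1 -[X in _ <= _ * X]subr0.
  apply: ler_norm_segint => //.
    by apply: contM; [cont|apply: cont_coord; apply: cont_cross; cont].
  move=> s s01; rewrite normrM.
  have -> : N *: e + s *: (N *: y - N *: e) = N *: (e + s *: (y - e)).
    by rewrite -scalerBr scalerA (mulrC s) -scalerA -scalerDr.
  have ms := H s t s01 t01; rewrite -/y in ms.
  have Ly : l1norm (y - e) <= L.
    rewrite (_ : y - e = (1 - t) *: (p - e) + t *: (q - e)); last first.
      by apply/rowP => j; rewrite !mxE; ring.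
    apply: le_trans (l1normD _ _) _; rewrite !l1normZ.
    have /andP[t0 t1] := t01.
    rewrite ger0_norm ?subr_ge0// ger0_norm//.
    have h1 : (1 - t) * l1norm (p - e) <= 1 * l1norm (p - e).
      by rewrite ler_wpM2r ?l1norm_ge0//; lra.
    have h2 : t * l1norm (q - e) <= 1 * l1norm (q - e) by rewrite ler_wpM2r ?l1norm_ge0.
    by rewrite /L; lra.
  have bd j : `|B (N *: (e + s *: (y - e))) 0 j| <= C * (1 + N * m) `^ (- r).
    apply: le_trans (field_coord_le B_le _ _) _; rewrite ler_wpM2l ?(ltW C_gt0)//.
    have me : 1 + N * m <= 1 + enorm (N *: (e + s *: (y - e))).
      by rewrite enormZ (gtr0_norm N0) lerD2l ler_pM2l.
    have r0 : 0 <= r by apply: ltW; apply: lt_trans r_gt2.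
    have pe := lt_le_trans Nm me.
    rewrite !powRN lef_pV2 ?posrE ?powR_gt0//.
    by rewrite ge0_ler_powR ?nnegrE ?(ltW Nm) ?(ltW pe).
  have /andP[s0 s1] := s01.
  have K := norm_cross_le (N *: y - N *: e) i bd.
  rewrite -[leRHS]mul1r; apply: ler_pM => //; first by rewrite ger0_norm.
  apply: le_trans K _; rewrite /k -scalerBr l1normZ (gtr0_norm N0).
  by rewrite ler_wpM2l ?ler_pM2l// mulr_ge0 ?powR_ge0// ltW.
apply: le_trans (lint_dist cr cz E) _.
rewrite -scalerBr l1normZ (gtr0_norm N0) (mulrA k) /k.
apply: ler_wpM2r; first exact: l1norm_ge0.
rewrite [leLHS](_ : _ = C * (N ^+ 2 * (1 + N * m) `^ (- r)) * L); last by ring.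
apply: ler_wpM2r => //; rewrite -mulrA; apply: ler_wpM2l; first exact: ltW.
rewrite powRD; last by apply/implyP => _; rewrite gt_eqF.
rewrite mulrA; apply: ler_wpM2r; first exact: powR_ge0.
rewrite powR_mulrn ?(ltW Nm)// -exprVn -exprMn lerXn2r ?nnegrE ?(ltW N0)//.
  by rewrite mulr_ge0 ?invr_ge0 ?(ltW m0) ?(ltW Nm).
by rewrite ler_pdivlMl// mulrC; lra.
Qed.

(** The transgression formula for the triangle dilated by N: its circulations tend
    to those of Ainf, while the flux of B through it tends to 0. The half-space
    keeps the triangle away from 0, where Ainf is singular. *)
Lemma Ainf_triangle n e p q : 0 < dot n e -> 0 < dot n p -> 0 < dot n q ->
  lint (Ainf B) e q - lint (Ainf B) e p = lint (Ainf B) p q.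
Proof.
move=> ne np nq.
pose d := Num.min (dot n e) (Num.min (dot n p) (dot n q)).
have d0 : 0 < d by rewrite !lt_min ne np nq.
have [de dp dq] : [/\ d <= dot n e, d <= dot n p & d <= dot n q].
  by split; rewrite /d !ge_min lexx ?orbT.
pose m := d / (l1norm n + 1) / 2%:R.
have m0 : 0 < m by rewrite !divr_gt0// ltr_pwDr// l1norm_ge0.
have far x : d <= dot n x -> 2%:R * m <= enorm x.
  by move=> /halfspace_enorm; rewrite /m [2%:R * _]mulrC divfK.
have seg x y : d <= dot n x -> d <= dot n y ->
    forall t, 0 <= t <= 1 -> 2%:R * m <= enorm (x + t *: (y - x)).
  by move=> dx dy t t01; apply: far; exact: dot_convex.
have tri s t : 0 <= s <= 1 -> 0 <= t <= 1 -> m <= enorm (e + s *: (p + t *: (q - p) - e)).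
  move=> s01 t01; apply: (@le_trans _ _ (2%:R * m)); first lra.
  by apply: far; apply: dot_convex => //; exact: dot_convex.
pose K1 := tail_cst r C / m.
pose K := K1 * l1norm (q - e) + K1 * l1norm (p - e) + K1 * l1norm (q - p) +
  C / m ^+ 2 * (l1norm (p - e) + l1norm (q - e)) * l1norm (q - p).
have K10 : 0 <= K1 by rewrite divr_ge0 ?(tail_cst_ge0 r_gt2 C_gt0) ?ltW.
have K0 : 0 <= K.
  have Cm : 0 <= C / m ^+ 2 by rewrite divr_ge0 ?(ltW C_gt0)// exprn_ge0// ltW.
  by rewrite /K !addr_ge0// mulr_ge0 ?l1norm_ge0// mulr_ge0// addr_ge0 ?l1norm_ge0.
apply/eqP; rewrite -subr_eq0 -normr_le0; apply/ler_addgt0Pl => eps eps0; rewrite addr0.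
have rr : 0 < r - 2%:R by rewrite subr_gt0.
have K1' : 0 < K + 1 by rewrite ltr_pwDr.
have [T T0 HT] := powR_small rr (divr_gt0 eps0 K1').
pose N := T / m.
have N0 : 0 < N by rewrite divr_gt0.
pose w := (1 + N * m) `^ (2%:R - r).
have w0 : 0 <= w by exact: powR_ge0.
have wd : w <= eps / (K + 1).
  rewrite /w (_ : 2%:R - r = - (r - 2%:R)); last by rewrite opprB.
  by apply: HT; rewrite /N divfK ?gt_eqF// lerDr.
have E1 := Ainf_lint_dist N0 m0 (seg _ _ de dq).
have E2 := Ainf_lint_dist N0 m0 (seg _ _ de dp).
have E3 := Ainf_lint_dist N0 m0 (seg _ _ dp dq).
have E4 := lint_rpot_far N0 m0 tri.
have := transgression (N *: e) (N *: p) (N *: q) B_cont B_div.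
rewrite !lint_scaled => E.
rewrite -/K1 -/w in E1 E2 E3 E4.
move: E E1 E2 E3 E4.
set j1 := lint (Ainf B) e q; set j2 := lint (Ainf B) e p; set j3 := lint (Ainf B) p q.
set i1 := lint _ e q; set i2 := lint _ e p; set i3 := lint _ p q; set i4 := lint _ _ _.
move=> E E1 E2 E3 E4.
have -> : j1 - j2 - j3 = - (i1 - j1) + (i2 - j2) + (i3 - j3) - i4.
  by rewrite (_ : i4 = i3 - (i1 - i2)); [ring|rewrite E; ring].
apply: (@le_trans _ _ (K * w)).
  apply: le_trans (ler_normB _ _) _.
  apply: le_trans (lerD (ler_normD _ _) (lexx _)) _.
  apply: le_trans (lerD (lerD (ler_normD _ _) (lexx _)) (lexx _)) _.
  rewrite normrN; apply: le_trans (lerD (lerD (lerD E1 E2) E3) E4) _.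
  by rewrite le_eqVlt; apply/orP; left; apply/eqP; rewrite /K; ring.
apply: le_trans (ler_wpM2l K0 wd) _.
rewrite mulrA ler_pdivrMr// mulrDr mulr1 (mulrC K).
by rewrite lerDl ltW.
Qed.

End PotentialAtInfinity.

(** * A primitive of the field at infinity *)

Section ScalarPotential.
Context {R : realType}.
Implicit Types (x y u v e p q n w d : 'rV[R]_3) (s t a : R).
Variable B : 'rV[R]_3 -> 'rV[R]_3.
Hypothesis B_cont : continuous B.
Hypothesis B_div : distr_div_free B.
Variable r : R.
Hypothesis r_gt2 : 2%:R < r.
Variable C : R.
Hypothesis C_gt0 : 0 < C.
Hypothesis B_le : forall x, enorm (B x) <= C * (1 + enorm x) `^ (- r).

Let cAc m (m0 : 0 < m) : continuous (Acut B m) := @continuous_Acut R B B_cont r r_gt2 C C_gt0 B_le m m0.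
Let triangle n e p q := @Ainf_triangle R B B_cont B_div r r_gt2 C C_gt0 B_le n e p q.

Local Notation J := (lint (Ainf B)).
Local Notation b0 := (basis_vec R 0).
Local Notation b1 := (basis_vec R 1).
Local Notation b2 := (basis_vec R 2%:R).

Lemma dot_basis n i : dot n (basis_vec R i) = n 0 i.
Proof.
rewrite /dot (bigD1 i)//= big1 ?addr0 ?basis_vecE ?eqxx ?mulr1// => l lk.
by rewrite basis_vecE eq_sym (negbTE lk) mulr0.
Qed.

Lemma dotDl u v w : dot (u + v) w = dot u w + dot v w.
Proof. by rewrite !dotE !mxE; ring. Qed.

Lemma dotZl (k : R) u w : dot (k *: u) w = k * dot u w.
Proof. by rewrite !dotE !mxE; ring. Qed.

Lemma dotNl u w : dot (- u) w = - dot u w.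
Proof. by rewrite !dotE !mxE; ring. Qed.

Lemma dotC u v : dot u v = dot v u.
Proof. by rewrite !dotE; ring. Qed.

(** Add to w a small multiple of e. *)
Lemma tilt w e d x : dot w e = 0 -> 0 < dot e e -> 0 < dot w d -> 0 < dot w x ->
  exists n, [/\ 0 < dot n e, 0 < dot n d & 0 < dot n x].
Proof.
move=> we ee wd wx.
pose k := 1 + `|dot e d| + `|dot e x|.
have k0 : 0 < k by rewrite ltr_pwDl// ltr_pwDl.
pose eps := Num.min (dot w d) (dot w x) / k.
have e0 : 0 < eps by rewrite divr_gt0// lt_min wd wx.
have ek : eps * k = Num.min (dot w d) (dot w x) by rewrite divfK// gt_eqF.
have pos y : eps * k <= dot w y -> `|dot e y| < k -> 0 < dot (w + eps *: e) y.
  move=> wy ey; rewrite dotDl dotZl.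
  have h : eps * `|dot e y| < eps * k by rewrite ltr_pM2l.
  have h2 : eps * - dot e y <= eps * `|dot e y| by rewrite ler_pM2l// -normrN ler_norm.
  rewrite mulrN in h2; lra.
have l1 : `|dot e d| < k by rewrite /k; have := normr_ge0 (dot e x); lra.
have l2 : `|dot e x| < k by rewrite /k; have := normr_ge0 (dot e d); lra.
exists (w + eps *: e); split.
- by rewrite dotDl dotZl we add0r mulr_gt0.
- by apply: pos => //; rewrite ek ge_min lexx.
- by apply: pos => //; rewrite ek ge_min lexx orbT.
Qed.

(** For e != 0: x is off the closed half-line opposite to e. *)
Definition seen e x := exists n, 0 < dot n e /\ 0 < dot n x.

Definition vec_of (a b c : R) : 'rV[R]_3 := a *: b0 + b *: b1 + c *: b2.

Lemma dot_vec_of a b c x : dot (vec_of a b c) x = a * x 0 0 + b * x 0 1 + c * x 0 2%:R.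
Proof. by rewrite /vec_of !dotDl !dotZl ![dot (basis_vec R _) x]dotC !dot_basis. Qed.

Lemma dot_b0 x : dot b0 x = x 0 0.
Proof. by rewrite dotC dot_basis. Qed.

Lemma dot_nb0 x : dot (- b0) x = - x 0 0.
Proof. by rewrite dotNl dot_b0. Qed.

Lemma dot_b0_b0 : dot b0 b0 = 1 :> R.
Proof. by rewrite dot_basis basis_vecE. Qed.

Lemma seen_off_axis x : x 0 1 != 0 \/ x 0 2%:R != 0 -> seen b0 x.
Proof.
move=> H; pose w := vec_of 0 (x 0 1) (x 0 2%:R).
have p : 0 < dot w x.
  rewrite dot_vec_of mul0r add0r -!expr2.
  by case: H => H; [apply: ltr_pwDl|apply: ltr_wpDl]; rewrite ?exprn_even_gt0// ?sqr_ge0.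
have w0 : dot w b0 = 0 by rewrite dot_vec_of !basis_vecE /=; ring.
have bb : 0 < dot b0 b0 :> R by rewrite dot_b0_b0.
by have [n [nb nx _]] := tilt w0 bb p p; exists n.
Qed.

Lemma unseenP x : ~ seen b0 x -> [/\ x 0 1 = 0, x 0 2%:R = 0 & x 0 0 <= 0].
Proof.
move=> H; split.
- by apply/eqP/negPn/negP => h; apply: H; apply: seen_off_axis; left.
- by apply/eqP/negPn/negP => h; apply: H; apply: seen_off_axis; right.
rewrite leNgt; apply/negP => h; apply: H; exists b0.
by rewrite dot_b0_b0 dot_b0.
Qed.

Lemma seen_neg x : x 0 0 < 0 -> seen b0 x -> x 0 1 != 0 \/ x 0 2%:R != 0.
Proof.
move=> x0 [n [nb nx]]; have [x1|h] := eqVneq (x 0 1) 0; last by left.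
right; apply/eqP => x2; move: nx; rewrite dot_basis in nb.
by rewrite dotE x1 x2 !mulr0 !addr0 pmulr_rgt0// ltNge (ltW x0).
Qed.

(** The half-space of normal w can be tilted both towards b0 and towards - b0, and
    the two triangles thus obtained share the side from d to x. *)
Lemma gap_half w d x : dot w b0 = 0 -> 0 < dot w d -> 0 < dot w x ->
  J b0 x - J (- b0) x = J b0 d - J (- b0) d.
Proof.
move=> wb wd wx.
have bb : 0 < dot b0 b0 :> R by rewrite dot_b0_b0.
have bb' : 0 < dot (- b0) (- b0) :> R by rewrite dotNl dotC dotNl dot_b0_b0 opprK.
have wb' : dot w (- b0) = 0 by rewrite dotC dotNl dotC wb oppr0.
have [n [n1 n2 n3]] := tilt wb bb wd wx.
have [n' [n1' n2' n3']] := tilt wb' bb' wd wx.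
have E := triangle n1 n2 n3; have E' := triangle n1' n2' n3'.
lra.
Qed.

(** A half-space bounded by a plane through the axis contains both x and b1, unless
    their projections along the axis are opposite; then b2 serves as an
    intermediate point. *)
Lemma gap_const x : x 0 1 != 0 \/ x 0 2%:R != 0 ->
  J b0 x - J (- b0) x = J b0 b1 - J (- b0) b1.
Proof.
move=> H.
have base a b : dot (vec_of 0 a b) b0 = 0 by rewrite dot_vec_of !basis_vecE /=; ring.
have ax a b : dot (vec_of 0 a b) x = a * x 0 1 + b * x 0 2%:R by rewrite dot_vec_of; ring.
have a1 a b : dot (vec_of 0 a b) b1 = a by rewrite dot_vec_of !basis_vecE /=; ring.
have a2 a b : dot (vec_of 0 a b) b2 = b by rewrite dot_vec_of !basis_vecE /=; ring.
have [x2|x2] := eqVneq (x 0 2%:R) 0; last first.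
  apply: (gap_half (base 1 ((1 - x 0 1) / x 0 2%:R))); first by rewrite a1.
  by rewrite ax divfK// mul1r addrC subrK.
have x1 : x 0 1 != 0 by case: H => //; rewrite x2 eqxx.
have [x1p|x1n|x1z] := ltgtP (x 0 1) 0; last by rewrite x1z eqxx in x1.
  rewrite (gap_half (base (-1) 1) (d := b2)).
  - by apply: (gap_half (base 1 1)); rewrite ?a1 ?a2.
  - by rewrite a2.
  - by rewrite ax x2 mulr0 addr0 mulN1r oppr_gt0.
by apply: (gap_half (base 1 0)); rewrite ?a1// ax x2 mulr0 addr0 mul1r.
Qed.

(** Integrate Ainf from b0 along segments; on the half-line opposite to b0, where
    such segments meet 0, integrate from - b0 and add the constant by which the
    two choices differ off the axis. This makes explicit that the complement of 0
    is simply connected. *)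
Definition Vpot x : R :=
  if `[< seen b0 x >] then J b0 x else J b0 b1 - J (- b0) b1 + J (- b0) x.

Lemma near_dot_gt n p (z : R) : z < dot n p -> \forall q \near p, z < dot n q.
Proof.
have c : continuous (dot n) by apply: cont_dot; [exact: cont_cst|exact: cont_id].
by move=> np; exact: (@cvgr_gt R _ (nbhs p) _ (dot n) (dot n p) (c p) z np).
Qed.

(** The point p and its neighbours lie with b0, or else with - b0, in a half-space
    to which the triangle identity applies. *)
Lemma Vpot_near p : p != 0 -> \forall q \near p, Vpot q - Vpot p = J p q.
Proof.
move=> p0; have [[n [nb np]]|H] := pselect (seen b0 p).
  apply: filterS (near_dot_gt np) => q nq; rewrite /Vpot !asboolT; [|by exists n|by exists n].
  exact: (triangle nb np nq).
have [p1 p2 p0'] := unseenP H.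
have pn : p 0 0 < 0.
  rewrite lt_neqAle p0' andbT; apply: contra_neq p0 => z; apply/rowP => i; rewrite mxE.
  by move: i; apply: ord3_ind.
have np : 0 < dot (- b0) p by rewrite dot_nb0 oppr_gt0.
apply: filterS (near_dot_gt np) => q nq.
have bb' : 0 < dot (- b0) (- b0) :> R by rewrite dotNl dotC dotNl dot_b0_b0 opprK.
have E := triangle bb' np nq; rewrite /Vpot [`[< seen b0 p >]]asboolF//.
case: asboolP => [S|_]; last by lra.
have qn : q 0 0 < 0 by move: nq; rewrite dot_nb0 oppr_gt0.
have := gap_const (seen_neg qn S); lra.
Qed.

Lemma Vpot_near_cut p : p != 0 -> exists m, [/\ 0 < m, 2%:R * m <= enorm p &
  \forall q \near p, Vpot q - Vpot p = lint (Acut B m) p q].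
Proof.
move=> p0; have pp : 0 < dot p p.
  by have := enorm_gt0 p0; rewrite /enorm sqrtr_gt0.
pose d := dot p p / 2%:R.
have d0 : 0 < d by rewrite divr_gt0.
pose m := d / (l1norm p + 1) / 2%:R.
have m0 : 0 < m by rewrite !divr_gt0// ltr_pwDr// l1norm_ge0.
have far x : d <= dot p x -> 2%:R * m <= enorm x.
  by move=> /halfspace_enorm; rewrite /m [2%:R * _]mulrC divfK.
have dp : d < dot p p by rewrite /d; lra.
exists m; split => //; first by apply: far; exact: ltW.
apply: filterS2 (Vpot_near p0) (near_dot_gt dp) => q -> dq.
apply: lint_Acut => // t t01; apply: far; apply: dot_convex => //; exact: ltW.
Qed.

(** With w = c (t + h) - c t, the difference quotient is the integral over s in
    [0, 1] of the product of F (c t + s w) with w / h, which is jointly continuous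
    in the pair (w, w / h). *)
Lemma is_derive_primitive_comp (V : 'rV[R]_3 -> R) (F : 'rV[R]_3 -> 'rV[R]_3)
    (c : R -> 'rV[R]_3) t v : continuous F -> is_derive t 1 c v ->
  (\forall q \near c t, V q - V (c t) = lint F (c t) q) ->
  is_derive t 1 (fun t => V (c t)) (dot (F (c t)) v).
Proof.
move=> cF dc; set p := c t => Vp.
pose Psi (w : 'rV[R]_3 * 'rV[R]_3) := segint 0 1 (fun s => dot (F (p + s *: w.1)) w.2).
have cPsi : continuous Psi.
  apply: (continuous_segint (f := fun (w : 'rV[R]_3 * 'rV[R]_3) s => dot (F (p + s *: w.1)) w.2)) => //.
  by apply: cont_dot; cont.
have Psi0 : Psi (0, v) = dot (F p) v.
  rewrite /Psi /= (_ : (fun s => _) = fun _ => dot (F p) v); last first.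
    by apply/funext => s; rewrite scaler0 addr0.
  by rewrite segint_cst// subr0 mulr1.
have [dc1 dc2] := dc.
have cc : {for t, continuous c} by apply: differentiable_continuous; apply/derivable1_diffP.
have cs : c (h *: 1 + t) @[h --> 0^'] --> p.
  apply: cvg_within_filter.
  have c2 : continuous (fun h : R => h *: (1 : R) + t) by cont.
  have c3 : (fun h : R => h *: (1 : R) + t) @ nbhs (0 : R) --> t.
    by have := c2 0; rewrite /continuous_at scale0r add0r.
  exact: (cvg_comp _ _ c3 cc).
have cw : c (h *: 1 + t) - p @[h --> 0^'] --> (0 : 'rV[R]_3).
  by rewrite -(subrr p); apply: cvgB => //; exact: cvg_cst.
have cq : h^-1 *: (c (h *: 1 + t) - p) @[h --> 0^'] --> v.
  rewrite -dc2; exact: dc1.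
have L : h^-1 *: (((fun t => V (c t)) \o shift t) (h *: 1) - V p) @[h --> 0^'] --> dot (F p) v.
  rewrite -Psi0.
  apply: (@cvg_trans _ (Psi (c (h *: 1 + t) - p, h^-1 *: (c (h *: 1 + t) - p)) @[h --> 0^'])).
    have N : \forall h \near (0 : R)^',
      V (c (h *: 1 + t)) - V p = lint F p (c (h *: 1 + t)) := cs _ Vp.
    apply: near_eq_cvg; apply: filterS N => h /= Eh.
    rewrite Eh; set q := c _; transitivity (h^-1 * lint F p q) => //.
    rewrite /Psi /lint/= -segintZ//; last by apply: cont_dot; cont.
    by apply: eq_segint => s _; rewrite !dotE !mxE; ring.
  apply: (cvg_comp _ _ (cvg_pair cw cq)); exact: cPsi.
by apply: DeriveDef; [exact: cvgP L|exact: cvg_lim L].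
Qed.

Lemma Vpot_comp (c : R -> 'rV[R]_3) t v : c t != 0 -> is_derive t 1 c v ->
  is_derive t 1 (fun t => Vpot (c t)) (dot (Ainf B (c t)) v).
Proof.
move=> p0 dc; have [m [m0 mp Vp]] := Vpot_near_cut p0.
by rewrite -(AcutE B m0 mp); exact: (is_derive_primitive_comp (cAc m0) dc Vp).
Qed.

Lemma is_derive_Vpot x v : x != 0 -> is_derive x v Vpot (dot (Ainf B x) v).
Proof.
move=> x0; apply/is_derive_line.
have dl : is_derive (0 : R) 1 (fun h : R => x + h *: v) v.
  apply/(is_derive_line (id : 'rV[R]_3 -> 'rV[R]_3)); exact: is_derive_id.
have := @Vpot_comp (fun h : R => x + h *: v) 0 v.
by rewrite scale0r addr0; apply.
Qed.

End ScalarPotential.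

(** * Integration along contours *)

Section Contours.
Context {R : realType}.
Implicit Types (x y u v e p q : 'rV[R]_3) (s t a b c : R).
Notation mu := (@lebesgue_measure R).

Lemma integrable_cat a b c (f : R -> R) : a <= b -> b <= c ->
  mu.-integrable `]a, b] (EFin \o f) -> mu.-integrable `]b, c] (EFin \o f) ->
  mu.-integrable `]a, c] (EFin \o f) /\
  \int[mu]_(t in `]a, c]) f t = \int[mu]_(t in `]a, b]) f t + \int[mu]_(t in `]b, c]) f t.
Proof.
move=> ab bc i1 i2.
have U : `]a, c]%classic = `]a, b]%classic `|` `]b, c]%classic :> set R.
  by apply: itv_bndbnd_setU; rewrite bnd_simp.
have D : [disjoint `]a, b]%classic & `]b, c]%classic].
  apply/disj_setPS => t [] /=; rewrite !in_itv/= => /andP[_ tb] /andP[bt _].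
  by move: (lt_le_trans bt tb); rewrite ltxx.
have m1 : measurable (`]a, b]%classic : set (measurableTypeR R)) by exact: measurable_itv.
have m2 : measurable (`]b, c]%classic : set (measurableTypeR R)) by exact: measurable_itv.
have [mf1 if1] := integrableP _ _ _ i1; have [mf2 if2] := integrableP _ _ _ i2.
have mU : measurable_fun (`]a, b]%classic `|` `]b, c]%classic) (EFin \o f).
  by apply/measurable_funU.
have I : mu.-integrable (`]a, b]%classic `|` `]b, c]%classic) (EFin \o f).
  apply/integrableP; split => //.
  rewrite ge0_integral_setU//; first exact: lte_add_pinfty.
  exact: measurableT_comp.
by rewrite U; split => //; rewrite Rintegral_setU.
Qed.

Variable B : 'rV[R]_3 -> 'rV[R]_3.
Hypothesis B_cont : continuous B.
Hypothesis B_div : distr_div_free B.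
Variable r : R.
Hypothesis r_gt2 : 2%:R < r.
Variable C : R.
Hypothesis C_gt0 : 0 < C.
Hypothesis B_le : forall x, enorm (B x) <= C * (1 + enorm x) `^ (- r).

Notation integrand g := (fun t => dot (Ainf B (g t)) ('D_1 g t)).

(** In the interior of [a, b] the path has the derivative of its C^1 extension, and
    the end points are negligible. *)
Lemma line_integral_piece a b (g : R -> 'rV[R]_3) : a < b -> C1_path_on a b g ->
  (forall t, a <= t <= b -> g t != 0) ->
  mu.-integrable `]a, b] (EFin \o integrand g) /\
  \int[mu]_(t in `]a, b]) integrand g t = Vpot B (g b) - Vpot B (g a).
Proof.
move=> ab [h [dh cdh gh]] g0.
have ch : continuous h.
  by move=> t; apply: differentiable_continuous; apply/derivable1_diffP.
have ce : continuous (fun t => enorm (h t)).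
  by apply: (cont_comp (g := @enorm R)) => //; exact: cont_enorm.
have [c cab cmin] := EVT_min (ltW ab) (continuous_subspaceT ce).
rewrite in_itv/= in cab.
pose m := enorm (h c) / 2%:R.
have m0 : 0 < m by rewrite divr_gt0// enorm_gt0// -gh// g0.
have mh t : a <= t <= b -> 2%:R * m <= enorm (h t).
  by move=> tab; rewrite /m mulrC divfK// cmin// in_itv.
have cA := continuous_Acut B_cont r_gt2 C_gt0 B_le m0.
pose F t := dot (Acut B m (h t)) ('D_1 h t).
have cF : continuous F by rewrite /F; apply: cont_dot; cont.
have dV t : a <= t <= b -> is_derive t 1 (fun t => Vpot B (h t)) (F t).
  move=> tab; rewrite /F AcutE ?mh//.
  apply: (Vpot_comp B_cont B_div r_gt2 C_gt0 B_le); first by rewrite -gh// g0.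
  by apply: DeriveDef.
have val := segint_FTC2 (ltW ab) cF dV.
have E t : t \in `]a, b[%classic -> (EFin \o F) t = (EFin \o integrand g) t.
  rewrite inE/= in_itv/= => /andP[at_ tb]; congr EFin.
  have tab : a <= t <= b by rewrite !ltW.
  have -> : 'D_1 g t = 'D_1 h t.
    apply: near_eq_derive; near=> s; apply: gh; apply/andP; split; apply: ltW.
      near: s; exact: lt_nbhsr.
    near: s; exact: lt_nbhsl.
  by rewrite /F (AcutE _ m0 (mh _ tab)) (gh _ tab).
have iF : mu.-integrable `[a, b] (EFin \o F) by exact: continuous_segment_integrable.
have iFo : mu.-integrable `]a, b[ (EFin \o F).
  by apply: integrableS iF => //; apply: subset_itv; rewrite bnd_simp.
have mo : measurable (`]a, b[%classic : set (measurableTypeR R)) by exact: measurable_itv.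
have igo : mu.-integrable `]a, b[ (EFin \o integrand g) .
  exact: (@eq_integrable _ _ R mu _ mo (EFin \o F) (EFin \o integrand g) E iFo).
have ig : mu.-integrable `]a, b] (EFin \o integrand g).
  have D : `]a, b]%classic `\ b = `]a, b[%classic :> set R by rewrite setDitv1r.
  have [H _] := integrableP _ _ _ igo.
  have mf : measurable_fun `]a, b] (EFin \o integrand g).
    by apply/measurable_EFinP; apply: measurable_fun_itv_oc; apply/measurable_EFinP; exact: H.
  have mb : measurable ([set b] : set (measurableTypeR R)) by exact: measurable_set1.
  have mc : measurable (`]a, b]%classic : set (measurableTypeR R)) by exact: measurable_itv.
  have [_] := negligible_integrable mb mc mf (lebesgue_measure_set1 b).
  by apply; rewrite D.
have iFc : mu.-integrable `]a, b] (EFin \o F).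
  by apply: integrableS iF => //; apply: subset_itv; rewrite bnd_simp.
have e1 : \int[mu]_(t in `]a, b[) integrand g t = \int[mu]_(t in `]a, b]) integrand g t.
  exact: Rintegral_itv_bndo_bndc igo.
have e2 : \int[mu]_(t in `]a, b[) F t = \int[mu]_(t in `]a, b]) F t.
  exact: Rintegral_itv_bndo_bndc iFo.
have e3 : \int[mu]_(t in `]a, b]) F t = \int[mu]_(t in `[a, b]) F t.
  exact: Rintegral_itv_obnd_cbnd iFc.
have e4 : \int[mu]_(t in `]a, b[) F t = \int[mu]_(t in `]a, b[) integrand g t.
  by apply: eq_Rintegral => t /E; case.
have aab : a <= a <= b by rewrite lexx ltW.
have bab : a <= b <= b by rewrite lexx ltW.
split; first exact: ig.
apply: (etrans (esym e1)); apply: (etrans (esym e4)); apply: (etrans e2); apply: (etrans e3).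
rewrite -segintE; apply: (etrans val).
by congr (Vpot B _ - Vpot B _); [exact: esym (gh b bab)|exact: esym (gh a aab)].
Unshelve. all: by end_near. Qed.

Lemma line_integral_partition (g : R -> 'rV[R]_3) (l : seq R) a b :
  itv_partition a b l -> (forall t, a <= t <= b -> g t != 0) ->
  (forall i, (i < size l)%N -> C1_path_on (a :: l)`_i l`_i g) ->
  mu.-integrable `]a, b] (EFin \o integrand g) /\
  \int[mu]_(t in `]a, b]) integrand g t = Vpot B (g b) - Vpot B (g a).
Proof.
elim: l a => [a /itv_partition_nil <- _ _|c l IH a H g0 Hp].
  rewrite set_itvoc0; split; first exact: integrable_set0.
  by rewrite Rintegral_set0 subrr.
have [/= /andP[ac _] _] := H.
have cb := itv_partition_le (itv_partition_cons H).
have [i1 v1] : mu.-integrable `]a, c] (EFin \o integrand g) /\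
    \int[mu]_(t in `]a, c]) integrand g t = Vpot B (g c) - Vpot B (g a).
  apply: line_integral_piece => //; first exact: (Hp 0%N isT).
  by move=> t /andP[at_ tc]; apply: g0; rewrite at_ (le_trans tc).
have [||i2 v2] := IH c (itv_partition_cons H).
- by move=> t /andP[ct tb]; apply: g0; rewrite tb (le_trans (ltW ac)).
- by move=> i si; exact: (Hp i.+1 si).
have [i v] := integrable_cat (ltW ac) cb i1 i2.
by split => //; rewrite v v1 v2; ring.
Qed.

Lemma line_integral_contour x y (g : R -> 'rV[R]_3) : contour x y g ->
  line_integral (Ainf B) g = Vpot B y - Vpot B x.
Proof.
move=> [<- <- g0 [l lp lC]].
have [i v] := line_integral_partition lp g0 lC.
by rewrite -v /line_integral Rintegral_itv_obnd_cbnd.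
Qed.

End Contours.

(** * Gauge changes in the sense of distributions *)

Section GaugeChange.
Context {R : realType}.
Implicit Types (x y u v p q : 'rV[R]_3) (s t a b c : R) (f phi : 'rV[R]_3 -> R).

Lemma distr_partialB i f g phi (M : R) : 0 <= M -> continuous f -> continuous g ->
  continuous (partial i phi) -> supported_in M (partial i phi) ->
  distr_partial i (fun x => f x - g x) phi = distr_partial i f phi - distr_partial i g phi.
Proof.
move=> M0 cf cg cp sp; rewrite /distr_partial.
rewrite !(@integral3_box _ M)//; [|by cont|exact: supported_inMr|by cont|exact: supported_inMr|by cont|exact: supported_inMr].
rewrite (_ : (fun x => (f x - g x) * _) = fun x => f x * partial i phi x + (-1) * (g x * partial i phi x)); last first.
  by apply/funext => x; ring.
rewrite box_intD//; [|by cont|by cont].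
by rewrite box_intZ//; [ring|by cont].
Qed.

(** Integration by parts moves the derivative from f to phi on both sides, and the
    second derivatives of phi commute. *)
Lemma distr_curl_grad f (df : 'I_3 -> 'rV[R]_3 -> R) phi j k :
  continuous f -> (forall i, continuous (df i)) ->
  (forall i x, is_derive x (basis_vec R i) f (df i x)) -> test_function phi ->
  distr_partial j (df k) phi = distr_partial k (df j) phi.
Proof.
move=> cf cdf Df [sphi /compact_support_supported[M M0 sM]].
have [cphi dphi] := sphi 1%N; have [_ d2phi] := sphi 2%N.
have cd l : continuous (partial l phi) by have [] := dphi l.
have MN : M < M + 1 by rewrite ltrDl.
have NP : M + 1 < M + 1 + 1 by rewrite ltrDl.
have N0 : 0 <= M + 1 by rewrite addr_ge0.
have P0 : 0 <= M + 1 + 1 by rewrite addr_ge0.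
have sd l : supported_in (M + 1) (partial l phi) by exact: supported_in_partial sM.
have sd' l : supported_in (M + 1 + 1) (partial l phi) by apply: supported_in_le (sd l); exact: ltW.
have sdd l i : supported_in (M + 1 + 1) (partial i (partial l phi)).
  exact: supported_in_partial (sd l).
have dd l i x : derivable (partial l phi) x (basis_vec R i).
  by have [_ [_ /(_ i)[+ _]]] := d2phi l; exact.
have cdd l i : continuous (partial i (partial l phi)).
  by have [_ [_ /(_ i)[_]]] := d2phi l.
have ibp l i : integral3 (fun x => df i x * partial l phi x) =
    - integral3 (fun x => f x * partial i (partial l phi) x).
  have c1 : continuous (fun x => df i x * partial l phi x).
    by have := @cd l; have := @cdf i => ? ?; cont.
  have c2 : continuous (fun x => f x * partial i (partial l phi) x).
    by have := @cdd l i => ?; cont.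
  have dprod x : is_derive x (basis_vec R i) (fun x => f x * partial l phi x)
      (df i x * partial l phi x + f x * partial i (partial l phi) x).
    exact: derM (Df i x) (derivableP (dd l i x)).
  have E : partial i (fun x => f x * partial l phi x) =
      fun x => df i x * partial l phi x + f x * partial i (partial l phi) x.
    by apply/funext => x; rewrite /partial; have ? := dprod x; exact: derive_val.
  have s12 : supported_in (M + 1 + 1) (fun x => df i x * partial l phi x + f x * partial i (partial l phi) x).
    by move=> x m Mx; rewrite (sd' l x m)// (sdd l i x m)// !mulr0 addr0.
  have c12 : continuous (fun x => df i x * partial l phi x + f x * partial i (partial l phi) x).
    exact: contD.
  have D x : derivable (fun x => f x * partial l phi x) x (basis_vec R i).
    by have ? := dprod x; exact: ex_derive.
  have s0 : supported_in (M + 1) (fun x => f x * partial l phi x) by exact: supported_inMr.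
  have := integral3_partial (i := i) N0 s0 D.
  rewrite E => /(_ c12); rewrite (integral3_box P0 c12 s12) box_intD// => /eqP.
  rewrite addr_eq0 => /eqP H.
  rewrite (integral3_box P0 c1); last exact: supported_inMr.
  by rewrite (integral3_box P0 c2) ?H//; exact: supported_inMr.
by rewrite /distr_partial (ibp j k) (ibp k j) (partialC j k (sphi 2%N)).
Qed.

End GaugeChange.

(** * The cut-off gauge change *)

Section CutoffGauge.
Context {R : realType}.
Implicit Types (x y u v p q : 'rV[R]_3) (s t a b c : R).
Variable B : 'rV[R]_3 -> 'rV[R]_3.
Hypothesis B_cont : continuous B.
Hypothesis B_div : distr_div_free B.
Variable r : R.
Hypothesis r_gt2 : 2%:R < r.
Variable C : R.
Hypothesis C_gt0 : 0 < C.
Hypothesis B_le : forall x, enorm (B x) <= C * (1 + enorm x) `^ (- r).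
Variables (k R1 : R) (eta : 'rV[R]_3 -> R).
Hypothesis R1_gt0 : 0 < R1.
Hypothesis eta_smooth : smooth eta.
Hypothesis eta_0 : forall x, enorm x <= R1 -> eta x = 0.

(** The function eta U: by line_integral_contour, U is Vpot B - k for some k. *)
Definition cutpot x := eta x * (Vpot B x - k).

Definition dcutpot i x := partial i eta x * (Vpot B x - k) + eta x * Ainf B x 0 i.

Lemma near_enorm_lt x (d : R) : enorm x < d -> \forall y \near x, enorm y < d.
Proof. by move=> xd; exact: (@cvgr_lt R _ (nbhs x) _ (@enorm R) (enorm x) (@cont_enorm R x) d xd). Qed.

Lemma near_enorm_gt x (d : R) : d < enorm x -> \forall y \near x, d < enorm y.
Proof. by move=> xd; exact: (@cvgr_gt R _ (nbhs x) _ (@enorm R) (enorm x) (@cont_enorm R x) d xd). Qed.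

Let cut0 x : enorm x < R1 -> cutpot x = 0.
Proof. by move=> xR; rewrite /cutpot eta_0 ?mul0r// ltW. Qed.

Lemma partial_eta0 i x : enorm x < R1 -> partial i eta x = 0.
Proof.
move=> xR; have D : is_derive x (basis_vec R i) eta 0.
  apply: (@near_eq_is_derive R _ _ (fun=> 0) eta x _ 0 _ (der_cst x (basis_vec R i) 0)).
  by apply: filterS (near_enorm_lt xR) => y yR; rewrite eta_0// ltW.
rewrite /partial; exact: derive_val.
Qed.

Let dcut0 i x : enorm x < R1 -> dcutpot i x = 0.
Proof. by move=> xR; rewrite /dcutpot eta_0 ?(ltW xR)// partial_eta0// !mul0r addr0. Qed.

Let dichotomy x : enorm x < R1 \/ x != 0.
Proof.
by have [->|] := eqVneq x 0; [left; rewrite enorm0|right].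
Qed.

(** Near 0 both functions vanish with eta; elsewhere Vpot is differentiable. *)
Lemma is_derive_cutpot i x : is_derive x (basis_vec R i) cutpot (dcutpot i x).
Proof.
have [xR|x0] := dichotomy x.
  rewrite dcut0//.
  apply: (@near_eq_is_derive R _ _ (fun=> 0) cutpot x _ 0 _ (der_cst x (basis_vec R i) 0)).
  by apply: filterS (near_enorm_lt xR) => y yR; rewrite cut0.
have [_ /(_ i)[de _]] := eta_smooth 1%N.
have dV := is_derive_Vpot B_cont B_div r_gt2 C_gt0 B_le (basis_vec R i) x0.
rewrite dot_basis in dV.
have := derM (derivableP (de x)) (derB dV (der_cst x (basis_vec R i) k)).
by rewrite subr0.
Qed.

Lemma Vpot_continuous_near p : p != 0 -> exists V A, [/\ continuous V, continuous A &
  \forall y \near p, Vpot B y = V y /\ Ainf B y = A y].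
Proof.
move=> p0; have [m [m0 mp Vp]] := Vpot_near_cut B_cont B_div r_gt2 C_gt0 B_le p0.
have e0 := enorm_gt0 p0.
pose m' := enorm p / 4%:R.
have m'0 : 0 < m' by rewrite divr_gt0.
have c1 := continuous_Acut B_cont r_gt2 C_gt0 B_le m0.
have c2 := continuous_Acut B_cont r_gt2 C_gt0 B_le m'0.
have cL : continuous (fun y => lint (Acut B m) p y).
  apply: (cont_lint (F := fun _ => Acut B m) (a := fun=> p) (b := id)); cont.
exists (fun y => lint (Acut B m) p y + Vpot B p), (Acut B m'); split => //; first by cont.
have mp' : 2%:R * m' < enorm p by rewrite /m'; lra.
apply: filterS2 Vp (near_enorm_gt mp') => y <- ym.
by rewrite subrK AcutE// ltW.
Qed.

Lemma continuous_cutpot : continuous cutpot.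
Proof.
have ce : continuous eta := eta_smooth 0%N.
apply: continuous_locally => p; have [pR|p0] := dichotomy p.
  exists (fun=> 0); first exact: cont_cst.
  by apply: filterS (near_enorm_lt pR) => y yR; rewrite cut0.
have [V [A [cV cA VA]]] := Vpot_continuous_near p0.
exists (fun y => eta y * (V y - k)); first by cont.
by apply: filterS VA => y [Vy _]; rewrite /cutpot Vy.
Qed.

Lemma continuous_dcutpot i : continuous (dcutpot i).
Proof.
have ce : continuous eta := eta_smooth 0%N.
have [_ /(_ i)[_ cde]] := eta_smooth 1%N.
rewrite /= in cde.
apply: continuous_locally => p; have [pR|p0] := dichotomy p.
  exists (fun=> 0); first exact: cont_cst.
  by apply: filterS (near_enorm_lt pR) => y yR; rewrite dcut0.
have [V [A [cV cA VA]]] := Vpot_continuous_near p0.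
exists (fun y => partial i eta y * (V y - k) + eta y * A y 0 i); first by cont.
by apply: filterS VA => y [Vy Ay]; rewrite /dcutpot Vy Ay.
Qed.

Definition gauged x : 'rV[R]_3 := rpot 0 B x - \row_i dcutpot i x.

Lemma continuous_gauged : continuous gauged.
Proof.
have cr := continuous_rpot (e := 0) B_cont; have cd := continuous_dcutpot.
have cw : continuous (fun x => \row_i dcutpot i x) by apply: cont_row.
by rewrite /gauged; cont.
Qed.

Lemma distr_curl_gauged : distr_curl_eq gauged B.
Proof.
have cr := continuous_rpot (e := 0) B_cont; have cd := continuous_dcutpot.
have cg := continuous_gauged.
have [_ [lB H]] := distr_curl_rpot B_cont B_div.
split; first by move=> i; apply: continuous_loc_integrable; rewrite /component; cont.
split; first exact: lB.
move=> phi tphi i; rewrite -(H phi tphi i).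
have [sphi /compact_support_supported[M M0 sM]] := tphi.
have [cphi dphi] := sphi 1%N.
have cp l : continuous (partial l phi) by have [] := dphi l.
have MN : M < M + 1 by rewrite ltrDl.
have N0 : 0 <= M + 1 by rewrite addr_ge0.
have sd l : supported_in (M + 1) (partial l phi) by exact: supported_in_partial sM.
have E l : component gauged l = fun x => component (rpot 0 B) l x - dcutpot l x.
  by apply/funext => x; rewrite /component /gauged [LHS]mxE; congr (_ + _); rewrite !mxE.
have cc l : continuous (component (rpot 0 B) l) by rewrite /component; cont.
have s1 := sd (i + 1); have s2 := sd (i + 2%:R).
have H1 := distr_partialB (i := i + 1) N0 (cc (i + 2%:R)) (@cd (i + 2%:R)) (cp _) s1.
have H2 := distr_partialB (i := i + 2%:R) N0 (cc (i + 1)) (@cd (i + 1)) (cp _) s2.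
have G := distr_curl_grad (i + 1) (i + 2%:R) continuous_cutpot cd is_derive_cutpot tphi.
rewrite !E.
have aux (a b c d : R) : c = d -> (a - c) - (b - d) = a - b by move=> ->; ring.
rewrite H1 H2.
exact: aux G.
Qed.

Lemma gaugedE x : x != 0 ->
  gauged x = Areg B x + (1 - eta x) *: Ainf B x - (Vpot B x - k) *: grad eta x.
Proof.
move=> x0; rewrite /gauged -Atr_rpot -(Ainf_add_Areg B_cont r_gt2 C_gt0 B_le x0).
rewrite (_ : \row_i dcutpot i x = (Vpot B x - k) *: grad eta x + eta x *: Ainf B x); last first.
  apply/rowP => i; rewrite mxE /dcutpot [RHS]mxE; congr (_ + _); rewrite [RHS]mxE//.
  by rewrite [X in _ = _ * X]mxE mulrC.
move: (Areg B x) (Ainf B x) (grad eta x) (Vpot B x - k) => a b g w.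
by rewrite scalerBl scale1r opprD !addrA addrAC [b + a]addrC.
Qed.

End CutoffGauge.

(** * Decay and support of the potential *)

Section Decay.
Context {R : realType}.
Implicit Types (x y u v p q : 'rV[R]_3) (s t a b c : R).
Variable B : 'rV[R]_3 -> 'rV[R]_3.
Hypothesis B_cont : continuous B.
Hypothesis B_div : distr_div_free B.
Variable r : R.
Hypothesis r_gt2 : 2%:R < r.
Variable C : R.
Hypothesis C_gt0 : 0 < C.
Hypothesis B_le : forall x, enorm (B x) <= C * (1 + enorm x) `^ (- r).
Variables (k R1 R2 : R) (eta : 'rV[R]_3 -> R).
Hypothesis R1_gt0 : 0 < R1.
Hypothesis R1_lt_R2 : R1 < R2.
Hypothesis eta_smooth : smooth eta.
Hypothesis eta_1 : forall x, R2 <= enorm x -> eta x = 1.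
Hypothesis eta_0 : forall x, enorm x <= R1 -> eta x = 0.

Let R2_gt0 : 0 < R2. Proof. exact: lt_trans R1_lt_R2. Qed.

Let far_neq0 x : R2 < enorm x -> x != 0.
Proof.
by apply: contraTneq => ->; rewrite enorm0 -leNgt ltW.
Qed.

Lemma grad_eta_far x : R2 < enorm x -> grad eta x = 0.
Proof.
move=> xR; apply/rowP => i; rewrite !mxE.
have D : is_derive x (basis_vec R i) eta 0.
  apply: (@near_eq_is_derive R _ _ (fun=> 1 : R) eta x _ 0 _ (der_cst x (basis_vec R i) (1 : R))).
  by apply: filterS (near_enorm_gt xR) => y yR; rewrite eta_1// ltW.
by rewrite /partial; exact: derive_val.
Qed.

Lemma gauged_far x : R2 < enorm x -> gauged B k eta x = Areg B x.
Proof.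
move=> xR; rewrite (gaugedE B_cont r_gt2 C_gt0 B_le k eta (far_neq0 xR)) grad_eta_far//.
by rewrite eta_1 ?(ltW xR)// subrr scale0r scaler0 addr0 subr0.
Qed.

Lemma gauged_bounded_on_ball (M : R) :
  exists2 D, 0 <= D & forall x, enorm x <= M -> forall i, `|gauged B k eta x 0 i| <= D.
Proof.
have cg : continuous (gauged B k eta) .
  move=> x; exact: (continuous_gauged B_cont B_div r_gt2 C_gt0 B_le R1_gt0 eta_smooth eta_0).
have H i : exists2 D, 0 <= D & forall x, enorm x <= M -> `|gauged B k eta x 0 i| <= D.
  have [D D0 HD] := continuous_bounded_on (@compact_box R M) (cont_coord (i := i) cg).
  by exists D => // x xM; apply: HD => j; apply: le_trans xM; exact: coord_le_enorm.
have [D0 D00 H0] := H 0; have [D1 D10 H1] := H 1; have [D2 D20 H2] := H 2%:R.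
exists (D0 + D1 + D2); first by rewrite !addr_ge0.
move=> x xM; have h0 := H0 x xM; have h1 := H1 x xM; have h2 := H2 x xM.
by apply: ord3_ind; lra.
Qed.

(** Beyond R2 the potential is Areg, of order |x|^-1 (1 + |x|)^(2 - r); on the ball
    of radius R2 it is bounded by continuity. *)
Lemma gauged_decay : decays (gauged B k eta) (r - 1).
Proof.
have [D D0 HD] := gauged_bounded_on_ball R2.
have T0 := tail_cst_ge0 r_gt2 C_gt0.
pose w := (1 + R2) `^ (- (r - 1)).
have R21 : 0 < 1 + R2 by rewrite addr_gt0.
have w0 : 0 < w by exact: powR_gt0.
pose K := tail_cst r C * ((1 + R2) / R2).
have K0 : 0 <= K by rewrite mulr_ge0// divr_ge0 ?(ltW R21) ?(ltW R2_gt0).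
have Dw0 : 0 <= D / w by rewrite divr_ge0// ltW.
exists (3%:R * (D / w + K) + 1); first by rewrite ltr_pwDr// mulr_ge0// addr_ge0.
move=> x; have e0 := enorm_ge0 x.
have x1 : 0 < 1 + enorm x by rewrite ltr_pwDl.
have p0 : 0 < (1 + enorm x) `^ (- (r - 1)) by exact: powR_gt0.
suff H i : `|gauged B k eta x 0 i| <= (D / w + K) * (1 + enorm x) `^ (- (r - 1)).
  apply: le_trans (enorm_le_coord H) _; rewrite mulrA.
  by apply: ler_wpM2r; [exact: ltW|rewrite lerDl].
have [xR|Rx] := leP (enorm x) R2.
  apply: le_trans (HD _ xR i) _.
  have wx : w <= (1 + enorm x) `^ (- (r - 1)).
    rewrite /w !powRN lef_pV2 ?posrE ?powR_gt0//.
    rewrite ge0_ler_powR ?nnegrE ?(ltW x1) ?(ltW R21)//; last by rewrite lerD2l.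
    by have := r_gt2; lra.
  apply: (@le_trans _ _ (D / w * w)); first by rewrite divfK// gt_eqF.
  apply: le_trans (ler_wpM2l Dw0 wx) _.
  by rewrite [leRHS]mulrDl lerDl mulr_ge0// ltW.
rewrite gauged_far//; apply: le_trans (Areg_le B_cont r_gt2 C_gt0 B_le i (far_neq0 Rx)) _.
have e1 : 0 < enorm x by exact: lt_trans Rx.
rewrite (_ : 2%:R - r = 1 + - (r - 1)); last by ring.
rewrite powRD; last by apply/implyP => _; rewrite gt_eqF.
rewrite powRr1 ?(ltW x1)// mulrA; apply: ler_wpM2r; first exact: ltW.
apply: (@le_trans _ _ K); last by rewrite lerDr.
rewrite /K -mulrA; apply: ler_wpM2l => //.
rewrite mulrC ler_pdivrMr// mulrAC ler_pdivlMr//.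
by rewrite mulrDl mulrDl mul1r mul1r mulrC lerD2r ltW.
Qed.

(** Beyond R2 the potential is Areg x, an integral of B over points at distance at
    least |x| from 0. *)
Lemma gauged_compact_support : compact_support B -> compact_support (gauged B k eta).
Proof.
move=> /compact_support_supported[M M0 sM].
have B0 y : 3%:R * M < enorm y -> B y = 0.
  move=> My; apply: contraTeq My => By; rewrite -leNgt; apply: enorm_le_coord => i.
  by rewrite leNgt; apply: contra_neqN By => /ltW; exact: sM.
apply: (@supported_compact_support R _ (R2 + 3%:R * M + 1)) => x i xi.
have ex : R2 + 3%:R * M + 1 <= enorm x by apply: le_trans xi _; exact: coord_le_enorm.
have M3 : 0 <= 3%:R * M by rewrite mulr_ge0.
have xR : R2 < enorm x by have := R2_gt0; lra.
have xM : 3%:R * M < enorm x by have := R2_gt0; lra.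
rewrite gauged_far//; apply/rowP => j; rewrite AregE mxE.
rewrite (_ : \int[_]_(s in _) _ = 0) ?mulr0 ?oppr0//.
rewrite /Rintegral integral0_eq// => s; rewrite /= in_itv/= andbT => xs; congr EFin.
have s0 : 0 <= s := le_trans (enorm_ge0 x) xs.
rewrite /ray B0; first by rewrite crossE !mxE; ring.
by rewrite enormZ enorm_unit_dir ?far_neq0// mulr1 ger0_norm// (lt_le_trans xM).
Qed.

End Decay.

Theorem proposition5p1 (R : realType) (B : 'rV[R]_3 -> 'rV[R]_3) (r : R)
    (x0 : 'rV[R]_3) (Gamma : 'rV[R]_3 -> R -> 'rV[R]_3)
    (R1 R2 : R) (eta : 'rV[R]_3 -> R)
    (B_cont : continuous B)
    (B_div : distr_div_free B)
    (r_gt2 : 2%:R < r)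
    (B_decay : decays B r)
    (x0_neq0 : x0 != 0)
    (Gamma_contour : forall x, x != 0 -> contour x0 x (Gamma x))
    (R1_gt0 : 0 < R1)
    (R1_lt_R2 : R1 < R2)
    (eta_smooth : smooth eta)
    (eta_1 : forall x, R2 <= enorm x -> eta x = 1)
    (eta_0 : forall x, enorm x <= R1 -> eta x = 0) :
  let U := Upot B Gamma in
  let A := magnetic_potential B Gamma eta in
  [/\ forall x, x != 0 ->
        A x = Areg B x + (1 - eta x) *: Ainf B x - U x *: grad eta x,
      distr_curl_eq A B,
      exists2 rho : R, 1 < rho & decays A rho &
      compact_support B -> compact_support A].
Proof.
move=> U A; have [C C_gt0 B_le] := B_decay.
pose k := Vpot B x0.
have UE x : x != 0 -> U x = Vpot B x - k.
  move=> x_neq0; rewrite /U /Upot.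
  exact: (line_integral_contour B_cont B_div r_gt2 C_gt0 B_le (Gamma_contour x x_neq0)).
have AE : A = gauged B k eta.
  apply/funext => x; rewrite /A /magnetic_potential /gauged Atr_rpot; congr (_ - _).
  have -> : (fun y => eta y * Upot B Gamma y) = cutpot B k eta.
    apply/funext => y; rewrite /cutpot; have [->|y_neq0] := eqVneq y 0.
      by rewrite eta_0 ?mul0r// enorm0 ltW.
    by rewrite -UE.
  apply/rowP => i; rewrite !mxE /partial.
  have D := is_derive_cutpot B_cont B_div r_gt2 C_gt0 B_le k R1_gt0 eta_smooth eta_0 i x.
  exact: derive_val.
split.
- move=> x x_neq0; rewrite AE UE//.
  exact: (gaugedE B_cont r_gt2 C_gt0 B_le).
- rewrite AE; exact: (distr_curl_gauged B_cont B_div r_gt2 C_gt0 B_le k R1_gt0 eta_smooth eta_0).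
- exists (r - 1); first by lra.
  rewrite AE; exact: (gauged_decay B_cont B_div r_gt2 C_gt0 B_le k R1_gt0 R1_lt_R2 eta_smooth eta_1 eta_0).
- rewrite AE => cB.
  by apply: (gauged_compact_support B_cont r_gt2 C_gt0 B_le R1_gt0 R1_lt_R2 eta_1).
Qed.
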